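(* Let $\mathcal O=\mathbb Z[\tfrac12(1+\sqrt{-3})]$ be the ring of Eisenstein integers and let $L=g\,\mathcal O^2\subset\mathbb C^2$ be a random lattice, where the coset $g\,\mathrm{SL}_2(\mathcal O)$ is distributed according to the invariant probability measure on $\mathrm{SL}_2(\mathbb C)/\mathrm{SL}_2(\mathcal O)$. Then the length $t$ of the shortest nonzero vector of $L$ has probability density function $$\frac1{v}\Big\{\chi_{0<t<1}\,t^3\frac{\sqrt3}2+\chi_{1<t<(4/3)^{1/4}}\,t^3\Big(\frac{\sqrt3}2-\pi\big(1-\tfrac1{t^4}\big)\Big)$$ $$+\chi_{(4/3)^{1/4}<t<(3/2)^{1/4}}\,t^3\Big(\frac{\sqrt3}2-\pi\big(1-\tfrac1{t^4}\big)+6\big(1-\tfrac1{t^4}\big)\arctan\big(3-\tfrac4{t^4}\big)^{1/2}-\frac32\big(3-\tfrac4{t^4}\big)^{1/2}\Big)\Big\},$$ where $v=\frac14\operatorname{Im}L_2\!\big(\frac{1+i\sqrt3}2\big)$ and $L_2(z)=\sum_{n=1}^\infty z^n/n^2$ is the dilogarithm.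
   Context: $\chi_A$ equals $1$ if $A$ holds and $0$ otherwise; $\arctan(x)^{1/2}$ means $\arctan(\sqrt{x})$. Lengths are with respect to the standard Hermitian norm on $\mathbb C^2$. The quotient $\mathrm{SL}_2(\mathbb C)/\mathrm{SL}_2(\mathcal O)$ has finite volume for the measure induced by Haar measure, so it carries a unique $\mathrm{SL}_2(\mathbb C)$-invariant probability measure; the columns of $g$ are a basis of the lattice $L$ over $\mathcal O$. *)

(* Defs.v *)
From HB Require Import structures.
From mathcomp Require Import all_boot all_order all_algebra.
From mathcomp Require Import generic_quotient complex.
From mathcomp Require Import all_classical all_reals all_analysis.

Set Implicit Arguments.
Unset Strict Implicit.
Unset Printing Implicit Defensive.

Import Order.TTheory GRing.Theory Num.Theory.
Import numFieldNormedType.Exports.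

Local Open Scope classical_set_scope.
Local Open Scope ring_scope.
Local Open Scope complex_scope.
Local Open Scope quotient_scope.

(* The usual topology of the complex numbers, i.e. the one of the norm; the
   topology of 'M[R[i]]_2 is then the entrywise one. *)
HB.instance Definition _ (R : realType) :=
  NormedModule.copy R[i] ((R[i] : numFieldType)^o).

Definition SL2C_set (R : realType) : set 'M[R[i]]_2 :=
  [set g : 'M[R[i]]_2 | \det g = 1].
Arguments SL2C_set : clear implicits.

(* SL_2(C), with the topology induced by that of 'M[R[i]]_2. *)
Definition SL2C (R : realType) : Type := set_type (SL2C_set R).

HB.instance Definition _ (R : realType) :=
  Topological.copy (SL2C R) (set_type (SL2C_set R)).

Definition SL2C_mx (R : realType) (g : SL2C R) : 'M[R[i]]_2 := set_val g.
Coercion SL2C_mx : SL2C >-> matrix.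

Lemma SL2C_det (R : realType) (g : SL2C R) : \det (g : 'M[R[i]]_2) = 1.
Proof. exact: (set_mem (svalP g)). Qed.

Definition SL2C_of (R : realType) (g : 'M[R[i]]_2) (dg : \det g = 1) : SL2C R :=
  SigSub (mem_set dg : g \in SL2C_set R).

Definition SL2C_one (R : realType) : SL2C R := SL2C_of (@det1 R[i] 2).

HB.instance Definition _ (R : realType) :=
  isPointed.Build (SL2C R) (SL2C_one R).

Lemma SL2C_mul_subproof (R : realType) (g h : SL2C R) :
  \det ((g : 'M[R[i]]_2) *m h) = 1.
Proof. by rewrite det_mulmx !SL2C_det mulr1. Qed.

Definition SL2C_mul (R : realType) (g h : SL2C R) : SL2C R :=
  SL2C_of (SL2C_mul_subproof g h).

Definition eisenstein_unit (R : realType) : R[i] := 2^-1 +i* (Num.sqrt 3 / 2).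

Definition eisenstein (R : realType) : set R[i] :=
  [set a%:~R + b%:~R * eisenstein_unit R | a in [set: int] & b in [set: int]].
Arguments eisenstein : clear implicits.

Definition SL2O (R : realType) : set (SL2C R) :=
  [set g : SL2C R | forall i j, eisenstein R ((g : 'M[R[i]]_2) i j)].
Arguments SL2O : clear implicits.

Definition left_coset (R : realType) (g : SL2C R) : set (SL2C R) :=
  [set SL2C_mul g h | h in SL2O R].

Definition same_coset (R : realType) : rel (SL2C R) :=
  fun g h => `[< left_coset g = left_coset h >].

Lemma same_coset_equiv (R : realType) : equiv_class_of (@same_coset R).
Proof.
split=> [g|g h|h g k]; first exact/asboolP.
- by apply/asboolP/asboolP.
- by move=> /asboolP hg /asboolP gk; apply/asboolP; rewrite hg.
Qed.

Canonical same_coset_equiv_rel (R : realType) :=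
  EquivRelPack (@same_coset_equiv R).

(* SL_2(C)/SL_2(O) with the quotient topology. *)
Definition coset_space (R : realType) :=
  quotient_topology {eq_quot (@same_coset R)}.

(* SL_2(C)/SL_2(O) with its Borel sigma-algebra. *)
Definition coset_borel (R : realType) :=
  g_sigma_algebraType (@open (coset_space R)).

Definition coset_of (R : realType) (g : SL2C R) : coset_borel R :=
  \pi_(coset_space R) g.

Definition translate (R : realType) (h : SL2C R) (A : set (coset_borel R)) :
    set (coset_borel R) :=
  [set coset_of (SL2C_mul h g) | g in [set g : SL2C R | A (coset_of g)]].

Definition SL2C_invariant (R : realType)
    (mu : set (coset_borel R) -> \bar R) : Prop :=
  forall (h : SL2C R) (A : set (coset_borel R)),
    measurable A -> mu (translate h A) = mu A.

Definition has_law (d d' : measure_display) (Omega : measurableType d)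
    (T : measurableType d') (R : realType) (P : probability Omega R)
    (X : Omega -> T) (mu : probability T R) : Prop :=
  measurable_fun [set: Omega] X /\
  forall A : set T, measurable A -> P (X @^-1` A) = mu A.

Definition has_density (d : measure_display) (Omega : measurableType d)
    (R : realType) (P : probability Omega R) (X : Omega -> R) (f : R -> R) :
    Prop :=
  [/\ measurable_fun [set: Omega] X,
      measurable_fun [set: R] f,
      forall t, 0 <= f t &
      forall A : set R, measurable A ->
        P (X @^-1` A) = (\int[lebesgue_measure]_(t in A) (f t)%:E)%E].

Definition lattice_of (R : realType) (g : 'M[R[i]]_2) : set 'cV[R[i]]_2 :=
  [set g *m x | x in [set x : 'cV[R[i]]_2 | forall i, eisenstein R (x i 0)]].

(* The standard Hermitian norm on C^2; the library norm `|v| on 'cV[R[i]]_2 is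
   the sup norm. *)
Definition hermitian_norm (R : realType) (v : 'cV[R[i]]_2) : R :=
  Num.sqrt (\sum_i ComplexField.Normc.normc (v i 0) ^+ 2).

(* The minimum of the lengths of the nonzero vectors of L (and the default
   value 0 when this minimum does not exist). *)
Definition shortest_length (R : realType) (L : set 'cV[R[i]]_2) : R :=
  let S := [set hermitian_norm v | v in L `\ 0] in xget 0 (S `&` lbound S).

Definition dilog (R : realType) (z : R[i]) : R[i] :=
  limn (series (fun n : nat => z ^+ n.+1 / n.+1%:R ^+ 2)).

(* Main.v *)
(** Write a basis of the lattice as the columns v, w of g in SL_2(C).  Reduction
    theory over the Eisenstein integers shows that every coset contains two
    bases g, -g (and generically no other) such that |v| <= |w| and z = <w,v>/|v|^2
    lies in a third of the hexagonal Voronoi cell of O; then v is a shortest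
    vector.  Averaging against a bi-invariant functional (a Haar measure, obtained
    from Lebesgue measure on the cone 0 < |det| <= 1) shows that the probability
    that the shortest length lies in A is proportional to the Haar measure of the
    reduced bases with |v| in A.  In the coordinates w = z v + d v^perp/|v|^2 this
    measure is the integral over t in A of t^3 times the area of the z in the cell
    with |z|^2 >= 1 - 1/t^4, which is elementary.  The total mass reduces to
    the integral of ln(4/(3-q^2))/(1+q^2) over 0 <= q <= 1/sqrt 3, that is, by the
    duplication formula of the Lobachevsky function L(x) = - int_0^x ln(2 sin t) dt,
    to L(pi/3)/2; and Im L_2(exp(i pi/3)) = 3 L(pi/3). *)

Require Import Defs.
From HB Require Import structures.
From mathcomp Require Import all_boot all_order all_algebra.
From mathcomp Require Import generic_quotient complex.
From mathcomp Require Import all_classical all_reals all_analysis.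
From mathcomp Require Import measurable_realfun ring lra zify.

Set Implicit Arguments.
Unset Strict Implicit.
Unset Printing Implicit Defensive.

Import Order.TTheory GRing.Theory Num.Theory.
Import numFieldNormedType.Exports.

Local Open Scope classical_set_scope.
Local Open Scope ring_scope.
Local Open Scope complex_scope.

(** * Linear changes of variables for Lebesgue measure *)

(** The invariant probability is an arbitrary [mu], so its comparison with [haar] has to produce the
    proportionality itself: [mu] unfolds to a left invariant functional [lam] on the group, and
    Tonelli's theorem for the two functionals gives [lam f * haar h = lam h * haar (f \o inverse)];
    the constant is then fixed by the total mass 1 of [mu]. Finite volume comes out of the
    computation of the total mass. The boundary of the reduction domain is not treated as a null
    set. Instead a flag [o] selects strict or weak inequalities: every coset has at least two bases
    for the weak ones and at most two for the strict ones, both sets have the same explicit Haar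
    measure, and the law of the length is squeezed between them. The quotient only has its Borel
    sigma-algebra, so a Borel section [lift] is built to turn sums over a coset into measurable
    series. The breakpoints 1, 4/3 and 3/2 of t^4 are the values at which the disc of squared radius
    1 - 1/t^4 appears, touches the sides of the hexagon (squared inradius 1/4) and swallows it
    (squared circumradius 1/3). *)

Section ProdMeasure.
Context d1 d2 (T1 : measurableType d1) (T2 : measurableType d2) (R : realType).
Context (m1 : {sigma_finite_measure set T1 -> \bar R}).
Context (m2 : {sigma_finite_measure set T2 -> \bar R}).

(** The product is given a name so that sigma-finiteness can be attached to it; [prodm] can then be
    iterated up to the eight real dimensions of [leb8]. *)
Definition prod_meas : set (T1 * T2) -> \bar R := (m1 \x m2)%E.

HB.instance Definition _ := Measure.copy prod_meas (m1 \x m2)%E.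

Lemma prod_meas_sigma_finite : sigma_finite setT prod_meas.
Proof.
have /sigma_finiteP[F [TF ndF Foo]] := sigma_finiteT m1.
have /sigma_finiteP[G [TG ndG Goo]] := sigma_finiteT m2.
exists (fun n => F n `*` G n).
  rewrite -setXTT TF TG; apply/seteqP; split => [[x y] /= [[n _ Fx] [k _ Gy]]|].
    exists (maxn n k) => //; split.
    - by move: x Fx; exact/subsetPset/ndF/leq_maxl.
    - by move: y Gy; exact/subsetPset/ndG/leq_maxr.
  by move=> [x y] [n _ [Fx Gy]]; split; exists n.
move=> k; have [mF Fk] := Foo k; have [mG Gk] := Goo k.
split; first exact: measurableX.
by rewrite /prod_meas product_measure1E// lte_mul_pinfty// ge0_fin_numE.
Qed.

HB.instance Definition _ :=
  Measure_isSigmaFinite.Build _ _ _ prod_meas prod_meas_sigma_finite.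

Definition prodm : {sigma_finite_measure set (T1 * T2)%type -> \bar R} := prod_meas.

Section Tonelli.
Local Open Scope ereal_scope.
Variable f : T1 * T2 -> \bar R.
Hypotheses (mf : measurable_fun setT f) (f0 : forall x, 0 <= f x).

Lemma prodm_tonelli1 :
  \int[prodm]_z f z = \int[m1]_x \int[m2]_y f (x, y).
Proof. exact: fubini_tonelli1. Qed.

Lemma prodm_tonelli2 :
  \int[prodm]_z f z = \int[m2]_y \int[m1]_x f (x, y).
Proof. by rewrite prodm_tonelli1 fubini_tonelli. Qed.

Lemma measurable_int1 : measurable_fun setT (fun x => \int[m2]_y f (x, y)).
Proof. exact: measurable_fun_fubini_tonelli_F. Qed.

Lemma measurable_int2 : measurable_fun setT (fun y => \int[m1]_x f (x, y)).
Proof. exact: measurable_fun_fubini_tonelli_G. Qed.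

End Tonelli.

End ProdMeasure.

Lemma measurable_set_bool d (T : measurableType d) (b : T -> bool) :
  measurable_fun setT b -> measurable [set x | b x].
Proof. by move=> mb; have := mb measurableT [set true] I; rewrite setTI. Qed.

Section ScalesDef.
Context {R : realType}.
Local Open Scope ereal_scope.

(* The change of variables [phi] multiplies the measure by [c]. *)
Definition scales d (T : measurableType d) (m : set T -> \bar R) (c : R)
    (phi : T -> T) :=
  measurable_fun setT phi /\
  forall g : T -> \bar R, measurable_fun setT g -> (forall x, 0 <= g x) ->
    \int[m]_x g (phi x) = c%:E * \int[m]_x g x.

Section Basic.
Context d (T : measurableType d) (m : {measure set T -> \bar R}).

(** It is enough to test sets: the left integral is one against the pushforward, which is then [m]
    scaled by [c]. *)
Lemma scales_of_set (c : R) (phi : T -> T) : (0 <= c)%R ->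
  measurable_fun setT phi ->
  (forall A, measurable A -> m (phi @^-1` A) = c%:E * m A) ->
  scales m c phi.
Proof.
move=> c0 mphi H; split=> // g mg g0.
have := @ge0_integral_pushforward _ _ _ _ R phi mphi m setT g measurableT mg
  (fun y _ => g0 y).
rewrite preimage_setT => <-.
rewrite (@eq_measure_integral _ _ _ _ (mscale (NngNum c0) m) (pushforward m phi)); last first.
  by move=> A mA _; exact: (H A mA).
by rewrite ge0_integral_mscale.
Qed.

Lemma scales_comp c e phi psi :
  scales m c phi -> scales m e psi -> scales m (c * e)%R (phi \o psi).
Proof.
move=> [m1 H1] [m2 H2]; split; first exact: measurableT_comp.
move=> g mg g0; rewrite /= (H2 (fun x => g (phi x)))//; last first.
  exact: measurableT_comp.
by rewrite H1// muleA -EFinM mulrC.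
Qed.

Lemma scales_eq c phi psi : phi =1 psi -> scales m c phi -> scales m c psi.
Proof. by move=> /funext ->. Qed.

End Basic.

Section Prod.
Context d1 d2 (T1 : measurableType d1) (T2 : measurableType d2).
Context (m1 : {sigma_finite_measure set T1 -> \bar R}).
Context (m2 : {sigma_finite_measure set T2 -> \bar R}).

(** Tonelli's theorem with the second coordinate frozen: on each fibre [k y] is a change of
    variables with the same factor [c]. *)
Lemma scales_shear1 c (k : T2 -> T1 -> T1) : (0 <= c)%R ->
  measurable_fun setT (fun p : T1 * T2 => k p.2 p.1) ->
  (forall y, scales m1 c (k y)) ->
  scales (prodm m1 m2) c (fun p => (k p.2 p.1, p.2)).
Proof.
move=> c0 mk H; have mf : measurable_fun setT (fun p : T1 * T2 => (k p.2 p.1, p.2)).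
  by apply: measurable_fun_pair => //.
split=> // g mg g0.
have mgf := measurableT_comp mg mf.
rewrite (prodm_tonelli2 _ _ mgf)//= prodm_tonelli2// -ge0_integralZl//; first last.
- by move=> y _; apply: integral_ge0.
- exact: measurable_int2.
apply: eq_integral => y _ /=; have [_ /(_ (fun x => g (x, y)))] := H y.
apply=> //; exact: measurableT_comp.
Qed.

Lemma scales_shear2 c (k : T1 -> T2 -> T2) : (0 <= c)%R ->
  measurable_fun setT (fun p : T1 * T2 => k p.1 p.2) ->
  (forall x, scales m2 c (k x)) ->
  scales (prodm m1 m2) c (fun p => (p.1, k p.1 p.2)).
Proof.
move=> c0 mk H; have mf : measurable_fun setT (fun p : T1 * T2 => (p.1, k p.1 p.2)).
  by apply: measurable_fun_pair => //.
split=> // g mg g0.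
have mgf := measurableT_comp mg mf.
rewrite (prodm_tonelli1 _ _ mgf)//= prodm_tonelli1// -ge0_integralZl//; first last.
- by move=> y _; apply: integral_ge0.
- exact: measurable_int1.
apply: eq_integral => y _ /=; have [_ /(_ (fun x => g (y, x)))] := H y.
apply=> //; exact: measurableT_comp.
Qed.

Lemma scales_prod c e phi psi : (0 <= c)%R -> (0 <= e)%R ->
  scales m1 c phi -> scales m2 e psi ->
  scales (prodm m1 m2) (c * e)%R (fun p => (phi p.1, psi p.2)).
Proof.
move=> c0 e0 H1 H2.
have S1 : scales (prodm m1 m2) c (fun p => (phi p.1, p.2)).
  apply: (scales_shear1 (k := fun _ x => phi x)) => //.
  by apply: measurableT_comp => //; apply: H1.1.
have S2 : scales (prodm m1 m2) e (fun p => (p.1, psi p.2)).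
  apply: (scales_shear2 (k := fun _ x => psi x)) => //.
  by apply: measurableT_comp => //; apply: H2.1.
exact: (scales_comp S1 S2).
Qed.

End Prod.

End ScalesDef.

Section Lebesgue.
Context {R : realType}.
(* [lebesgue_measure] lives on [measurableTypeR R]; [leb1] is the same measure
   for the canonical measurable structure of [R], which is the one used by the
   product sigma-algebras. *)
Definition leb1_set : set R -> \bar R := @lebesgue_measure R.
Fact leb1_set0 : leb1_set set0 = 0%E. Proof. exact: measure0. Qed.
Fact leb1_set_ge0 A : (0 <= leb1_set A)%E. Proof. exact: measure_ge0. Qed.
Fact leb1_set_sa : semi_sigma_additive leb1_set. Proof. exact: (@measure_semi_sigma_additive _ _ _ (@lebesgue_measure R)). Qed.
HB.instance Definition _ := isMeasure.Build _ _ _ leb1_set leb1_set0 leb1_set_ge0 leb1_set_sa.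
Fact leb1_set_sf : sigma_finite setT leb1_set. Proof. exact: (@sigma_finiteT _ _ _ (@lebesgue_measure R)). Qed.
HB.instance Definition _ := Measure_isSigmaFinite.Build _ _ _ leb1_set leb1_set_sf.

Definition leb1 : {sigma_finite_measure set R -> \bar R} := leb1_set.
Definition leb2 : {sigma_finite_measure set (R * R)%type -> \bar R} := prodm leb1 leb1.
Definition leb4 : {sigma_finite_measure set ((R * R) * (R * R))%type -> \bar R} := prodm leb2 leb2.
Definition leb8 : {sigma_finite_measure set (((R * R) * (R * R)) * ((R * R) * (R * R)))%type -> \bar R} := prodm leb4 leb4.
Lemma leb1E (D : set R) (f : R -> \bar R) : measurable D -> measurable_fun D f ->
  (forall x, D x -> 0 <= f x)%E -> (\int[leb1]_(x in D) f x = \int[@lebesgue_measure R]_(x in D) f x)%E.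
Proof.
move=> mD mf f0.
have mphi : measurable_fun setT (idfun : measurableTypeR R -> R) by exact: measurable_id.
apply: (@ge0_integral_pushforward _ _ _ _ R _ mphi lebesgue_measure D f) => //.
by move=> y; rewrite inE; exact: f0.
Qed.

Local Open Scope ereal_scope.
Notation leb := (@lebesgue_measure R).

(** By uniqueness of Lebesgue measure: the pushforward multiplied by [|a|] gives half-open intervals
    their length. *)
Lemma scales_affine (a b : R) : a != 0%R ->
  scales leb1 `|a|^-1 (fun x => a * x + b)%R.
Proof.
move=> a0.
have mf : measurable_fun setT (fun x : R => a * x + b)%R.
  by apply: measurable_funD => //; apply: measurable_funM.
apply: scales_of_set => // A mA; rewrite /leb1 /leb1_set /=.
pose phi : measurableTypeR R -> measurableTypeR R := fun x => (a * x + b)%R.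
have mphi : measurable_fun setT phi by exact: mf.
pose m := measure_function_pushforward__canonical__measure_function_Measure leb mphi.
pose nu : {measure set (measurableTypeR R) -> \bar R} :=
  mscale (NngNum (normr_ge0 a)) m.
have E : leb A = nu A; last first.
  suff : m A = (`|a|^-1)%:E * leb A by [].
  rewrite E.
  rewrite /nu /mscale /= /m /pushforward muleA -EFinM mulVf ?mul1e//.
  by rewrite normr_eq0.
apply: (lebesgue_measure_unique (mu := nu)) => //.
  move=> _ [[u v] _ <-] /=.
  rewrite /nu /mscale /= /pushforward /phi.
  have [au|au] := ltrP 0 a.
    have -> : (fun x : R => a * x + b)%R @^-1` `]u, v]%classic = `]((u - b) / a)%R, ((v - b) / a)%R]%classic.
      apply/seteqP; split=> x /=; rewrite !in_itv /= ltr_pdivrMr// ler_pdivlMr//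
        ltrBlDr lerBrDr mulrC => /andP[-> ->] //.
    rewrite !lebesgue_measure_itv /= !lte_fin.
    rewrite ltr_pM2r ?invr_gt0// ltrD2r.
    case: ifP => // uv; last by rewrite mule0.
    rewrite -!EFinB -EFinM; congr (_%:E); rewrite gtr0_norm//.
    field. by [].
  have {}au : (a < 0)%R by rewrite lt_neqAle a0.
  (* A negative slope moves the open end of the interval to the other side, which does not change
     its length. *)
  have -> : (fun x : R => a * x + b)%R @^-1` `]u, v]%classic = `[((v - b) / a)%R, ((u - b) / a)%R[%classic.
    apply/seteqP; split=> x /=; rewrite !in_itv /= ltr_ndivlMr// ler_ndivrMr//
        ltrBlDr lerBrDr mulrC => /andP[-> ->] //.
  rewrite !lebesgue_measure_itv /= !lte_fin.
  rewrite ltr_nM2r ?invr_lt0// ltrD2r.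
  case: ifP => // uv; last by rewrite mule0.
  rewrite -!EFinB -EFinM; congr (_%:E); rewrite ltr0_norm//.
  field. by [].
Qed.

Lemma scales_transl (b : R) : scales leb1 1 (fun x => x + b)%R.
Proof.
have := scales_affine b (oner_neq0 R); rewrite normr1 invr1.
by apply: scales_eq => x; rewrite mul1r.
Qed.

Lemma scales_mul (a : R) : a != 0%R -> scales leb1 `|a|^-1 (fun x => a * x)%R.
Proof.
move=> a0; have := scales_affine 0 a0.
by apply: scales_eq => x; rewrite addr0.
Qed.

Definition cmulp (s z : R * R) : R * R :=
  ((s.1 * z.1 - s.2 * z.2)%R, (s.1 * z.2 + s.2 * z.1)%R).
Definition caddp (s z : R * R) : R * R := ((s.1 + z.1)%R, (s.2 + z.2)%R).
Definition cadd2 (s z : (R * R) * (R * R)) := (caddp s.1 z.1, caddp s.2 z.2).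
Definition cmul2 (s : R * R) (z : (R * R) * (R * R)) := (cmulp s z.1, cmulp s z.2).

Lemma measurable_caddp d (T : measurableType d) (f g : T -> R * R) :
  measurable_fun setT f -> measurable_fun setT g ->
  measurable_fun setT (fun x => caddp (f x) (g x)).
Proof.
move=> mf mg; apply: measurable_fun_pair; apply: measurable_funD => /=;
  exact: measurableT_comp.
Qed.

Lemma measurable_cmulp d (T : measurableType d) (f g : T -> R * R) :
  measurable_fun setT f -> measurable_fun setT g ->
  measurable_fun setT (fun x => cmulp (f x) (g x)).
Proof.
move=> mf mg; apply: measurable_fun_pair => /=.
  by apply: measurable_funB; apply: measurable_funM; exact: measurableT_comp.
by apply: measurable_funD; apply: measurable_funM; exact: measurableT_comp.
Qed.

Lemma measurable_cadd2 d (T : measurableType d) (f g : T -> (R * R) * (R * R)) :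
  measurable_fun setT f -> measurable_fun setT g ->
  measurable_fun setT (fun x => cadd2 (f x) (g x)).
Proof.
by move=> mf mg; apply: measurable_fun_pair; apply: measurable_caddp => /=;
  exact: measurableT_comp.
Qed.

Lemma measurable_cmul2 d (T : measurableType d) (f : T -> R * R)
    (g : T -> (R * R) * (R * R)) :
  measurable_fun setT f -> measurable_fun setT g ->
  measurable_fun setT (fun x => cmul2 (f x) (g x)).
Proof.
by move=> mf mg; apply: measurable_fun_pair; apply: measurable_cmulp => //=;
  exact: measurableT_comp.
Qed.

Lemma scales_leb2_transl (b : R * R) : scales leb2 1 (caddp b).
Proof.
have := scales_prod ler01 ler01 (scales_transl b.1) (scales_transl b.2).
by rewrite mulr1; apply: scales_eq => z; congr (_, _); exact: addrC.
Qed.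

Lemma scales_leb4_transl (b : (R * R) * (R * R)) : scales leb4 1 (cadd2 b).
Proof.
have := scales_prod ler01 ler01 (scales_leb2_transl b.1) (scales_leb2_transl b.2).
by rewrite mulr1.
Qed.

Lemma scales_leb4_dilate (a : R) : (0 < a)%R ->
  scales leb4 (a ^- 4) (fun z => ((a * z.1.1, a * z.1.2), (a * z.2.1, a * z.2.2)))%R.
Proof.
move=> a0; have Sa := scales_mul (lt0r_neq0 a0); rewrite gtr0_norm// in Sa.
have a1 : (0 <= a^-1)%R by rewrite invr_ge0 ltW.
have S2 := scales_prod a1 a1 Sa Sa.
have := scales_prod (mulr_ge0 a1 a1) (mulr_ge0 a1 a1) S2 S2.
suff -> : (a^-1 / a * (a^-1 / a) = a ^- 4)%R by [].
by field; exact: lt0r_neq0.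
Qed.
End Lebesgue.

(** Generation of SL_2 of a field by unipotent matrices: for c <> 0 the matrix is a product upper,
    lower, upper with parameters (a - 1)/c, c and (d - 1)/c; for c = 0, adding the first row to the
    second first makes the lower left entry nonzero. *)
Lemma SL2_ind (F : fieldType) (P : F -> F -> F -> F -> Prop) :
  (forall s, P 1 s 0 1) -> (forall s, P 1 0 s 1) ->
  (forall a b c d a' b' c' d', P a b c d -> P a' b' c' d' ->
    P (a * a' + b * c') (a * b' + b * d') (c * a' + d * c') (c * b' + d * d')) ->
  forall a b c d, a * d - b * c = 1 -> P a b c d.
Proof.
move=> PU PL PM.
have main a b c d : c != 0 -> a * d - b * c = 1 -> P a b c d.
  move=> c0 H.
  have := PM _ _ _ _ _ _ _ _ (PM _ _ _ _ _ _ _ _ (PU ((a - 1) / c)) (PL c)) (PU ((d - 1) / c)).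
  congr P; rewrite ?(mulr0, mulr1, mul1r, mul0r, addr0, add0r).
  - by rewrite divfK// addrC subrK.
  - have -> : b = (a * d - 1) / c by rewrite -H; field.
    by field.
  - by [].
  - by rewrite mulrC divfK// subrK.
move=> a b c d H; have [c0|c0] := eqVneq c 0; last exact: main.
have a0 : a != 0.
  by apply/eqP => a0; move/eqP: H; rewrite a0 c0 mulr0 mul0r subrr eq_sym oner_eq0.
have := PM _ _ _ _ _ _ _ _ (PL (-1)) (main a b (a + c) (b + d) _ _).
have -> : 1 * a + 0 * (a + c) = a by ring.
have -> : 1 * b + 0 * (b + d) = b by ring.
have -> : -1 * a + 1 * (a + c) = c by ring.
have -> : -1 * b + 1 * (b + d) = d by ring.
by apply; [rewrite c0 addr0|rewrite -H c0; ring].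
Qed.

Section Pairs.
Context {R : realType}.
Implicit Types (z w : R[i]).

(** Lebesgue measure lives on pairs of reals and the algebra in [R[i]]; [p2c] and [c2p] pass between
    the two. *)
Definition p2c (p : R * R) : R[i] := p.1 +i* p.2.
Definition c2p z : R * R := (complex.Re z, complex.Im z).

Lemma p2cK : cancel p2c c2p. Proof. by case. Qed.
Lemma c2pK : cancel c2p p2c. Proof. by case. Qed.

Lemma c2pM z w : c2p (z * w) = cmulp (c2p z) (c2p w).
Proof. by case: z w => [a b] [c e]. Qed.

Lemma c2pD z w : c2p (z + w) = caddp (c2p z) (c2p w).
Proof. by case: z w => [a b] [c e]. Qed.

Definition linp (a b c e : R[i]) (v : (R * R) * (R * R)) :=
  (c2p (a * p2c v.1 + b * p2c v.2), c2p (c * p2c v.1 + e * p2c v.2)).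

(** Unipotent matrices act as shears made of translations, so generation by them replaces a Jacobian
    formula. *)
Lemma scales_linp a b c e : a * e - b * c = 1 -> scales leb4 1 (linp a b c e).
Proof.
move: a b c e; apply: SL2_ind.
- move=> s; apply: (@scales_eq R _ _ leb4 1 (fun p : (R * R) * (R * R) => (caddp (cmulp (c2p s) p.2) p.1, p.2))); last first.
    apply: (scales_shear1 leb2 (m1 := leb2) (k := fun y x => caddp (cmulp (c2p s) y) x) ler01) => [|y].
    + apply: measurable_caddp => //; apply: measurable_cmulp => //.
    + exact: scales_leb2_transl.
  move=> [x y]; rewrite /linp /= !mul1r !mul0r add0r !c2pD c2pM !p2cK.
  by congr (_, _, _); exact: addrC.
- move=> s; apply: (@scales_eq R _ _ leb4 1 (fun p : (R * R) * (R * R) => (p.1, caddp (cmulp (c2p s) p.1) p.2))); last first.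
    apply: (scales_shear2 leb2 (m2 := leb2) (k := fun x y => caddp (cmulp (c2p s) x) y) ler01) => [|y].
    + apply: measurable_caddp => //; apply: measurable_cmulp => //.
    + exact: scales_leb2_transl.
  by move=> [x y]; rewrite /linp /= !mul1r !mul0r addr0 !c2pD c2pM !p2cK.
- move=> a b c e a' b' c' e' H H'.
  have := scales_comp H H'; rewrite mulr1; apply: scales_eq => v.
  by rewrite /linp /= !c2pK; congr (c2p _, c2p _); ring.
Qed.

Definition linl (a b c e : R[i]) (M : ((R * R) * (R * R)) * ((R * R) * (R * R))) :=
  (linp a b c e M.1, linp a b c e M.2).

Lemma scales_linl a b c e : a * e - b * c = 1 -> scales leb8 1 (linl a b c e).
Proof.
move=> H; have := scales_prod ler01 ler01 (scales_linp H) (scales_linp H).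
by rewrite mulr1.
Qed.

(** [M.1] and [M.2] are the columns of a matrix. Right multiplication combines the columns, whereas
    [linl] acts inside each of them. *)
Definition linr (a b c e : R[i]) (M : ((R * R) * (R * R)) * ((R * R) * (R * R))) :=
  (cadd2 (cmul2 (c2p a) M.1) (cmul2 (c2p c) M.2),
   cadd2 (cmul2 (c2p b) M.1) (cmul2 (c2p e) M.2)).

Let c2p0 : c2p 0 = (0, 0) :> R * R. Proof. by []. Qed.
Let c2p1 : c2p 1 = (1, 0) :> R * R. Proof. by []. Qed.

Lemma scales_linr a b c e : a * e - b * c = 1 -> scales leb8 1 (linr a b c e).
Proof.
move: a b c e; apply: SL2_ind.
- move=> s; apply: (@scales_eq R _ _ leb8 1 (fun p : ((R * R) * (R * R)) * ((R * R) * (R * R)) => (p.1, cadd2 (cmul2 (c2p s) p.1) p.2))); last first.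
    apply: (scales_shear2 leb4 (m2 := leb4) (k := fun v w : (R * R) * (R * R) => cadd2 (cmul2 (c2p s) v) w) ler01) => [|y].
    + apply: measurable_cadd2 => //; apply: measurable_cmul2 => //.
    + exact: scales_leb4_transl.
  move=> [[v1 v2] [w1 w2]].
  rewrite /linr /= c2p0 c2p1 /cadd2 /cmul2 /cmulp /caddp /= !mul0r !mul1r !subr0 !addr0.
  by rewrite -!surjective_pairing.
- move=> s; apply: (@scales_eq R _ _ leb8 1 (fun p : ((R * R) * (R * R)) * ((R * R) * (R * R)) => (cadd2 (cmul2 (c2p s) p.2) p.1, p.2))); last first.
    apply: (scales_shear1 leb4 (m1 := leb4) (k := fun w v : (R * R) * (R * R) => cadd2 (cmul2 (c2p s) w) v) ler01) => [|y].
    + apply: measurable_cadd2 => //; apply: measurable_cmul2 => //.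
    + exact: scales_leb4_transl.
  move=> [[v1 v2] [w1 w2]].
  rewrite /linr /= c2p0 c2p1 /cadd2 /cmul2 /cmulp /caddp /= !mul0r !mul1r !subr0 !addr0 !add0r.
  by rewrite -!surjective_pairing; congr (_, _, (_, _), _); exact: addrC.
- move=> a b c e a' b' c' e' H H'.
  (* Right multiplication reverses products, hence the order of the two factors. *)
  have := scales_comp H' H; rewrite mulr1; apply: scales_eq => -[[[v1 v2] [v3 v4]] [[w1 w2] [w3 w4]]].
  rewrite /linr /= !c2pD !c2pM.
  case: (c2p a) (c2p b) (c2p c) (c2p e) (c2p a') (c2p b') (c2p c') (c2p e') =>
   [? ?] [? ?] [? ?] [? ?] [? ?] [? ?] [? ?] [? ?].
  rewrite /cadd2 /cmul2 /cmulp /caddp /=.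
  by congr (_, _, (_, _), (_, _, (_, _))); ring.
Qed.

End Pairs.

(** * Borel structure of SL_2(C) and of its quotient *)

Section Topology.
Context {R : realType}.
Implicit Types (z w : R[i]) (g h : SL2C R).
Notation Re := (@complex.Re R).
Notation Im := (@complex.Im R).

Lemma normc_ge_Re z : `|Re z| <= ComplexField.Normc.normc z.
Proof.
case: z => a b /=; rewrite -sqrtr_sqr ler_wsqrtr// lerDl; exact: sqr_ge0.
Qed.

Lemma normc_ge_Im z : `|Im z| <= ComplexField.Normc.normc z.
Proof.
case: z => a b /=; rewrite -sqrtr_sqr ler_wsqrtr// lerDr; exact: sqr_ge0.
Qed.

Lemma normc_le_ReIm z : ComplexField.Normc.normc z <= `|Re z| + `|Im z|.
Proof.
case: z => a b /=.
rewrite -[leRHS]ger0_norm ?addr_ge0// -sqrtr_sqr ler_wsqrtr//.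
rewrite sqrrD !real_normK ?num_real//.
by rewrite addrAC lerDl mulrn_wge0// mulr_ge0.
Qed.

Definition clos (e : R) g h := forall i j,
  `|Re (g i j - h i j)| < e /\ `|Im (g i j - h i j)| < e.

(** Reduces the induced topology to finitely many real inequalities, in which the later openness
    proofs are carried out. *)
Lemma SL2C_openP (U : set (SL2C R)) :
  open U <-> forall g, U g -> exists2 e : R, 0 < e & forall h, clos e g h -> U h.
Proof.
split => [[V oV <-] g Ug|H].
  have /nbhs_ballP[e /= e0 eV] : nbhs (set_val g) V by exact: open_nbhs_nbhs.
  (* The radius of a ball is a positive element of [R[i]], that is, a positive real with zero
     imaginary part. *)
  move: e0 eV; case: e => e e' ; rewrite ltcE /= => /andP[/eqP e'0 e0] eV; subst e'.
  exists (e / 2); first by rewrite divr_gt0.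
  move=> h gh; apply: eV => /=; split; first by rewrite ltcE /= eqxx.
  move=> i j; have [H1 H2] := gh i j.
  rewrite /ball /= ltcE /= eqxx /=.
  apply: (le_lt_trans (normc_le_ReIm _)).
  by rewrite [e]splitr ltrD.
rewrite openE => g Ug; have [e e0 eU] := H g Ug.
set B := ball (set_val g) (e%:C).
apply: (@filterS _ _ _ (set_val @^-1` B^°)).
  move=> h /= /interior_subset [_ gh]; apply: eU => i j.
  have := gh i j; rewrite /ball /= ltcE /= => /andP[_ gh'].
  split; first exact: (le_lt_trans (normc_ge_Re _) gh').
  exact: (le_lt_trans (normc_ge_Im _) gh').
apply: open_nbhs_nbhs; split; first by exists B^° => //; exact: open_interior.
by rewrite /= /interior /=; apply: nbhsx_ballx; rewrite ltcE /= eqxx.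
Qed.

Definition SL2C_borel := g_sigma_algebraType (@open (SL2C R)).

Lemma open_measurable_SL2C (U : set (SL2C R)) :
  open U -> measurable (U : set SL2C_borel).
Proof. by move=> oU; apply: sub_sigma_algebra. Qed.

Lemma measurable_SL2C_Re i j :
  measurable_fun setT (fun g : SL2C_borel => Re ((g : SL2C R) i j)).
Proof.
apply: (measurability (@RGenOInfty.G R)) => [|_ [_ [a ->] <-]].
  exact: RGenOInfty.measurableE.
rewrite setTI; apply: open_measurable_SL2C; apply/SL2C_openP => g /=.
rewrite in_itv /= andbT => ag; exists (Re (g i j) - a); first by rewrite subr_gt0.
move=> h /(_ i j)[+ _] /=; rewrite in_itv /= andbT raddfB /= => /ltr_normlW.
by move=> ?; lra.
Qed.

Lemma measurable_SL2C_Im i j :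
  measurable_fun setT (fun g : SL2C_borel => Im ((g : SL2C R) i j)).
Proof.
apply: (measurability (@RGenOInfty.G R)) => [|_ [_ [a ->] <-]].
  exact: RGenOInfty.measurableE.
rewrite setTI; apply: open_measurable_SL2C; apply/SL2C_openP => g /=.
rewrite in_itv /= andbT => ag; exists (Im (g i j) - a); first by rewrite subr_gt0.
move=> h /(_ i j)[_ +] /=; rewrite in_itv /= andbT raddfB /= => /ltr_normlW.
by move=> ?; lra.
Qed.

(** Indices of cubes of half-side 1/(n + 1) centred at multiples of 1/(n + 1): a countable base of
    the topology, from which both the measurability of maps into SL_2(C) and the sheets of the
    quotient map are obtained. *)
Definition box_index := (nat * {ffun 'I_2 * 'I_2 -> int * int})%type.

Definition box (k : box_index) : set (SL2C R) := [set g | forall i j,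
  `|k.1.+1%:R * Re (g i j) - (k.2 (i, j)).1%:~R| < 1 /\
  `|k.1.+1%:R * Im (g i j) - (k.2 (i, j)).2%:~R| < 1].

Definition box_around (n : nat) (g : SL2C R) : box_index :=
  (n, [ffun ij => (Num.floor (n.+1%:R * Re (g ij.1 ij.2)), Num.floor (n.+1%:R * Im (g ij.1 ij.2)))]).

Lemma box_aroundP n g : box (box_around n g) g.
Proof.
have F (x : R) : `|x - (Num.floor x)%:~R| < 1.
  rewrite ger0_norm; last by rewrite subr_ge0 floor_le_tmp.
  by rewrite ltrBlDl -(intrD _ _ 1) lt_succ_floor.
by move=> i j; rewrite /= ffunE /=; split; exact: F.
Qed.

Lemma box_clos (k : box_index) g h :
  box k g -> box k h -> clos (2 / k.1.+1%:R) g h.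
Proof.
have F (n x y : R) (m : int) : 0 < n -> `|n * x - m%:~R| < 1 -> `|n * y - m%:~R| < 1 ->
    `|x - y| < 2 / n.
  move=> n0 H1 H2; rewrite ltr_pdivlMr// -[X in _ * X](gtr0_norm n0) -normrM.
  have -> : (x - y) * n = (n * x - m%:~R) - (n * y - m%:~R) by ring.
  apply: (le_lt_trans (ler_normB _ _)); lra.
move=> kg kh i j; have [H1 H2] := kg i j; have [H3 H4] := kh i j.
by rewrite !raddfB /=; split; apply: F; eassumption || rewrite ltr0n.
Qed.

Lemma box_open k : open (box k).
Proof.
apply/SL2C_openP => g kg.
pose e := \big[Num.min/1]_(ij : 'I_2 * 'I_2)
  Num.min (1 - `|k.1.+1%:R * Re (g ij.1 ij.2) - (k.2 ij).1%:~R|)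
  (1 - `|k.1.+1%:R * Im (g ij.1 ij.2) - (k.2 ij).2%:~R|).
have e0 : 0 < e.
  rewrite /e; apply: (big_ind (fun x => 0 < x)) => //; first by move=> x y x0 y0; rewrite lt_min x0.
  by move=> [i j] _; have [H1 H2] := kg i j; rewrite lt_min /= !subr_gt0 H1 H2.
exists (e / k.1.+1%:R); first by rewrite divr_gt0.
move=> h gh i j; have [H1 H2] := gh i j.
have : e <= Num.min (1 - `|k.1.+1%:R * Re (g i j) - (k.2 (i, j)).1%:~R|)
  (1 - `|k.1.+1%:R * Im (g i j) - (k.2 (i, j)).2%:~R|).
  by rewrite /e (bigD1 (i, j))//= ge_min lexx.
rewrite le_min => /andP[E1 E2].
have n0 : (0 : R) < k.1.+1%:R by [].
have F (x y m : R) : `|x - y| < e / k.1.+1%:R -> e <= 1 - `|k.1.+1%:R * x - m| ->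
    `|k.1.+1%:R * y - m| < 1.
  rewrite ltr_pdivlMr// -[X in _ * X](gtr0_norm n0) -normrM => A B.
  have -> : k.1.+1%:R * y - m = (k.1.+1%:R * x - m) - (x - y) * k.1.+1%:R by ring.
  apply: (le_lt_trans (ler_normB _ _)); lra.
rewrite !raddfB /= in H1 H2.
by split; [exact: F H1 E1|exact: F H2 E2].
Qed.

Lemma open_boxP (U : set (SL2C R)) g : open U -> U g -> exists2 n, True & box (box_around n g) `<=` U.
Proof.
move=> /SL2C_openP/[apply] -[e e0 eU].
have [n ne] : exists n : nat, 2 / n.+1%:R < e.
  exists (Num.bound (2 / e)); rewrite ltr_pdivrMr// mulrC -ltr_pdivrMr//.
  apply: (lt_trans (archi_boundP _)); first by rewrite divr_ge0// ltW.
  by rewrite ltr_nat.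
exists n => // h hb; apply: eU => i j.
have [H1 H2] := box_clos (box_aroundP n g) hb i j.
by split; [apply: (lt_trans H1)|apply: (lt_trans H2)].
Qed.

(** An open set is a countable union of boxes, and the preimage of a box is a finite intersection of
    conditions on single entries. *)
Lemma measurable_fun_SL2C d (T : measurableType d) (f : T -> SL2C_borel) :
  (forall i j, measurable_fun setT (fun x => Re ((f x : SL2C R) i j))) ->
  (forall i j, measurable_fun setT (fun x => Im ((f x : SL2C R) i j))) ->
  measurable_fun setT f.
Proof.
move=> mRe mIm.
have mbox k : measurable (f @^-1` box k).
  have -> : f @^-1` box k = \bigcap_(ij in [set: 'I_2 * 'I_2])
    ([set x | `|k.1.+1%:R * Re ((f x : SL2C R) ij.1 ij.2) - (k.2 ij).1%:~R| < 1] `&`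
     [set x | `|k.1.+1%:R * Im ((f x : SL2C R) ij.1 ij.2) - (k.2 ij).2%:~R| < 1]).
    by apply/seteqP; split => [x xk [i j] _|x xk i j]; [exact: xk|exact: (xk (i, j))].
  apply: fin_bigcap_measurable; [exact: finite_finset|move=> [i j] _].
  have B (u : T -> R) m : measurable_fun setT u ->
      measurable [set x | `|k.1.+1%:R * u x - m| < 1].
    move=> mu; apply: measurable_set_bool; apply: measurable_fun_ltr => //.
    by apply: measurableT_comp => //; apply: measurable_funB => //; apply: measurable_funM.
  by apply: measurableI; apply: B.
apply: (@measurability _ _ _ _ _ f (@open (SL2C R) : set (set SL2C_borel))) => // _ [U oU <-]; rewrite setTI.
have -> : f @^-1` U = \bigcup_(k in [set k | box k `<=` U]) (f @^-1` box k).
  apply/seteqP; split => [x /= Ux|x [k /= kU]]; last exact: kU.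
  have [n _ nU] := open_boxP oU Ux.
  by exists (box_around n (f x)) => //=; exact: box_aroundP.
rewrite bigcup_mkcond; apply: countable_bigcupT_measurable => [|k]; first exact: countableP.
by case: ifP.
Qed.
End Topology.
Arguments SL2C_borel : clear implicits.

(** * Two-by-two matrices, the group SL_2(C), Eisenstein integers and cosets *)

Section Mx22.
Variable F : comNzRingType.

Definition mx22 (a b c d : F) : 'M[F]_2 :=
  \matrix_(i, j) if i == 0 then (if j == 0 then a else b) else (if j == 0 then c else d).

Lemma mx22E (A : 'M[F]_2) : A = mx22 (A 0 0) (A 0 1) (A 1 0) (A 1 1).
Proof.
apply/matrixP => i j; rewrite mxE.
have I2 (k : 'I_2) : k = 0 \/ k = 1.
  by case: k => [[|[|//]] p]; [left|right]; apply/val_inj.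
by case: (I2 i) => ->; case: (I2 j) => ->.
Qed.

Lemma det22 (A : 'M[F]_2) : \det A = A 0 0 * A 1 1 - A 0 1 * A 1 0.
Proof.
rewrite (expand_det_row _ 0) !big_ord_recl big_ord0 addr0 /cofactor.
rewrite !det_mx11 !mxE /= !addn0 expr0 mul1r expr1 mulN1r mulrN.
by congr (_ * A _ _ - A _ _ * A _ _); apply/val_inj.
Qed.

Lemma mul22E (A B : 'M[F]_2) i j : (A *m B) i j = A i 0 * B 0 j + A i 1 * B 1 j.
Proof.
rewrite mxE !big_ord_recl big_ord0 addr0.
by congr (A i _ * B _ j + A i _ * B _ j); apply/val_inj.
Qed.

Lemma mx22_inj (A B : 'M[F]_2) : A 0 0 = B 0 0 -> A 0 1 = B 0 1 ->
  A 1 0 = B 1 0 -> A 1 1 = B 1 1 -> A = B.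
Proof. by move=> H1 H2 H3 H4; rewrite (mx22E A) (mx22E B) H1 H2 H3 H4. Qed.

End Mx22.

Section Group.
Context {R : realType}.
Implicit Types (g h k : SL2C R).

Lemma SL2C_inj g h : (g : 'M[R[i]]_2) = h -> g = h.
Proof. exact: val_inj. Qed.

Lemma SL2C_detE g : g 0 0 * g 1 1 - g 0 1 * g 1 0 = 1.
Proof. by rewrite -det22 SL2C_det. Qed.

Lemma SL2C_inv_subproof g : \det (mx22 (g 1 1) (- g 0 1) (- g 1 0) (g 0 0)) = 1.
Proof. by rewrite det22 !mxE /= -(SL2C_detE g); ring. Qed.

Definition SL2C_inv g : SL2C R := SL2C_of (SL2C_inv_subproof g).

Lemma SL2C_mulA g h k : SL2C_mul g (SL2C_mul h k) = SL2C_mul (SL2C_mul g h) k.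
Proof. by apply: SL2C_inj; exact: mulmxA. Qed.

Lemma SL2C_mul1g g : SL2C_mul (SL2C_one R) g = g.
Proof. by apply: SL2C_inj; exact: mul1mx. Qed.

Lemma SL2C_mulg1 g : SL2C_mul g (SL2C_one R) = g.
Proof. by apply: SL2C_inj; exact: mulmx1. Qed.

Lemma SL2C_mulVg g : SL2C_mul (SL2C_inv g) g = SL2C_one R.
Proof.
apply: SL2C_inj; apply: mx22_inj; rewrite mul22E !mxE /=.
- by rewrite -(SL2C_detE g); ring.
- by rewrite mulr0n; ring.
- by rewrite mulr0n; ring.
- by rewrite -(SL2C_detE g); ring.
Qed.

Lemma SL2C_mulgV g : SL2C_mul g (SL2C_inv g) = SL2C_one R.
Proof.
apply: SL2C_inj; apply: mx22_inj; rewrite mul22E !mxE /=.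
- by rewrite -(SL2C_detE g); ring.
- by rewrite mulr0n; ring.
- by rewrite mulr0n; ring.
- by rewrite -(SL2C_detE g); ring.
Qed.

Lemma SL2C_mulKg g h : SL2C_mul (SL2C_inv g) (SL2C_mul g h) = h.
Proof. by rewrite SL2C_mulA SL2C_mulVg SL2C_mul1g. Qed.

Lemma SL2C_mulKVg g h : SL2C_mul g (SL2C_mul (SL2C_inv g) h) = h.
Proof. by rewrite SL2C_mulA SL2C_mulgV SL2C_mul1g. Qed.

Lemma SL2C_mulgK g h : SL2C_mul (SL2C_mul h g) (SL2C_inv g) = h.
Proof. by rewrite -SL2C_mulA SL2C_mulgV SL2C_mulg1. Qed.

Lemma SL2C_mulgKV g h : SL2C_mul (SL2C_mul h (SL2C_inv g)) g = h.
Proof. by rewrite -SL2C_mulA SL2C_mulVg SL2C_mulg1. Qed.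

Notation eta := (eisenstein_unit R).
Notation O := (eisenstein R).

Lemma eta_sqr : eta * eta = eta - 1.
Proof.
apply/eqP; rewrite eq_complex /=; apply/andP; split; apply/eqP.
  have s3 : Num.sqrt 3 * Num.sqrt 3 = 3 :> R by rewrite -expr2 sqr_sqrtr.
  have -> : Num.sqrt 3 / 2 * (Num.sqrt 3 / 2) = Num.sqrt 3 * Num.sqrt 3 / 4 :> R by field.
  rewrite s3; lra.
by rewrite [LHS](_ : _ = Num.sqrt 3 / 2); lra.
Qed.

Lemma eisensteinP (x : R[i]) :
  O x <-> exists a b : int, x = a%:~R + b%:~R * eta.
Proof.
split; first by move=> [a _ [b _ <-]]; exists a, b.
by move=> [a [b ->]]; exists a => //; exists b.
Qed.

Lemma eisenstein0 : O 0.
Proof. by apply/eisensteinP; exists 0, 0; rewrite mul0r addr0. Qed.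
Lemma eisenstein1 : O 1.
Proof. by apply/eisensteinP; exists 1, 0; rewrite mul0r addr0. Qed.
Lemma eisenstein_eta : O eta.
Proof. by apply/eisensteinP; exists 0, 1; rewrite mul1r add0r. Qed.
Lemma eisensteinD x y : O x -> O y -> O (x + y).
Proof.
move=> /eisensteinP[a [b ->]] /eisensteinP[c [d ->]]; apply/eisensteinP.
by exists (a + c), (b + d); rewrite !intrD; ring.
Qed.
Lemma eisensteinN x : O x -> O (- x).
Proof.
move=> /eisensteinP[a [b ->]]; apply/eisensteinP.
by exists (- a), (- b); rewrite !mulrNz; ring.
Qed.
Lemma eisensteinM x y : O x -> O y -> O (x * y).
Proof.
move=> /eisensteinP[a [b ->]] /eisensteinP[c [d ->]]; apply/eisensteinP.
exists (a * c - b * d), (a * d + b * c + b * d).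
rewrite !(intrD, mulrNz, intrM).
transitivity (a%:~R * c%:~R + (a%:~R * d%:~R + b%:~R * c%:~R) * eta + b%:~R * d%:~R * (eta * eta)); first by ring.
by rewrite eta_sqr; ring.
Qed.

Lemma eisenstein_small x : O x ->
  `|complex.Re x| < 2^-1 -> `|complex.Im x| < 2^-1 -> x = 0.
Proof.
have intE (a : int) : (a%:~R : R[i]) = (a%:~R : R)%:C by rewrite rmorph_int.
move=> /eisensteinP[a [b ->]]; rewrite !intE /= !(mul0r, subr0, addr0, add0r).
set s := Num.sqrt 3.
have s1 : 1 < s by rewrite -[X in X < _]sqrtr1 ltr_sqrt// ltr1n.
have small (n : int) : `|n%:~R| < (1 : R) -> n = 0.
  by rewrite -intr_norm (ltrz1 _ `|n|) => H; apply/eqP; rewrite -normr_eq0; lia.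
move=> H1 H2; have b0 : b = 0.
  apply: small; apply: le_lt_trans (_ : `|b%:~R * s| < 1).
    by rewrite normrM ler_peMr// ger0_norm ?ltW// (lt_trans _ s1).
  by move: H2; rewrite mulrA normrM [`|2^-1|]ger0_norm//; lra.
move: H1; rewrite b0 mul0r addr0 => H1.
have -> : a = 0 by apply: small; apply: (lt_trans H1); lra.
by rewrite mulr0z rmorph0 mul0r addr0.
Qed.

Lemma SL2O1 : SL2O R (SL2C_one R).
Proof.
by move=> i j; rewrite /= mxE; case: (i == j); [exact: eisenstein1|exact: eisenstein0].
Qed.

Lemma SL2OM g h : SL2O R g -> SL2O R h -> SL2O R (SL2C_mul g h).
Proof.
move=> Og Oh i j; rewrite /= mul22E.
by apply: eisensteinD; apply: eisensteinM.
Qed.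

Lemma SL2OV g : SL2O R g -> SL2O R (SL2C_inv g).
Proof.
move=> Og i j; rewrite /= mxE.
by case: (i == 0); case: (j == 0) => //; apply: eisensteinN.
Qed.

Lemma left_cosetP g h :
  left_coset g = left_coset h <-> exists2 k, SL2O R k & h = SL2C_mul g k.
Proof.
split => [gh|[k Ok ->]].
  have : left_coset h h by exists (SL2C_one R); [exact: SL2O1|exact: SL2C_mulg1].
  by rewrite -gh => -[k Ok <-]; exists k.
apply/seteqP; split => _ [u Ou <-].
  exists (SL2C_mul (SL2C_inv k) u); first by apply: SL2OM => //; exact: SL2OV.
  by rewrite -SL2C_mulA SL2C_mulKVg.
by exists (SL2C_mul k u); [exact: SL2OM|rewrite SL2C_mulA].
Qed.

Lemma coset_ofP g h :
  coset_of g = coset_of h <-> exists2 k, SL2O R k & h = SL2C_mul g k.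
Proof.
rewrite -left_cosetP; split => [/eqquotP/asboolP//|gh].
by apply/eqquotP/asboolP.
Qed.

Lemma coset_of_mul g k : SL2O R k -> coset_of (SL2C_mul g k) = coset_of g.
Proof. by move=> Ok; apply/esym/coset_ofP; exists k. Qed.

Lemma coset_of_surj (x : coset_borel R) : exists g, coset_of g = x.
Proof. by exists (repr (x : coset_space R)); rewrite /coset_of reprK. Qed.

Definition eis_of (p : int * int) : R[i] := p.1%:~R + p.2%:~R * eta.

(** Meant as a map from a countable type onto SL_2(O); coefficient arrays of determinant other than
    1 go to the identity. *)
Definition SL2O_of (f : {ffun 'I_2 * 'I_2 -> int * int}) : SL2C R :=
  let M := \matrix_(i < 2, j < 2) eis_of (f (i, j)) in
  match pselect (\det M = 1) with
  | left H => SL2C_of H | right _ => SL2C_one R end.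

Lemma SL2O_ofP g : SL2O R g -> exists f, SL2O_of f = g.
Proof.
move=> Og; have H i j : exists p, eis_of p = g i j.
  by have /eisensteinP[a [b E]] := Og i j; exists (a, b).
exists [ffun ij => projT1 (cid (H ij.1 ij.2))].
rewrite /SL2O_of; set M := \matrix_(i, j) _.
have E : M = g.
  by apply/matrixP => i j; rewrite mxE ffunE; case: cid.
case: pselect => [D|]; first by apply: SL2C_inj.
by rewrite E SL2C_det.
Qed.

Lemma countable_SL2O : countable (SL2O R).
Proof.
apply: (@sub_countable _ _ _ (range SL2O_of)).
  by apply: subset_card_le => g /SL2O_ofP[f <-]; exists f.
by apply: card_le_trans (card_image_le _ _) _; exact: countableP.
Qed.

End Group.

(** * A Borel section of the quotient map *)

Section MeasurableLift.
Context {R : realType}.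
Implicit Types (g h k : SL2C R).
Notation Re := (@complex.Re R).
Notation Im := (@complex.Im R).

(** A submultiplicative size without square roots, for explicit estimates of matrix products. *)
Definition n1 (z : R[i]) : R := `|Re z| + `|Im z|.

Lemma n1_ge0 z : 0 <= n1 z. Proof. by rewrite /n1 addr_ge0. Qed.

Lemma n1_clos e g h i j : clos e g h -> n1 (g i j - h i j) < e * 2.
Proof. by move=> /(_ i j)[H1 H2]; rewrite /n1 mulr_natr mulr2n ltrD. Qed.

Lemma n1M z w : n1 (z * w) <= n1 z * n1 w.
Proof.
case: z w => [a b] [c d]; rewrite /n1 /=.
apply: (@le_trans _ _ ((`|a * c| + `|b * d|) + (`|a * d| + `|b * c|))).
  by rewrite lerD ?ler_normB ?ler_normD.
rewrite !normrM; set u := `|a|; set v := `|b|; set w := `|c|; set t := `|d|.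
by rewrite le_eqVlt; apply/orP; left; apply/eqP; ring.
Qed.

Lemma n1D z w : n1 (z + w) <= n1 z + n1 w.
Proof.
rewrite /n1 !raddfD /=.
by apply: le_trans (lerD (ler_normD _ _) (ler_normD _ _)) _; lra.
Qed.

Lemma n1N z : n1 (- z) = n1 z.
Proof. by rewrite /n1 !raddfN /= !normrN. Qed.

Lemma n1_Re z : `|Re z| <= n1 z. Proof. by rewrite /n1 lerDl. Qed.
Lemma n1_Im z : `|Im z| <= n1 z. Proof. by rewrite /n1 lerDr. Qed.

Definition mxn1 (A : 'M[R[i]]_2) : R := n1 (A 0 0) + n1 (A 0 1) + n1 (A 1 0) + n1 (A 1 1).

Lemma I2P (i : 'I_2) : i = 0 \/ i = 1.
Proof. by case: i => [[|[|//]] p]; [left|right]; apply/val_inj. Qed.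

Lemma n1_mulmx (A B : 'M[R[i]]_2) (e : R) i j : (forall i j, n1 (B i j) <= e) ->
  n1 ((A *m B) i j) <= mxn1 A * e.
Proof.
move=> H; rewrite mul22E; apply: (le_trans (n1D _ _)).
have e0 : 0 <= e by apply: le_trans (H 0 0); exact: n1_ge0.
apply: (@le_trans _ _ ((n1 (A i 0) + n1 (A i 1)) * e)).
  rewrite mulrDl; apply: lerD; apply: (le_trans (n1M _ _));
  by apply: ler_wpM2l; [exact: n1_ge0|exact: H].
apply: ler_wpM2r => //; rewrite /mxn1.
have H' := n1_ge0; have := H' (A 0 0); have := H' (A 0 1); have := H' (A 1 0); have := H' (A 1 1).
by case: (I2P i) => ->; lra.
Qed.

Lemma n1_mulmxr (A B : 'M[R[i]]_2) (e : R) i j : (forall i j, n1 (A i j) <= e) ->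
  n1 ((A *m B) i j) <= mxn1 B * e.
Proof.
move=> H; rewrite mul22E; apply: (le_trans (n1D _ _)).
have e0 : 0 <= e by apply: le_trans (H 0 0); exact: n1_ge0.
apply: (@le_trans _ _ (e * (n1 (B 0 j) + n1 (B 1 j)))).
  rewrite mulrDr; apply: lerD; apply: (le_trans (n1M _ _));
  by apply: ler_wpM2r; [exact: n1_ge0|exact: H].
rewrite mulrC; apply: ler_wpM2r => //; rewrite /mxn1.
have H' := n1_ge0; have := H' (B 0 0); have := H' (B 0 1); have := H' (B 1 0); have := H' (B 1 1).
by case: (I2P j) => ->; lra.
Qed.

Lemma closW e g h : (forall i j, n1 (g i j - h i j) < e) -> clos e g h.
Proof.
move=> H i j; split; apply: (le_lt_trans _ (H i j)); [exact: n1_Re|exact: n1_Im].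
Qed.

Lemma open_mulr (U : set (SL2C R)) k : open U -> open [set g | U (SL2C_mul g k)].
Proof.
move=> /SL2C_openP oU; apply/SL2C_openP => g /= /oU[e e0 eU].
pose K := mxn1 k + 1.
have K0 : 0 < K by rewrite /K ltr_wpDl// /mxn1 !addr_ge0// n1_ge0.
exists (e / K / 2); first by rewrite !divr_gt0.
move=> h gh; apply: eU; apply: closW => i j.
have -> : SL2C_mul g k i j - SL2C_mul h k i j = ((SL2C_mx g - SL2C_mx h) *m SL2C_mx k) i j.
  by rewrite mulmxBl !mxE.
apply: (@le_lt_trans _ _ (mxn1 k * (e / K))); last first.
  rewrite mulrA ltr_pdivrMr// mulrC ltr_pM2l// /K; lra.
apply: n1_mulmxr => {}i {}j; rewrite !mxE; apply: ltW.
by have := n1_clos i j gh; rewrite divfK.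
Qed.

(** The saturation of [U] is the union of its right translates by SL_2(O), each of which is open. *)
Lemma open_coset_image (U : set (SL2C R)) :
  open U -> open ([set coset_of g | g in U] : set (coset_space R)).
Proof.
move=> oU; rewrite /open /= /quotient_open.
have -> : \pi_(coset_space R)%qT @^-1` [set coset_of g | g in U] =
    \bigcup_(k in SL2O R) [set g | U (SL2C_mul g k)].
  apply/seteqP; split => [g [h Uh /coset_ofP[k Ok E]]|g [k Ok /= Ugk]].
    exists (SL2C_inv k); first exact: SL2OV.
    by rewrite /= E SL2C_mulgK.
  by exists (SL2C_mul g k) => //; exact: coset_of_mul.
by apply: bigcup_open => k _; exact: open_mulr.
Qed.

Lemma open_measurable_coset (U : set (coset_borel R)) :
  open (U : set (coset_space R)) -> measurable U.
Proof. by move=> oU; apply: sub_sigma_algebra. Qed.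

Lemma measurable_coset_of : measurable_fun setT (@coset_of R : (SL2C_borel R) -> coset_borel R).
Proof.
apply: (@measurability _ _ _ _ _ _ (@open (coset_space R) : set (set (coset_borel R)))) => //.
by move=> _ [U oU <-]; rewrite setTI; apply: open_measurable_SL2C.
Qed.

Lemma mxn1_inv g : mxn1 (SL2C_inv g) = mxn1 g.
Proof. by rewrite /mxn1 !mxE /= !n1N; ring. Qed.

(** If [h] and [h u] lie in the same small box, then u - 1 is the inverse of [h] times a small
    matrix, so its Eisenstein entries are too small to be nonzero. *)
Lemma locally_injective g : exists n, forall h k,
  box (box_around n g) h -> box (box_around n g) k -> coset_of h = coset_of k -> h = k.
Proof.
(* Two points of a box differ by less than 2 in every real and imaginary part, hence by less than 4
   in [n1] of each of the four entries; so [K] bounds [mxn1] on the box. *)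
pose K := mxn1 g + 4 * 4.
have K0 : 0 <= K by rewrite /K addr_ge0// /mxn1 !addr_ge0// n1_ge0.
have [n nK] : exists n : nat, K * 16 < n.+1%:R.
  exists (Num.bound (K * 16)); apply: (lt_trans (archi_boundP _)).
    by rewrite mulr_ge0.
  by rewrite ltr_nat.
exists n => h k bh bk /coset_ofP[u Ou E].
have hK : mxn1 h <= K.
  have gh := box_clos bh (box_aroundP n g).
  rewrite /K /mxn1.
  have H i j : n1 (h i j) <= n1 (g i j) + 4.
    have -> : h i j = g i j + (h i j - g i j) by rewrite addrC subrK.
    apply: (le_trans (n1D _ _)); rewrite lerD2l; apply/ltW/(lt_le_trans (n1_clos i j gh)).
    apply: (@le_trans _ _ (2 / 1 * 2)); last lra.
    by rewrite ler_pM2r// ler_pM2l// lef_pV2 ?posrE// ler1n.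
  by have := H 0 0; have := H 0 1; have := H 1 0; have := H 1 1; lra.
have uE : SL2C_mx u - 1%:M = SL2C_mx (SL2C_inv h) *m (SL2C_mx k - SL2C_mx h).
  rewrite mulmxBr E; congr (_ - _).
    have := SL2C_mulKg h u; by move=> /(congr1 (@SL2C_mx R)).
  by have /(congr1 (@SL2C_mx R)) := SL2C_mulVg h.
have u1 : SL2C_mx u = 1%:M.
  apply/eqP; rewrite -subr_eq0; apply/eqP/matrixP => i j; rewrite [RHS]mxE.
  apply: eisenstein_small.
  - rewrite !mxE; apply: eisensteinD; first exact: Ou.
    by apply: eisensteinN; case: (i == j); [exact: eisenstein1|exact: eisenstein0].
  - apply: (le_lt_trans (n1_Re _)); rewrite uE.
    apply: (@le_lt_trans _ _ (K * (4 / n.+1%:R))).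
      apply: (@le_trans _ _ (mxn1 (SL2C_inv h) * (4 / n.+1%:R))).
        apply: n1_mulmx => {}i {}j; rewrite !mxE; apply: ltW.
        have := n1_clos i j (box_clos bk bh); rewrite mulrAC.
        by have -> : 2 * 2 = 4 :> R by lra.
      by rewrite mxn1_inv ler_wpM2r.
    rewrite mulrA ltr_pdivrMr//; lra.
  - apply: (le_lt_trans (n1_Im _)); rewrite uE.
    apply: (@le_lt_trans _ _ (K * (4 / n.+1%:R))).
      apply: (@le_trans _ _ (mxn1 (SL2C_inv h) * (4 / n.+1%:R))).
        apply: n1_mulmx => {}i {}j; rewrite !mxE; apply: ltW.
        have := n1_clos i j (box_clos bk bh); rewrite mulrAC.
        by have -> : 2 * 2 = 4 :> R by lra.
      by rewrite mxn1_inv ler_wpM2r.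
    rewrite mulrA ltr_pdivrMr//; lra.
apply: SL2C_inj; rewrite E; transitivity (SL2C_mx h *m SL2C_mx u) => //.
by rewrite u1 mulmx1.
Qed.

(** The good sets [B] form a sigma-algebra: injectivity on [U] is what makes images commute with
    complements. Images of open sets are open. *)
Lemma measurable_coset_image (U : set (SL2C R)) (B : set (SL2C_borel R)) :
  open U -> (forall h k, U h -> U k -> coset_of h = coset_of k -> h = k) ->
  measurable B -> measurable [set coset_of g | g in B `&` U].
Proof.
move=> oU injU.
suff : <<s @open (SL2C R) >> `<=` [set B | measurable ([set coset_of g | g in B `&` U] : set (coset_borel R))].
  exact.
apply: smallest_sub; last first.
  move=> V oV /=; apply: open_measurable_coset; apply: open_coset_image.
  exact: openI.
split => /=.
- by rewrite set0I image_set0.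
- move=> A mA; have -> : [set coset_of g | g in (setT `\` A) `&` U] =
    [set coset_of g | g in U] `\` [set coset_of g | g in A `&` U].
    apply/seteqP; split => [_ [g [[_ nAg] Ug] <-]|_ [[g Ug <-] nA]].
      split; first by exists g.
      by move=> [h [Ah Uh] /(injU _ _ Uh Ug) E]; apply: nAg; rewrite -E.
    exists g => //; split => //; split => // Ag; apply: nA; by exists g.
  apply: (measurableD (T := coset_borel R)) => //.
  by apply: open_measurable_coset; exact: open_coset_image.
- move=> F mF; rewrite setI_bigcupl image_bigcup; exact: (@bigcupT_measurable _ (coset_borel R)).
Qed.

Definition good_box (k : box_index) := forall g h,
  box k g -> box k h -> coset_of g = coset_of h -> g = h.

(** Enumerates the boxes on which [coset_of] is injective; other codes give the empty set, so every
    sheet is open and injective. *)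
Definition sheet (n : nat) : set (SL2C R) :=
  if unpickle n is Some k then (if pselect (good_box k) then box k else set0) else set0.

Lemma sheet_open n : open (sheet n).
Proof.
rewrite /sheet; case: unpickle => [k|]; last exact: open0.
by case: pselect => a; [exact: box_open|exact: open0].
Qed.

Lemma sheet_inj n g h : sheet n g -> sheet n h -> coset_of g = coset_of h -> g = h.
Proof.
rewrite /sheet; case: unpickle => [k|//]; case: pselect => [H|//]; exact: H.
Qed.

Lemma sheet_cover g : exists n, sheet n g.
Proof.
have [n H] := locally_injective g; exists (pickle (box_around n g)).
rewrite /sheet pickleK; case: pselect => [a|//]; exact: box_aroundP.
Qed.

Definition sheet_image n : set (coset_borel R) := [set coset_of g | g in sheet n].

Lemma sheet_image_cover x : exists n, `[< sheet_image n x >].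
Proof.
have [g <-] := coset_of_surj x; have [n H] := sheet_cover g.
by exists n; apply/asboolP; exists g.
Qed.

Definition first_sheet x := ex_minn (sheet_image_cover x).

Lemma lift_ex x : exists g, sheet (first_sheet x) g /\ coset_of g = x.
Proof.
rewrite /first_sheet; case: ex_minnP => n /asboolP[g Hg <-] _; by exists g.
Qed.

(* A Borel section of [coset_of], sheet by sheet over the countably many boxes
   on which [coset_of] is injective. *)
Definition lift x : (SL2C_borel R) := projT1 (cid (lift_ex x)).

Lemma liftK x : coset_of (lift x) = x.
Proof. by rewrite /lift; case: cid => g []. Qed.

Lemma measurable_lift : measurable_fun setT lift.
Proof.
move=> _ B mB; rewrite setTI.
(* Cosets are sorted by their first sheet [n]; on those, [lift] inverts the restriction of
   [coset_of] to sheet [n]. *)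
have -> : lift @^-1` B = \bigcup_n ([set coset_of g | g in B `&` sheet n] `\`
    \bigcup_(m < n) sheet_image m).
  apply/seteqP; split => [x /= Bx|x [n _ [[g [Bg ng] <-] H]]].
    exists (first_sheet x) => //.
    have Hs : sheet (first_sheet x) (lift x) by rewrite /lift; case: cid => g [].
    split; first by exists (lift x); [|exact: liftK].
    move=> [m /= mn mx]; move: mn; rewrite /first_sheet; case: ex_minnP => n _ H.
    by rewrite ltnNge H//; apply/asboolP.
  have E : first_sheet (coset_of g) = n.
    rewrite /first_sheet; case: ex_minnP => m /asboolP mg mmin.
    apply/eqP; rewrite eqn_leq mmin//=; last by apply/asboolP; exists g.
    by rewrite leqNgt; apply/negP => mn; apply: H; exists m.
  rewrite /= /lift; case: cid => h [hs hg] /=.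
  by rewrite (@sheet_inj n h g)//; rewrite -E.
apply: bigcupT_measurable => n; apply: measurableD.
  by apply: measurable_coset_image => //; [exact: sheet_open|exact: sheet_inj].
apply: bigcup_measurable => m _; apply: open_measurable_coset.
exact/open_coset_image/sheet_open.
Qed.

End MeasurableLift.

(** * Haar measure *)

Section MeasurableReal.
Context {R : realType}.

Lemma measurable_invr : measurable_fun setT (fun x : R => x^-1).
Proof.
have mne : measurable_fun setT (fun x : R => x == 0).
  by apply: measurable_fun_eqr.
have -> : (fun x : R => x^-1) = (fun x => if x == 0 then 0 else x^-1).
  by apply/funext => x; case: eqVneq => // ->; rewrite invr0.
apply: measurable_fun_if => //.
have -> : [set: R] `&` (fun x : R => x == 0) @^-1` [set false] = [set x | x != 0].
  by rewrite setTI; apply/seteqP; split => x /=; [move/negbT|move/negbTE].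
apply: open_continuous_measurable_fun.
  exact: open_neq.
by move=> x; rewrite inE /= => x0; exact: inv_continuous.
Qed.

Lemma measurable_sqrtr : measurable_fun setT (@Num.sqrt R).
Proof. by apply: continuous_measurable_fun => x; exact: sqrt_continuous. Qed.

End MeasurableReal.

Section Measurability.
Context {R : realType}.
Notation V4 := ((R * R) * (R * R))%type.
Notation V8 := (V4 * V4)%type.

Definition mcplx d (T : measurableType d) (f : T -> R[i]) :=
  measurable_fun setT (fun x => complex.Re (f x)) /\
  measurable_fun setT (fun x => complex.Im (f x)).

Section Ops.
Context d (T : measurableType d).
Implicit Types f g : T -> R[i].

Lemma mcplx_cst z : mcplx (fun _ : T => z).
Proof. by split. Qed.

Lemma mcplxD f g : mcplx f -> mcplx g -> mcplx (fun x => f x + g x).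
Proof.
move=> [f1 f2] [g1 g2]; split.
  under eq_fun do rewrite raddfD /=; exact: measurable_funD.
under eq_fun do rewrite raddfD /=; exact: measurable_funD.
Qed.

Lemma mcplxN f : mcplx f -> mcplx (fun x => - f x).
Proof.
move=> [f1 f2]; split.
  under eq_fun do rewrite raddfN /=; exact: measurable_funN.
under eq_fun do rewrite raddfN /=; exact: measurable_funN.
Qed.

Lemma cRe_mul (z w : R[i]) : complex.Re (z * w) =
  complex.Re z * complex.Re w - complex.Im z * complex.Im w.
Proof. by case: z w => [a b] [c e]. Qed.
Lemma cIm_mul (z w : R[i]) : complex.Im (z * w) =
  complex.Re z * complex.Im w + complex.Im z * complex.Re w.
Proof. by case: z w => [a b] [c e]. Qed.

Lemma mcplxM f g : mcplx f -> mcplx g -> mcplx (fun x => f x * g x).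
Proof.
move=> [f1 f2] [g1 g2]; split.
  under eq_fun do rewrite cRe_mul.
  by apply: measurable_funB; apply: measurable_funM.
under eq_fun do rewrite cIm_mul.
by apply: measurable_funD; apply: measurable_funM.
Qed.

Lemma mcplxV f : mcplx f -> mcplx (fun x => (f x)^-1).
Proof.
move=> [f1 f2].
have mN : measurable_fun setT (fun x => ((complex.Re (f x)) ^+ 2 + (complex.Im (f x)) ^+ 2)^-1).
  apply: (measurableT_comp measurable_invr).
  by apply: measurable_funD; apply: measurable_funX.
split.
  have -> : (fun x => complex.Re (f x)^-1) = (fun x => complex.Re (f x) *
      ((complex.Re (f x)) ^+ 2 + (complex.Im (f x)) ^+ 2)^-1).
    by apply/funext => x; case: (f x).
  exact: measurable_funM.
have -> : (fun x => complex.Im (f x)^-1) = (fun x => - complex.Im (f x) *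
    ((complex.Re (f x)) ^+ 2 + (complex.Im (f x)) ^+ 2)^-1).
  by apply/funext => x; case: (f x) => a b /=; rewrite mulNr.
by apply: measurable_funM => //; exact: measurable_funN.
Qed.

Lemma mcplx_sqrtc f : mcplx f -> mcplx (fun x => sqrtc (f x)).
Proof.
move=> [f1 f2].
have mr : measurable_fun setT (fun x => Num.sqrt ((complex.Re (f x)) ^+ 2 + (complex.Im (f x)) ^+ 2)).
  apply: (measurableT_comp measurable_sqrtr).
  by apply: measurable_funD; apply: measurable_funX.
split.
  have -> : (fun x => complex.Re (sqrtc (f x))) = (fun x =>
      Num.sqrt ((Num.sqrt ((complex.Re (f x)) ^+ 2 + (complex.Im (f x)) ^+ 2) + complex.Re (f x)) / 2)).
    by apply/funext => x; case: (f x).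
  apply: (measurableT_comp measurable_sqrtr); apply: measurable_funM => //.
  exact: measurable_funD.
have -> : (fun x => complex.Im (sqrtc (f x))) = (fun x =>
   (if 0 <= complex.Im (f x) then 1 else -1) *
   Num.sqrt ((Num.sqrt ((complex.Re (f x)) ^+ 2 + (complex.Im (f x)) ^+ 2) - complex.Re (f x)) / 2)).
  apply/funext => x; case: (f x) => a b /=; congr (_ * _).
  have [b0|b0|b0] := ltrgtP 0 b.
  - by rewrite gtr0_sg.
  - by rewrite ltr0_sg.
  - by [].
apply: measurable_funM.
  by apply: measurable_fun_ifT => //; exact: measurable_fun_ler.
apply: (measurableT_comp measurable_sqrtr); apply: measurable_funM => //.
exact: measurable_funB.
Qed.

Lemma measurable_SL2C_mcplx (f : T -> (SL2C_borel R)) :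
  (forall i j, mcplx (fun x => SL2C_mx (f x) i j)) -> measurable_fun setT f.
Proof. by move=> H; apply: measurable_fun_SL2C => i j; [exact: (H i j).1|exact: (H i j).2]. Qed.

Lemma mcplx_entry (f : T -> (SL2C_borel R)) i j :
  measurable_fun setT f -> mcplx (fun x => SL2C_mx (f x) i j).
Proof.
move=> mf; split.
  exact: (measurableT_comp (measurable_SL2C_Re i j) mf).
exact: (measurableT_comp (measurable_SL2C_Im i j) mf).
Qed.

Lemma measurable_SL2C_mul (u v : T -> (SL2C_borel R)) :
  measurable_fun setT u -> measurable_fun setT v ->
  measurable_fun setT (fun x => SL2C_mul (u x) (v x) : (SL2C_borel R)).
Proof.
move=> mu mv; apply: measurable_SL2C_mcplx => i j.
have -> : (fun x => SL2C_mx (SL2C_mul (u x) (v x)) i j) = (fun x =>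
    SL2C_mx (u x) i 0 * SL2C_mx (v x) 0 j + SL2C_mx (u x) i 1 * SL2C_mx (v x) 1 j).
  by apply/funext => x; rewrite -mul22E.
by apply: mcplxD; apply: mcplxM; exact: mcplx_entry.
Qed.

Lemma measurable_SL2C_inv (u : T -> (SL2C_borel R)) :
  measurable_fun setT u ->
  measurable_fun setT (fun x => SL2C_inv (u x) : (SL2C_borel R)).
Proof.
move=> mu; apply: measurable_SL2C_mcplx => i j.
have -> : (fun x => SL2C_mx (SL2C_inv (u x)) i j) = (fun x =>
  if i == 0 then (if j == 0 then SL2C_mx (u x) 1 1 else - SL2C_mx (u x) 0 1)
  else (if j == 0 then - SL2C_mx (u x) 1 0 else SL2C_mx (u x) 0 0)).
  by apply/funext => x; rewrite mxE.
by case: (i == 0); case: (j == 0); try apply: mcplxN; exact: mcplx_entry.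
Qed.

Lemma mcplx_p2c (f : T -> R * R) : measurable_fun setT f -> mcplx (fun x => p2c (f x)).
Proof.
move=> mf; split; first exact: (measurableT_comp measurable_fst mf).
exact: (measurableT_comp measurable_snd mf).
Qed.

End Ops.

Definition nsq (z : R[i]) : R := complex.Re z ^+ 2 + complex.Im z ^+ 2.

Lemma measurable_nsq d (T : measurableType d) (f : T -> R[i]) :
  mcplx f -> measurable_fun setT (fun x => nsq (f x)).
Proof. by move=> [f1 f2]; apply: measurable_funD; apply: measurable_funX. Qed.

Lemma nsqM z w : nsq (z * w) = nsq z * nsq w.
Proof. by case: z w => [a b] [c d]; rewrite /nsq /=; ring. Qed.

Lemma nsq_ge0 z : 0 <= nsq z.
Proof. by rewrite /nsq addr_ge0 ?sqr_ge0. Qed.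

Lemma nsq_eq0 z : (nsq z == 0) = (z == 0).
Proof.
by case: z => a b; rewrite /nsq paddr_eq0 ?sqr_ge0//= !sqrf_eq0 eq_complex.
Qed.

Lemma nsq1 : nsq 1 = 1. Proof. by rewrite /nsq /= expr1n expr0n addr0. Qed.

Lemma nsqV z : nsq z^-1 = (nsq z)^-1.
Proof.
have [->|z0] := eqVneq z 0; first by rewrite invr0 /nsq /= expr0n addr0 invr0.
by apply: (mulfI (x := nsq z)); rewrite ?nsq_eq0// -nsqM !mulfV ?nsq_eq0// nsq1.
Qed.

Definition mxp (M : V8) : 'M[R[i]]_2 :=
  mx22 (p2c M.1.1) (p2c M.2.1) (p2c M.1.2) (p2c M.2.2).

Definition detp (M : V8) : R[i] := p2c M.1.1 * p2c M.2.2 - p2c M.2.1 * p2c M.1.2.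

Lemma det_mxp M : \det (mxp M) = detp M.
Proof. by rewrite det22 !mxE. Qed.

Lemma det_normalized M : detp M != 0 -> \det ((sqrtc (detp M))^-1 *: mxp M) = 1.
Proof.
move=> M0; rewrite detZ det_mxp exprVn sqr_sqrtc mulVf//.
Qed.

(** The chosen square root depends on the determinant only, so [normalize] commutes with
    multiplication by SL_2(C) on either side. Singular matrices, which lie outside the cone, go to
    the identity. *)
Definition normalize (M : V8) : (SL2C_borel R) :=
  match pselect (detp M != 0) with
  | left H => SL2C_of (det_normalized H) | right _ => SL2C_one R end.

Lemma normalizeE M : detp M != 0 ->
  SL2C_mx (normalize M) = (sqrtc (detp M))^-1 *: mxp M.
Proof. by rewrite /normalize; case: pselect => //. Qed.

Lemma mcplx_detp : mcplx detp.
Proof.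
apply: mcplxD; [|apply: mcplxN]; apply: mcplxM; apply: mcplx_p2c;
  do ?[exact: measurableT_comp].
Qed.

Lemma measurable_det_neq0 : measurable_fun setT (fun M => detp M != 0).
Proof.
have -> : (fun M => detp M != 0) = (fun M => nsq (detp M) != 0).
  by apply/funext => M; rewrite nsq_eq0.
apply: measurable_neg; apply: measurable_fun_eqr => //.
exact/measurable_nsq/mcplx_detp.
Qed.

Lemma measurable_normalize : measurable_fun setT normalize.
Proof.
apply: measurable_SL2C_mcplx => i j.
have -> : (fun M => SL2C_mx (normalize M) i j) = (fun M =>
   if detp M != 0 then (sqrtc (detp M))^-1 *
     (if i == 0 then (if j == 0 then p2c M.1.1 else p2c M.2.1)
      else (if j == 0 then p2c M.1.2 else p2c M.2.2))
   else (i == j)%:R).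
  apply/funext => M; have [M0|M0] := boolP (detp M != 0).
    by rewrite normalizeE// !mxE.
  rewrite /normalize; case: pselect => [H|_]; first by case/negP: M0.
  by rewrite /= mxE.
have mp : mcplx (fun M => (sqrtc (detp M))^-1 *
     (if i == 0 then (if j == 0 then p2c M.1.1 else p2c M.2.1)
      else (if j == 0 then p2c M.1.2 else p2c M.2.2))).
  apply: mcplxM; first exact/mcplxV/mcplx_sqrtc/mcplx_detp.
  by case: (i == 0); case: (j == 0); apply: mcplx_p2c; exact: measurableT_comp.
have md := measurable_det_neq0.
split.
  under eq_fun do rewrite (fun_if (@complex.Re R)).
  by apply: measurable_fun_ifT => //; exact: mp.1.
under eq_fun do rewrite (fun_if (@complex.Im R)).
by apply: measurable_fun_ifT => //; exact: mp.2.
Qed.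

(* Haar measure of [SL_2(C)]: the Haar measure of [A] is the Lebesgue measure of
   the cone of the matrices with [0 < |det M| <= 1] that lie over [A]. *)
Definition cone (M : V8) : bool := (detp M != 0) && (nsq (detp M) <= 1).

Lemma measurable_cone : measurable_fun setT cone.
Proof.
apply: measurable_and; first exact: measurable_det_neq0.
by apply: measurable_fun_ler => //; exact/measurable_nsq/mcplx_detp.
Qed.

Definition cone_fun (f : (SL2C_borel R) -> \bar R) (M : V8) : \bar R :=
  if cone M then f (normalize M) else 0%E.

Definition haar (f : (SL2C_borel R) -> \bar R) : \bar R :=
  (\int[@leb8 R]_M cone_fun f M)%E.

Lemma cone_fun_ge0 f M : (forall g, 0 <= f g)%E -> (0 <= cone_fun f M)%E.
Proof. by move=> f0; rewrite /cone_fun; case: ifP. Qed.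

Lemma measurable_cone_fun f : measurable_fun setT f -> measurable_fun setT (cone_fun f).
Proof.
move=> mf; apply: measurable_fun_ifT => //; first exact: measurable_cone.
exact: (measurableT_comp mf measurable_normalize).
Qed.

Section Invariance.
Variables (f : (SL2C_borel R) -> \bar R).
Hypotheses (mf : measurable_fun setT f) (f0 : forall g, (0 <= f g)%E).

(** Multiplication by [h] preserves both Lebesgue measure and the determinant, hence the cone and
    the square root used in [normalize]. *)
Lemma haar_left (h : SL2C R) : haar (fun g => f (SL2C_mul h g)) = haar f.
Proof.
have [_ /(_ (cone_fun f) (measurable_cone_fun mf))] :=
  scales_linl (SL2C_detE h).
rewrite mul1e -/(haar f) => <-; last by move=> M; exact: cone_fun_ge0.
apply: eq_integral => M _; rewrite /cone_fun.
set M' := linl _ _ _ _ M.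
have mM' : mxp M' = SL2C_mx h *m mxp M.
  by apply: mx22_inj; rewrite mul22E !mxE /= c2pK.
have dM' : detp M' = detp M by rewrite -!det_mxp mM' det_mulmx SL2C_det mul1r.
rewrite /cone dM'; case: ifP => // /andP[M0 _]; congr f.
apply: SL2C_inj; rewrite normalizeE ?dM'// mM' scalemxAr -normalizeE//.
Qed.

Lemma haar_right (h : SL2C R) : haar (fun g => f (SL2C_mul g h)) = haar f.
Proof.
have [_ /(_ (cone_fun f) (measurable_cone_fun mf))] :=
  scales_linr (SL2C_detE h).
rewrite mul1e -/(haar f) => <-; last by move=> M; exact: cone_fun_ge0.
apply: eq_integral => M _; rewrite /cone_fun.
set M' := linr _ _ _ _ M.
have p2cA z w : p2c (caddp z w) = p2c z + p2c w :> R[i] by case: z w => [? ?] [? ?].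
have p2cM z w : p2c (cmulp z w) = p2c z * p2c w :> R[i] by case: z w => [? ?] [? ?].
have mM' : mxp M' = mxp M *m SL2C_mx h.
  by apply: mx22_inj; rewrite mul22E !mxE /= /cadd2 /cmul2 /= !(p2cA, p2cM) !c2pK; ring.
have dM' : detp M' = detp M by rewrite -!det_mxp mM' det_mulmx SL2C_det mulr1.
rewrite /cone dM'; case: ifP => // /andP[M0 _]; congr f.
apply: SL2C_inj; rewrite normalizeE ?dM'// mM' scalemxAl -normalizeE//.
Qed.

End Invariance.
End Measurability.

(** * Unfolding over the quotient and proportionality to Haar measure *)

Section OrbitSum.
Context {R : realType}.
Notation G := (SL2C_borel R).
Notation X := (coset_borel R).
Local Open Scope ereal_scope.

Definition orbit_sum (f : G -> \bar R) (x : X) : \bar R :=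
  \esum_(g in [set g : SL2C R | coset_of g = x]) f g.

Lemma SL2O_enum : exists B : set nat, exists e : nat -> SL2C R, set_bij B (SL2O R) e.
Proof.
have /countable_bijP[B /card_esym/card_set_bijP[e He]] := countable_SL2O (R := R).
by exists B, e.
Qed.

Definition gam_set : set nat := projT1 (cid SL2O_enum).
Definition gam : nat -> SL2C R := projT1 (cid (projT2 (cid SL2O_enum))).
Lemma gam_bij : set_bij gam_set (SL2O R) gam.
Proof. exact: projT2 (cid (projT2 (cid SL2O_enum))). Qed.

(** The unordered sum is intrinsic, which gives the equivariance [orbit_sum_act]; the series based
    at [lift x] makes measurability in [x] visible. *)
Lemma orbit_sumE f x : (forall g, 0 <= f g) ->
  orbit_sum f x = \sum_(n <oo | n \in gam_set) f (SL2C_mul (lift x) (gam n)).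
Proof.
move=> f0; rewrite nneseries_esum//.
have -> : [set n | n \in gam_set] = gam_set.
  by apply/seteqP; split => n /=; rewrite inE.
rewrite /orbit_sum (@reindex_esum R _ _ (SL2O R) _ (fun k => SL2C_mul (lift x) k)).
  exact: (@reindex_esum R _ _ gam_set (SL2O R) gam (fun k => f (SL2C_mul (lift x) k)) gam_bij).
split.
- by move=> k Ok /=; rewrite coset_of_mul// liftK.
- by move=> k l _ _ /(congr1 (SL2C_mul (SL2C_inv (lift x)))); rewrite !SL2C_mulKg.
- move=> g /= gx; have /coset_ofP[k Ok E] : coset_of (lift x) = coset_of g.
    by rewrite liftK.
  by exists k.
Qed.

Lemma measurable_lift_mul (n : nat) :
  measurable_fun setT (fun x : X => SL2C_mul (lift x) (gam n) : G).
Proof. by apply: measurable_SL2C_mul => //; exact: measurable_lift. Qed.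

Lemma orbit_sum_ge0 f x : (forall g, 0 <= f g) -> 0 <= orbit_sum f x.
Proof. by move=> f0; apply: esum_ge0. Qed.

Lemma measurable_orbit_sum f : measurable_fun setT f -> (forall g, 0 <= f g) ->
  measurable_fun setT (orbit_sum f).
Proof.
move=> mf f0.
have -> : orbit_sum f = (fun x => \sum_(n <oo | n \in gam_set) f (SL2C_mul (lift x) (gam n))).
  by apply/funext => x; exact: orbit_sumE.
apply: ge0_emeasurable_sum => // n _.
exact: (measurableT_comp mf (measurable_lift_mul n)).
Qed.

Definition act (h : SL2C R) (x : X) : X := coset_of (SL2C_mul h (lift x)).

Lemma coset_of_mull (h g g' : SL2C R) :
  coset_of g = coset_of g' -> coset_of (SL2C_mul h g) = coset_of (SL2C_mul h g').
Proof. by move=> /coset_ofP[k Ok ->]; rewrite SL2C_mulA (coset_of_mul _ Ok). Qed.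

Lemma act_coset h g : act h (coset_of g) = coset_of (SL2C_mul h g).
Proof. by apply: coset_of_mull; rewrite liftK. Qed.

Lemma orbit_sum_act f h x : (forall g, 0 <= f g) ->
  orbit_sum (fun g => f (SL2C_mul h g)) x = orbit_sum f (act h x).
Proof.
move=> f0; rewrite /orbit_sum.
rewrite [RHS](@reindex_esum R _ _ [set g : SL2C R | coset_of g = x] _ (SL2C_mul h))//.
split.
- by move=> g /= <-; rewrite act_coset.
- by move=> k l _ _ /(congr1 (SL2C_mul (SL2C_inv h))); rewrite !SL2C_mulKg.
- move=> g /= gx; exists (SL2C_mul (SL2C_inv h) g); last by rewrite SL2C_mulKVg.
  have [y xy] := coset_of_surj x; rewrite -xy act_coset in gx.
  by rewrite /= (coset_of_mull _ gx) SL2C_mulKg.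
Qed.

Lemma measurable_act h : measurable_fun setT (act h).
Proof.
apply: (measurableT_comp measurable_coset_of).
by apply: measurable_SL2C_mul => //; exact: measurable_lift.
Qed.

Section Invariant.
Variable mu : probability X R.
Hypothesis mu_inv : SL2C_invariant mu.

(** Invariance is stated for the direct images [translate]; the preimage of a set under [act h] is
    its translate by the inverse of [h]. *)
Lemma scales_act h : scales mu 1 (act h).
Proof.
apply: scales_of_set => //; first exact: measurable_act.
move=> A mA; rewrite mul1e.
suff -> : act h @^-1` A = translate (SL2C_inv h) A by exact: mu_inv.
apply/seteqP; split => [x /= Ax|_ [g /= Ag <-]].
  exists (SL2C_mul h (lift x)) => //=.
  by rewrite SL2C_mulKg liftK.
by rewrite act_coset SL2C_mulKVg.
Qed.

(** The functional on the group that [mu] induces by unfolding; on an indicator it is the expected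
    number of bases of the random lattice in the given set. *)
Definition lam (f : G -> \bar R) : \bar R := \int[mu]_x orbit_sum f x.

Lemma lam_left (f : G -> \bar R) h : measurable_fun setT f -> (forall g, 0 <= f g) ->
  lam (fun g => f (SL2C_mul h g)) = lam f.
Proof.
move=> mf f0; rewrite /lam.
under eq_integral do rewrite orbit_sum_act//.
have [_ /(_ (orbit_sum f))] := scales_act h.
rewrite mul1e => -> //; first exact: measurable_orbit_sum.
by move=> x; exact: orbit_sum_ge0.
Qed.

Notation V8 := (((R * R) * (R * R)) * ((R * R) * (R * R)))%type.

Section Kernel.
Variables (f : G -> \bar R) (c : G -> G -> \bar R) (H : R).
Hypotheses (mf : measurable_fun setT f) (f0 : forall g, 0 <= f g).
Hypotheses (mc : forall d (T : measurableType d) (u v : T -> G),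
  measurable_fun setT u -> measurable_fun setT v ->
  measurable_fun setT (fun t => c (u t) (v t))).
Hypotheses (c0 : forall k g, 0 <= c k g).
Hypotheses (cH : forall g, haar (c^~ g) = H%:E).

Let K (x : X) (M : V8) : \bar R :=
  orbit_sum (fun g => f g * cone_fun (c^~ g) M) x.

Let term (n : nat) (p : X * V8) : \bar R :=
  let g := SL2C_mul (lift p.1) (gam n) in f g * cone_fun (c^~ g) p.2.

Let term_ge0 n p : 0 <= term n p.
Proof. by rewrite mule_ge0//; exact: cone_fun_ge0. Qed.

Let mterm n : measurable_fun setT (term n).
Proof.
have mg : measurable_fun setT (fun p : X * V8 => SL2C_mul (lift p.1) (gam n) : G).
  exact: (measurableT_comp (measurable_lift_mul n) measurable_fst).
apply: emeasurable_funM; first exact: (measurableT_comp mf mg).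
apply: measurable_fun_ifT => //; first exact: (measurableT_comp measurable_cone measurable_snd).
by apply: mc => //; exact: (measurableT_comp measurable_normalize measurable_snd).
Qed.

Let KE x M : K x M = \sum_(n <oo | n \in gam_set) term n (x, M).
Proof. by apply: orbit_sumE => g; rewrite mule_ge0//; exact: cone_fun_ge0. Qed.

Let mK : measurable_fun setT (fun p : X * V8 => K p.1 p.2).
Proof.
have -> : (fun p : X * V8 => K p.1 p.2) =
    (fun p => \sum_(n <oo | n \in gam_set) term n p).
  by apply/funext => -[x M]; exact: KE.
by apply: ge0_emeasurable_sum => // n _.
Qed.

Let K0 x M : 0 <= K x M.
Proof. by apply: orbit_sum_ge0 => g; rewrite mule_ge0//; exact: cone_fun_ge0. Qed.

Let int_row x : \int[@leb8 R]_M K x M = orbit_sum f x * H%:E.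
Proof.
have mt n : measurable_fun setT (fun M : V8 => term n (x, M)).
  exact: (measurable_fun_pair2 x (mterm n)).
have -> : (fun M => K x M) =
    (fun M => \sum_(n <oo) (if n \in gam_set then term n (x, M) else 0)).
  by apply/funext => M; rewrite KE eseries_mkcond.
rewrite integral_nneseries//; first last.
- by move=> n M _; case: ifP.
- by move=> n; case: (n \in gam_set).
rewrite orbit_sumE// muleC.
have H0 : (0 <= H)%R.
  by rewrite -lee_fin -(cH (SL2C_one R)); apply: integral_ge0 => M _; exact: cone_fun_ge0.
rewrite -nneseriesZl//.
rewrite [RHS]eseries_mkcond; apply: eq_eseriesr => n _.
case: ifP => _; last by rewrite integral0.
set g := SL2C_mul (lift x) (gam n).
transitivity (f g * \int[@leb8 R]_M cone_fun (c^~ g) M); last first.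
  by rewrite -/(haar _) cH muleC.
have mcg : measurable_fun setT (cone_fun (c^~ g)).
  by apply: measurable_cone_fun; exact: mc.
apply: (@ge0_integralZl _ _ R (@leb8 R) setT measurableT _ mcg (f g)) => //.
by move=> M _; exact: cone_fun_ge0.
Qed.

(** Tonelli on the product of the quotient and the space of matrices. By [cH], integrating the
    kernel over the cone gives the same [H] for every basis [g], so it leaves the orbit sum as a
    factor. *)
Lemma lam_kernel : lam f * H%:E =
  \int[@leb8 R]_M lam (fun g => f g * cone_fun (c^~ g) M).
Proof.
have <- : \int[mu]_x \int[@leb8 R]_M K x M = \int[@leb8 R]_M \int[mu]_x K x M.
  exact: (@fubini_tonelli _ _ _ _ R mu (@leb8 R) (fun p => K p.1 p.2) mK).
under eq_integral do rewrite int_row.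
rewrite ge0_integralZr//.
- exact: measurable_orbit_sum.
- by move=> x _; exact: orbit_sum_ge0.
- by rewrite -(cH (SL2C_one R)); apply: integral_ge0 => M _; exact: cone_fun_ge0.
Qed.

End Kernel.

(* Right invariance of [haar] evaluates one side of Tonelli's theorem, left
   invariance of [lam] and then of [haar] the other. *)
Lemma lam_haar (f h : G -> \bar R) :
  measurable_fun setT f -> (forall g, 0 <= f g) ->
  measurable_fun setT h -> (forall g, 0 <= h g) ->
  haar h \is a fin_num -> haar (f \o @SL2C_inv R) \is a fin_num ->
  lam f * haar h = lam h * haar (f \o @SL2C_inv R).
Proof.
move=> mf f0 mh h0 fh ff.
have mfV : measurable_fun setT (f \o @SL2C_inv R : G -> \bar R).
  by apply: (measurableT_comp mf); apply: measurable_SL2C_inv.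
have E1 : lam f * haar h = \int[@leb8 R]_M
    lam (fun g => f g * cone_fun (fun k => h (SL2C_mul k g)) M).
  rewrite -(fineK fh).
  apply: (@lam_kernel f (fun k g => h (SL2C_mul k g))) => //.
  - by move=> d T u v mu' mv; apply: (measurableT_comp mh); exact: measurable_SL2C_mul.
  - by move=> g; rewrite fineK//; exact: haar_right.
have E2 : lam h * haar (f \o @SL2C_inv R) = \int[@leb8 R]_M
    lam (fun g => h g * cone_fun (fun k => f (SL2C_mul (SL2C_inv k) g)) M).
  rewrite -(fineK ff).
  apply: (@lam_kernel h (fun k g => f (SL2C_mul (SL2C_inv k) g))) => //.
  - move=> d T u v mu' mv; apply: (measurableT_comp mf); apply: measurable_SL2C_mul => //.
    exact: measurable_SL2C_inv.
  (* Left translation by the inverse of [g] turns f(k^-1) into f(k^-1 g), so the integral in [k] is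
     the same for all [g]. *)
  - move=> g; rewrite fineK// -(haar_left mfV _ (SL2C_inv g))//.
    congr haar; apply/funext => k /=; congr f.
    rewrite -[LHS](SL2C_mulgK (SL2C_mul (SL2C_inv g) k)) -(SL2C_mulA (SL2C_inv k)).
    by rewrite SL2C_mulKVg SL2C_mulVg SL2C_mul1g.
  by move=> k; exact: f0.
rewrite E1 E2; apply: eq_integral => M _; rewrite /cone_fun; have [_|_] := boolP (cone M); last first.
  by congr lam; apply/funext => g; rewrite !mule0.
rewrite -(@lam_left (fun g => h g * f (SL2C_mul (SL2C_inv (normalize M)) g)) (normalize M)).
- by congr lam; apply/funext => g; rewrite SL2C_mulKg muleC.
- apply: emeasurable_funM => //; apply: (measurableT_comp mf).
  exact: measurable_SL2C_mul.
- by move=> g; rewrite mule_ge0.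
Qed.

End Invariant.
End OrbitSum.

(** * Reduction theory over the Eisenstein integers *)

Section Reduction.
Context {R : realType}.
Implicit Types (A B : 'M[R[i]]_2) (x y : R[i]) (g : SL2C R).
Notation eta := (eisenstein_unit R).
Notation O := (eisenstein R).
Notation Re := (@complex.Re R).
Notation Im := (@complex.Im R).
Notation s3 := (Num.sqrt 3 : R).

(* Gram data of the columns [v], [w] of [A]: [hv = |v|^2], [hw = |w|^2],
   [hs = <w, v>] and [hq x y = |x v + y w|^2]. *)
Definition hv A : R := nsq (A 0 0) + nsq (A 1 0).
Definition hw A : R := nsq (A 0 1) + nsq (A 1 1).
Definition hs A : R[i] := A 0 1 * conjc (A 0 0) + A 1 1 * conjc (A 1 0).
Definition hq A x y : R := nsq x * hv A + nsq y * hw A + 2 * Re (conjc x * y * hs A).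

Lemma hv_ge0 A : 0 <= hv A. Proof. by rewrite addr_ge0 ?nsq_ge0. Qed.

Lemma hqE A x y : hq A x y =
  nsq (A 0 0 * x + A 0 1 * y) + nsq (A 1 0 * x + A 1 1 * y).
Proof.
rewrite /hq /hv /hw /hs.
case: x y (A 0 0) (A 0 1) (A 1 0) (A 1 1) => [x1 x2] [y1 y2] [a1 a2] [b1 b2] [c1 c2] [d1 d2].
by rewrite /nsq /=; ring.
Qed.

(** Lagrange's identity for the Gram determinant of the two columns. *)
Lemma gram A : hv A * hw A = nsq (hs A) + nsq (\det A).
Proof.
rewrite det22 /hv /hw /hs.
case: (A 0 0) (A 0 1) (A 1 0) (A 1 1) => [a1 a2] [b1 b2] [c1 c2] [d1 d2].
by rewrite /nsq /=; ring.
Qed.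

Lemma hv_mul A B : hv (A *m B) = hq A (B 0 0) (B 1 0).
Proof. by rewrite hqE /hv !mul22E. Qed.

Lemma hw_mul A B : hw (A *m B) = hq A (B 0 1) (B 1 1).
Proof. by rewrite hqE /hw !mul22E. Qed.

Lemma hs_diag A B : B 0 1 = 0 -> B 1 0 = 0 ->
  hs (A *m B) = conjc (B 0 0) * B 1 1 * hs A.
Proof.
rewrite /hs !mul22E => -> ->.
case: (A 0 0) (A 0 1) (A 1 0) (A 1 1) (B 0 0) (B 1 1) => [a1 a2] [b1 b2] [c1 c2] [d1 d2] [x1 x2] [y1 y2].
by apply/eqP; rewrite eq_complex /=; apply/andP; split; apply/eqP; ring.
Qed.

Lemma s3_sq : s3 * s3 = 3. Proof. by rewrite -expr2 sqr_sqrtr. Qed.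
Lemma s3_gt0 : 0 < s3. Proof. by rewrite sqrtr_gt0. Qed.

Lemma eis_Re (p q : int) : Re (p%:~R + q%:~R * eta) = p%:~R + q%:~R / 2.
Proof.
have intE (a : int) : (a%:~R : R[i]) = (a%:~R : R)%:C by rewrite rmorph_int.
by rewrite !intE /= mul0r subr0.
Qed.

Lemma eis_Im (p q : int) : Im (p%:~R + q%:~R * eta) = q%:~R * (s3 / 2).
Proof.
have intE (a : int) : (a%:~R : R[i]) = (a%:~R : R)%:C by rewrite rmorph_int.
by rewrite !intE /= mul0r addr0 add0r.
Qed.

Lemma nsq_eis (p q : int) : nsq (p%:~R + q%:~R * eta) = (p * p + p * q + q * q)%:~R.
Proof.
rewrite /nsq eis_Re eis_Im !intrD !intrM.
transitivity (p%:~R * p%:~R + p%:~R * q%:~R + (1 + s3 * s3) / 4 * q%:~R * q%:~R : R).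
  by field.
by rewrite s3_sq; field.
Qed.

Lemma nsq_eis_ge1 x : O x -> x != 0 -> 1 <= nsq x.
Proof.
move=> /eisensteinP[p [q ->]]; rewrite -nsq_eq0 nsq_eis => H.
rewrite intr_eq0 in H; rewrite ler1z -gtz0_ge1 lt_neqAle eq_sym H /=.
have := sqr_ge0 (2 * p + q); have := sqr_ge0 q; rewrite !expr2; nia.
Qed.

(** Norms are integers. The gap from 1 to 2 is enough below because [bowtie_hv] bounds the square of
    [hv] by 3/2. *)
Lemma nsq_eis_1or2 x : O x -> x != 0 -> nsq x = 1 \/ 2 <= nsq x.
Proof.
move=> Ox x0; have := nsq_eis_ge1 Ox x0.
move: Ox => /eisensteinP[p [q ->]]; rewrite nsq_eis.
set n := (X in X%:~R); rewrite ler1z => n1.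
have [->|n2] : n = 1 \/ 2 <= n by lia.
  by left.
by right; rewrite (ler_int R 2 n).
Qed.

(** The left side is 2 max(|p|, |p + q|), and [p] and [p + q] are first coordinates of pairs with
    the same norm, (p, q) and (p + q, -q); the first coordinate never exceeds the norm. *)
Lemma eis_int_ineq (p q : int) : `|2 * p + q| + `|q| <= 2 * (p * p + p * q + q * q).
Proof.
have H (u v : int) : `|u| <= u * u + u * v + v * v.
  have [u0|u0] := lerP 0 u; [rewrite ger0_norm//|rewrite ltr0_norm//].
    have [->|[->|u2]] : u = 0 \/ u = 1 \/ 2 <= u by lia.
    - nia.
    - have [v0|v0] := lerP 0 v; nia.
    - have := sqr_ge0 (2 * v + u); rewrite expr2; nia.
  have [->|u2] : u = -1 \/ u <= -2 by lia.
    have [v0|v0] := lerP 0 v; nia.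
  have := sqr_ge0 (2 * v + u); rewrite expr2; nia.
have H1 := H p q; have H2 := H (p + q) (- q).
have E : (p + q) * (p + q) + (p + q) * (- q) + (- q) * (- q) = p * p + p * q + q * q by ring.
rewrite E in H2; lia.
Qed.

(* For [V = 1], a third of the hexagonal Voronoi cell of the Eisenstein integers:
   its rotations by the cube roots of unity cover the cell. *)
Definition bowtie (V : R) (s : R[i]) : bool :=
  (2 * `|Re s| <= V) && (s3 * `|Im s| <= `|Re s|).
Definition bowtie_oo (V : R) (s : R[i]) : bool :=
  (2 * `|Re s| < V) && (s3 * `|Im s| < `|Re s|).

Lemma bowtie_ooW V s : bowtie_oo V s -> bowtie V s.
Proof. by move=> /andP[/ltW H1 /ltW H2]; apply/andP. Qed.

(** For e = p + q eta the right side is (2p + q) Re s + q sqrt 3 Im s. In the sector both Re s and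
    sqrt 3 Im s are bounded by |Re s|, and [eis_int_ineq] treats all shifts [e] at once. *)
Lemma bowtie_pairing s e : O e -> s3 * `|Im s| <= `|Re s| ->
  - (2 * nsq e * `|Re s|) <= 2 * Re (conjc e * s).
Proof.
move=> /eisensteinP[p [q ->]] H; rewrite nsq_eis.
have -> : Re (conjc (p%:~R + q%:~R * eta) * s) =
    (p%:~R + q%:~R / 2) * Re s + q%:~R * (s3 / 2) * Im s.
  rewrite -(eis_Re p q) -(eis_Im p q) cRe_mul.
  by case: (p%:~R + q%:~R * eta) => a b /=; ring.
have K : `|2 * p%:~R + q%:~R : R| + `|q%:~R| <= 2 * (p * p + p * q + q * q)%:~R.
  by have := eis_int_ineq p q; rewrite -(ler_int R) !intrD !intrM !intr_norm !intrD !intrM.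
apply: le_trans (_ : - ((`|2 * p%:~R + q%:~R| + `|q%:~R|) * `|Re s|) <= _).
  by rewrite lerN2 ler_wpM2r.
have -> : 2 * ((p%:~R + q%:~R / 2) * Re s + q%:~R * (s3 / 2) * Im s) =
   (2 * p%:~R + q%:~R) * Re s + q%:~R * (s3 * Im s) by field.
rewrite mulrDl opprD; apply: lerD.
  by rewrite -normrM; have := ler_norm (- ((2 * p%:~R + q%:~R) * Re s)); rewrite normrN; lra.
apply: le_trans (_ : - `|q%:~R * (s3 * Im s)| <= _).
  rewrite lerN2 normrM ler_wpM2l// normrM (gtr0_norm s3_gt0)//.
by have := ler_norm (- (q%:~R * (s3 * Im s))); rewrite normrN; lra.
Qed.

(** The quotient of [hs] by [hv] lies in the Voronoi cell of 0, so adding Eisenstein multiples of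
    [v] cannot shorten [w]. *)
Lemma bowtie_shift A e : O e -> bowtie (hv A) (hs A) -> hw A <= hq A e 1.
Proof.
move=> Oe /andP[H1 H2]; rewrite /hq nsq1 mul1r mulr1.
have := bowtie_pairing Oe H2.
have := nsq_ge0 e; nra.
Qed.

Lemma bowtie_shift_lt A e : O e -> e != 0 -> bowtie_oo (hv A) (hs A) ->
  hw A < hq A e 1.
Proof.
move=> Oe e0 /andP[H1 /ltW H2]; rewrite /hq nsq1 mul1r mulr1.
have := bowtie_pairing Oe H2.
have := nsq_eis_ge1 Oe e0; nra.
Qed.

Definition redc A : bool := (hv A <= hw A) && bowtie (hv A) (hs A).
Definition redo A : bool := (hv A < hw A) && bowtie_oo (hv A) (hs A).

Lemma redoW A : redo A -> redc A.
Proof. by move=> /andP[/ltW H1 /bowtie_ooW H2]; apply/andP. Qed.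

Lemma hv_gt0 g : 0 < hv g.
Proof.
rewrite lt_neqAle hv_ge0 andbT eq_sym; apply/eqP => H.
have := gram g; rewrite H mul0r SL2C_det nsq1 => E.
have := nsq_ge0 (hs g); lra.
Qed.

(** In the bowtie |s|^2 is at most V^2 / 3, so V^2 <= |v|^2 |w|^2 = |s|^2 + 1 <= V^2 / 3 + 1. This
    is the source of the endpoint 3/2 of t^4. *)
Lemma bowtie_hv g : hv g <= hw g -> bowtie (hv g) (hs g) -> 2 * hv g ^+ 2 <= 3.
Proof.
move=> H /andP[H1 H2].
have := gram g; rewrite SL2C_det nsq1 => G.
have I : 3 * (Im (hs g)) ^+ 2 <= (Re (hs g)) ^+ 2.
  rewrite -[X in _ <= X]real_normK ?num_real// -[X in 3 * X]real_normK ?num_real//.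
  rewrite -s3_sq -expr2 -exprMn ler_pXn2r// nnegrE// mulr_ge0//.
have J : 4 * (Re (hs g)) ^+ 2 <= hv g ^+ 2.
  rewrite -[X in 4 * X]real_normK ?num_real//.
  have -> : 4 * `|Re (hs g)| ^+ 2 = (2 * `|Re (hs g)|) ^+ 2 by ring.
  by rewrite ler_pXn2r// nnegrE ?hv_ge0// mulr_ge0.
rewrite /nsq in G.
have := hv_ge0 g; nra.
Qed.

Lemma hq_unit A x y : nsq y = 1 -> hq A x y = hq A (conjc y * x) 1.
Proof.
rewrite /hq; case: x y (hs A) => [x1 x2] [y1 y2] [u v]; rewrite /nsq /= => Y.
have -> : (y1 * x1 - - y2 * x2) ^+ 2 + (y1 * x2 + - y2 * x1) ^+ 2 =
  (y1 ^+ 2 + y2 ^+ 2) * (x1 ^+ 2 + x2 ^+ 2) by ring.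
by rewrite Y; ring.
Qed.

Lemma eisenstein_conj x : O x -> O (conjc x).
Proof.
move=> /eisensteinP[p [q ->]]; apply/eisensteinP; exists (p + q), (- q).
have intE (a : int) : (a%:~R : R[i]) = (a%:~R : R)%:C by rewrite rmorph_int.
rewrite !intE; apply/eqP; rewrite eq_complex /= !intrD !mulrNz.
by apply/andP; split; apply/eqP; field.
Qed.

(** The vectors [v] and x v + y w have determinant [y], which the Gram identity bounds by the
    product of their lengths. *)
Lemma hq_cauchy g x y : nsq y <= hq g x y * hv g.
Proof.
have := gram (g *m mx22 1 x 0 y); rewrite hv_mul hw_mul det_mulmx SL2C_det mul1r det22 !mxE /=.
rewrite !mul1r !mulr0 subr0 => E.
have -> : hv g = hq g 1 0 by rewrite /hq nsq1 mulr0 mul0r /= /nsq /= expr0n /=; ring.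
rewrite mulrC E; have := nsq_ge0 (hs (g *m mx22 1 x 0 y)); lra.
Qed.

(** Three ranges: for y = 0 the vector is a multiple of [v]; for a unit [y] it is a shift of [w] up
    to a unit; otherwise |y|^2 >= 2, and [hq_cauchy] with [bowtie_hv] makes it longer than [v]. *)
Lemma redc_min g x y : redc g -> O x -> O y -> (x != 0) || (y != 0) -> hv g <= hq g x y.
Proof.
move=> /andP[vw bt] Ox Oy xy0; have v0 := hv_gt0 g.
have [y0|y0] := eqVneq y 0.
  move: xy0; rewrite y0 eqxx orbF => x0.
  have -> : hq g x 0 = nsq x * hv g.
    by rewrite /hq mulr0 mul0r /nsq /= expr0n /=; ring.
  by rewrite ler_peMl ?hv_ge0// nsq_eis_ge1.
have [y1|y2] := nsq_eis_1or2 Oy y0.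
  rewrite hq_unit//; apply: (le_trans vw); apply: bowtie_shift => //.
  by apply: eisensteinM => //; exact: eisenstein_conj.
have := hq_cauchy g x y; have := bowtie_hv vw bt; nra.
Qed.

Lemma redo_min_lt g x y : redo g -> O x -> O y -> y != 0 -> hv g < hq g x y.
Proof.
move=> /andP[vw bt] Ox Oy y0; have v0 := hv_gt0 g.
have [y1|y2] := nsq_eis_1or2 Oy y0.
  rewrite hq_unit//; apply: (lt_le_trans vw); apply: bowtie_shift => //.
    by apply: eisensteinM => //; exact: eisenstein_conj.
  exact: bowtie_ooW.
have := hq_cauchy g x y; have := bowtie_hv (ltW vw) (bowtie_ooW bt); nra.
Qed.

End Reduction.

(** * Uniqueness of strictly reduced bases up to sign *)

Section Uniqueness.
Context {R : realType}.
Implicit Types (A B : 'M[R[i]]_2) (x y : R[i]) (g h k : SL2C R).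
Notation eta := (eisenstein_unit R).
Notation O := (eisenstein R).
Notation Re := (@complex.Re R).
Notation Im := (@complex.Im R).
Notation s3 := (Num.sqrt 3 : R).

Lemma SL2C_opp_subproof g : \det (- SL2C_mx g) = 1.
Proof. by rewrite det22 !mxE -[RHS](SL2C_detE g); ring. Qed.

Definition SL2C_opp g : SL2C R := SL2C_of (SL2C_opp_subproof g).

Lemma SL2C_oppE g : SL2C_opp g = SL2C_mul g (SL2C_opp (SL2C_one R)).
Proof.
by apply: SL2C_inj; transitivity (SL2C_mx g *m (- 1%:M)) => //; rewrite mulmxN mulmx1.
Qed.

Lemma SL2O_opp1 : SL2O R (SL2C_opp (SL2C_one R)).
Proof. by move=> i j; rewrite /= mxE; apply: eisensteinN; exact: SL2O1. Qed.

Lemma SL2C_opp_neq g : SL2C_opp g <> g.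
Proof.
move=> /(congr1 (@SL2C_mx R)) E; have := SL2C_det g.
have H i j : SL2C_mx g i j = 0.
  have : SL2C_mx (SL2C_opp g) i j = SL2C_mx g i j by rewrite E.
  rewrite /= mxE => /eqP; rewrite -subr_eq0 -opprD oppr_eq0 -mulr2n mulrn_eq0 /=.
  by move/eqP.
by rewrite det22 !H mulr0 subrr => /eqP; rewrite eq_sym oner_eq0.
Qed.

Lemma hv_opp g : hv (SL2C_opp g) = hv g.
Proof. by rewrite /hv /nsq !mxE !raddfN /= !sqrrN. Qed.

Lemma redc_opp g : redc (SL2C_opp g) = redc g.
Proof.
rewrite /redc /bowtie hv_opp.
have -> : hw (SL2C_opp g) = hw g by rewrite /hw /nsq !mxE !raddfN /= !sqrrN.
by have -> : hs (SL2C_opp g) = hs g by rewrite /hs !mxE !raddfN /= !mulrN !mulNr !opprK.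
Qed.

Lemma SL2C_col_neq0 k : (k 0 0 != 0) || (k 1 0 != 0).
Proof.
apply/negP => /negP; rewrite negb_or !negbK => /andP[/eqP H1 /eqP H2].
by have := SL2C_detE k; rewrite H1 H2 mul0r mulr0 subrr => /eqP; rewrite eq_sym oner_eq0.
Qed.

Lemma hv_redc g k : redc g -> SL2O R k -> hv g <= hv (SL2C_mul g k).
Proof.
by move=> rg Ok; rewrite [leRHS]hv_mul; apply: redc_min => //; exact: SL2C_col_neq0.
Qed.

(** Strictness leaves no room for a unipotent change of basis, so [k] is diagonal with a unit [a]
    and its conjugate. This multiplies [hs] by the square of the conjugate of [a], which leaves the
    open third of the cell unless [a] is 1 or -1. *)
Lemma redo_unique g k : redo g -> SL2O R k -> redo (SL2C_mul g k) ->
  SL2C_mul g k = g \/ SL2C_mul g k = SL2C_opp g.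
Proof.
set h := SL2C_mul g k => rg Ok rh.
have OV := SL2OV Ok.
have gE : g = SL2C_mul h (SL2C_inv k) by rewrite /h SL2C_mulgK.
(* Otherwise the first column of [h] involves [w] and is strictly longer than [v], whereas [h] is
   itself reduced and leads back to [g] through the inverse of [k]. *)
have c0 : k 1 0 = 0.
  apply/eqP/negP => /negP c0.
  have : hv g < hv h by rewrite [ltRHS]hv_mul; exact: redo_min_lt.
  by rewrite ltNge {1}gE hv_redc//; exact: redoW.
have ad1 : k 0 0 * k 1 1 = 1 by have := SL2C_detE k; rewrite c0 mulr0 subr0.
have /(congr1 (@nsq R)) := ad1; rewrite nsqM nsq1 => nad.
have a0 : k 0 0 != 0.
  by apply/eqP => a0; move/eqP: ad1; rewrite a0 mul0r eq_sym oner_eq0.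
have d0 : k 1 1 != 0.
  by apply/eqP => d0; move/eqP: ad1; rewrite d0 mulr0 eq_sym oner_eq0.
have na1 := nsq_eis_ge1 (Ok 0 0) a0; have nd1 := nsq_eis_ge1 (Ok 1 1) d0.
have na : nsq (k 0 0) = 1 by nra.
have nd : nsq (k 1 1) = 1 by nra.
have conjc0 z : (conjc z == 0) = (z == 0) :> bool.
  by case: z => [p q]; rewrite !eq_complex /= oppr_eq0.
(* A nonzero entry would make the second column strictly longer from [g] to [h], and likewise from
   [h] back to [g]. *)
have b0 : k 0 1 = 0.
  apply/eqP/negP => /negP b0.
  have H1 : hw g < hw h.
    rewrite [ltRHS]hw_mul hq_unit//; apply: bowtie_shift_lt.
    - by apply: eisensteinM => //; exact: eisenstein_conj.
    - by rewrite mulf_neq0 ?conjc0.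
    - by case/andP: rg.
  have : hw h < hw g.
    rewrite [in ltRHS]gE [ltRHS]hw_mul !mxE /= hq_unit//; apply: bowtie_shift_lt.
    - by apply: eisensteinM; [exact: eisenstein_conj|exact: eisensteinN].
    - by rewrite mulf_neq0 ?conjc0 ?oppr_eq0.
    - by case/andP: rh.
  by rewrite ltNge (ltW H1).
have dE : k 1 1 = conjc (k 0 0).
  have aa : k 0 0 * conjc (k 0 0) = 1.
    move: na; case: (k 0 0) => p q; rewrite /nsq /= => E; apply/eqP.
    by rewrite eq_complex /=; apply/andP; split; apply/eqP; [rewrite -E|]; ring.
  by apply: (mulfI a0); rewrite ad1 aa.
have hsh : hs h = conjc (k 0 0) * conjc (k 0 0) * hs g by rewrite [LHS]hs_diag// dE.
have key : k 0 0 = 1 \/ k 0 0 = -1.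
  have [p [q E]] := (eisensteinP _).1 (Ok 0 0).
  have [q0|q0] := eqVneq q 0.
    move: na; rewrite E nsq_eis q0 !mulr0 !addr0 mul0r addr0 => /eqP.
    rewrite (eqr_int R _ 1) => /eqP pp.
    have [->|->] : p = 1 \/ p = -1 by nia.
      by left.
    by right; rewrite mulrN1z.
  (* The four other units have real part 1/2 and imaginary part sqrt 3 / 2 up to sign. They turn
     [hs g] by 120 degrees one way or the other, while [hs g] and [hs h] both lie in an open double
     sector of half-angle 30 degrees. *)
  exfalso.
  have x2 : 4 * Re (k 0 0) ^+ 2 = 1.
    have : (2 * p + q) ^+ 2 = 1.
      move: na; rewrite E nsq_eis => /eqP; rewrite (eqr_int R _ 1) => /eqP N1.
      have q2 : q * q = 1.
        have := sqr_ge0 (2 * p + q); rewrite expr2; nia.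
      rewrite expr2; nia.
    move=> /(congr1 (fun z : int => z%:~R : R)); rewrite expr2 intrM !intrD !intrM => H.
    by rewrite E eis_Re -[RHS]H; field.
  have y2 : 4 * Im (k 0 0) ^+ 2 = 3 by move: na; rewrite /nsq; lra.
  move: rg rh => /andP[_ /andP[_ B1]] /andP[_ /andP[_ B2]].
  have sq z : s3 * `|Im z| < `|Re z| -> 3 * Im z ^+ 2 < Re z ^+ 2.
    move=> H; rewrite -[X in _ < X]real_normK ?num_real// -[X in 3 * X]real_normK ?num_real//.
    rewrite -s3_sq -expr2 -exprMn ltr_pXn2r// nnegrE// mulr_ge0//.
  have := sq _ B1; have := sq _ B2; rewrite hsh.
  move: x2 y2; case: (k 0 0) (hs g) => [x y] [u v] /= x2 y2.
  set P := (X in 3 * X ^+ 2); set Q := (X in _ < X ^+ 2) => H2 H1.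
  have xy2 : x ^+ 2 = 4^-1 by lra.
  have xy3 : y ^+ 2 = 3 / 4 by lra.
  have PE : P = - v / 2 - 2 * x * y * u.
    rewrite /P; transitivity ((x ^+ 2 - y ^+ 2) * v - 2 * x * y * u); first by ring.
    by rewrite xy2 xy3; field.
  have QE : Q = - u / 2 + 2 * x * y * v.
    rewrite /Q; transitivity ((x ^+ 2 - y ^+ 2) * u + 2 * x * y * v); first by ring.
    by rewrite xy2 xy3; field.
  (* Squaring this gives u^4 < 3 u^2 v^2, against the sector condition 3 v^2 < u^2 for [hs g]. *)
  have : u ^+ 2 < - 4 * x * y * u * v.
    move: H2; rewrite PE QE.
    have -> : 3 * (- v / 2 - 2 * x * y * u) ^+ 2 =
       3 / 4 * v ^+ 2 + 6 * x * y * u * v + 12 * (x ^+ 2) * (y ^+ 2) * u ^+ 2 by field.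
    have -> : (- u / 2 + 2 * x * y * v) ^+ 2 =
       u ^+ 2 / 4 - 2 * x * y * u * v + 4 * (x ^+ 2) * (y ^+ 2) * v ^+ 2 by field.
    rewrite xy2 xy3; lra.
  move=> H3; have u0 : 0 <= u ^+ 2 by exact: sqr_ge0.
  have : (u ^+ 2) ^+ 2 < (- 4 * x * y * u * v) ^+ 2.
    by rewrite ltr_pXn2r// nnegrE// ltW// (le_lt_trans u0).
  have -> : (- 4 * x * y * u * v) ^+ 2 = 16 * x ^+ 2 * y ^+ 2 * (u ^+ 2 * v ^+ 2) by ring.
  rewrite xy2 xy3; nra.
have fin (e : R[i]) : e * e = 1 -> k 0 0 = e -> SL2C_mx k = e%:M.
  move=> ee ae; apply: mx22_inj; rewrite !mxE /= ?mulr1n ?mulr0n//.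
  by apply: (mulfI a0); rewrite ad1 ae ee.
case: key => E; [left|right].
  apply: SL2C_inj; transitivity (SL2C_mx g *m SL2C_mx k) => //.
  by rewrite (fin 1)// ?mulr1// mulmx1.
apply: SL2C_inj; transitivity (SL2C_mx g *m SL2C_mx k) => //.
by rewrite (fin (-1))// ?mulrNN ?mulr1// mul_mx_scalar scaleN1r.
Qed.

End Uniqueness.

(** * Existence of reduced bases and measurability of the shortest length *)

Section Shortest.
Context {R : realType}.
Implicit Types (A B : 'M[R[i]]_2) (x y : R[i]) (g h k : SL2C R).
Notation eta := (eisenstein_unit R).
Notation O := (eisenstein R).
Notation Re := (@complex.Re R).
Notation Im := (@complex.Im R).
Notation s3 := (Num.sqrt 3 : R).

Lemma hq01 A : hq A 0 1 = hw A.
Proof. by rewrite hqE /hw !mulr0 !mulr1 !add0r. Qed.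

Lemma hq10 A : hq A 1 0 = hv A.
Proof. by rewrite hqE /hv !mulr0 !mulr1 !addr0. Qed.

Lemma hq_ge0 A x y : 0 <= hq A x y.
Proof. by rewrite hqE addr_ge0 ?nsq_ge0. Qed.

Lemma hq_cauchy_l g x y : nsq x <= hq g x y * hw g.
Proof.
have := gram (g *m mx22 x 0 y 1); rewrite hv_mul hw_mul det_mulmx SL2C_det mul1r det22 !mxE /=.
rewrite !mulr1 mul0r subr0 hq01 => ->; have := nsq_ge0 (hs (g *m mx22 x 0 y 1)); lra.
Qed.

Lemma eis_coord_le (p q : int) : (`|p| <= p * p + p * q + q * q) /\ (`|q| <= p * p + p * q + q * q).
Proof.
have H1 := eis_int_ineq p q; have H2 := eis_int_ineq q p.
have E : q * q + q * p + p * p = p * p + p * q + q * q by ring.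
rewrite E in H2; lia.
Qed.

(** Sublevel sets are finite: if [hq g x y <= B], both [x] and [y] have norm at most [K], and the
    norm of an Eisenstein integer bounds its two integer coordinates. *)
Lemma eis_min g (S : set (R[i] * R[i])) : S !=set0 ->
  (forall p, S p -> O p.1 /\ O p.2) ->
  exists2 p, S p & forall q, S q -> hq g p.1 p.2 <= hq g q.1 q.2.
Proof.
move=> [p0 Sp0] SO; pose B := hq g p0.1 p0.2.
pose K := B * hv g + B * hw g.
have B0 : 0 <= B by exact: hq_ge0.
have hw0 : 0 <= hw g by rewrite addr_ge0 ?nsq_ge0.
have K0 : 0 <= K by rewrite /K addr_ge0// mulr_ge0// hv_ge0.
pose m := Num.bound K.
pose dec (i : 'I_(m + m).+1) : int := (i : nat)%:Z - m%:Z.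
have enc (z : int) : (`|z| <= m%:Z) -> exists i, dec i = z.
  move=> zm; have L : (absz (z + m%:Z)%R < (m + m).+1)%N by lia.
  by exists (Ordinal L); rewrite /dec /=; lia.
pose I := ('I_(m + m).+1 * 'I_(m + m).+1 * ('I_(m + m).+1 * 'I_(m + m).+1))%type.
pose F (i : I) : R[i] * R[i] :=
  (eis_of (dec i.1.1, dec i.1.2), eis_of (dec i.2.1, dec i.2.2)).
have encS q : S q -> hq g q.1 q.2 <= B -> exists i, F i = q.
  case: q => x y Sq /= qB; have [/= Ox Oy] := SO _ Sq.
  have [a [b xE]] := (eisensteinP _).1 Ox; have [c [d yE]] := (eisensteinP _).1 Oy.
  have bd (u v : int) : nsq (u%:~R + v%:~R * eta) <= K -> (`|u| <= m%:Z) /\ (`|v| <= m%:Z).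
    rewrite nsq_eis => H; have [H1 H2] := eis_coord_le u v.
    have : u * u + u * v + v * v <= m%:Z.
      rewrite -(ler_int R); apply: (le_trans H); apply/ltW.
      by have := archi_boundP K0.
    lia.
  have nx : nsq x <= K.
    apply: (le_trans (hq_cauchy_l g x y)).
    apply: (@le_trans _ _ (B * hw g)); first by rewrite ler_wpM2r.
    by rewrite /K lerDr mulr_ge0// hv_ge0.
  have ny : nsq y <= K.
    apply: (le_trans (hq_cauchy g x y)).
    apply: (@le_trans _ _ (B * hv g)); first by rewrite ler_wpM2r// hv_ge0.
    by rewrite /K lerDl mulr_ge0.
  rewrite xE in nx; rewrite yE in ny.
  have [/enc[i1 E1] /enc[i2 E2]] := bd _ _ nx.
  have [/enc[i3 E3] /enc[i4 E4]] := bd _ _ ny.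
  by exists ((i1, i2), (i3, i4)); rewrite /F /= E1 E2 E3 E4 xE yE.
have [i0 Fi0] := encS _ Sp0 (lexx _).
pose P i := `[< S (F i) >].
have Pi0 : P i0 by apply/asboolP; rewrite Fi0.
pose v i := hq g (F i).1 (F i).2.
case: (@Order.TotalTheory.arg_minP _ _ _ i0 P v Pi0) => i /asboolP Si imin.
exists (F i) => // q Sq; have [qB|qB] := lerP (hq g q.1 q.2) B.
  have [j Fj] := encS _ Sq qB.
  by have := imin j; rewrite /P /v Fj => -> //; apply/asboolP.
apply: (le_trans _ (ltW qB)); have := imin i0 Pi0.
by rewrite /v Fi0.
Qed.

Definition mk22 a b c d (H : \det (mx22 a b c d) = 1) : SL2C R := SL2C_of H.

Lemma SL2O_mk a b c d (H : \det (mx22 a b c d) = 1) :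
  O a -> O b -> O c -> O d -> SL2O R (mk22 H).
Proof.
by move=> Oa Ob Oc Od i j; rewrite /= mxE; case: (i == 0); case: (j == 0).
Qed.

(** Among the three rotates of [s] by cube roots of unity, the one with the largest |Re| lies in the
    bowtie. With X = Re s and Y = sqrt 3 Im s, the doubled |Re| of the rotates are 2|X|, |X + Y| and
    |X - Y|. Squares of units occur because the change of basis diag(u, conj u) multiplies [hs] by
    conj(u)^2. *)
Lemma bowtie_rotate (V : R) s :
  2 * `|Re s| <= V -> `|Re s + s3 * Im s| <= V -> `|Re s - s3 * Im s| <= V ->
  exists2 u : R[i], O u /\ nsq u = 1 & bowtie V (conjc u * conjc u * s).
Proof.
move=> H1 H2 H3; have S0 := s3_gt0 (R := R); have SS := s3_sq (R := R).
have Oe : O eta by exact: eisenstein_eta.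
have eta_nsq : nsq eta = 1.
  rewrite /nsq /=; transitivity ((1 + s3 * s3) / 4); first by field.
  by rewrite SS; field.
(* With a = Re z and b = sqrt 3 Im z, the sector condition |b| <= |a| amounts to |a + b| <= 2|a| and
   |a - b| <= 2|a|. *)
have bt z (a b : R) : Re z = a -> s3 * Im z = b -> 2 * `|a| <= V ->
    `|a + b| <= 2 * `|a| -> `|a - b| <= 2 * `|a| -> bowtie V z.
  move=> <- bE A1 A2 A3; apply/andP; split => //.
  rewrite -[X in X * _](gtr0_norm S0) -normrM bE.
  move: A2 A3; rewrite !ler_norml; set a' := Re z => /andP[B1 B2] /andP[B3 B4].
  by move: B1 B2 B3 B4; case: (ger0P a') => X0 B1 B2 B3 B4; lra.
have e2 : (conjc eta * conjc eta) = - 2^-1 -i* (s3 / 2).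
  apply/eqP; rewrite eq_complex /=; apply/andP; split; apply/eqP.
    transitivity ((1 - s3 * s3) / 4); first by field.
    by rewrite SS; field.
  by field.
have e4 : (conjc (eta * eta) * conjc (eta * eta)) = - 2^-1 +i* (s3 / 2).
  rewrite eta_sqr; apply/eqP; rewrite eq_complex /=; apply/andP; split; apply/eqP.
    transitivity ((1 - s3 * s3) / 4); first by field.
    by rewrite SS; field.
  by field.
have R2 : Re (conjc eta * conjc eta * s) = (- Re s + s3 * Im s) / 2.
  by rewrite e2; case: (s) => a b /=; field.
have I2 : s3 * Im (conjc eta * conjc eta * s) = - (3 * Re s + s3 * Im s) / 2.
  rewrite e2; case: (s) => a b /=; transitivity (- (s3 * s3 * a + s3 * b) / 2); first by field.
  by rewrite SS.
have R4 : Re (conjc (eta * eta) * conjc (eta * eta) * s) = (- Re s - s3 * Im s) / 2.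
  by rewrite e4; case: (s) => a b /=; field.
have I4 : s3 * Im (conjc (eta * eta) * conjc (eta * eta) * s) = (3 * Re s - s3 * Im s) / 2.
  rewrite e4; case: (s) => a b /=; transitivity ((s3 * s3 * a - s3 * b) / 2); first by field.
  by rewrite SS.
have conj1 : conjc (1 : R[i]) * conjc 1 * s = s.
  by case: (s) => a b; apply/eqP; rewrite eq_complex /=; apply/andP; split; apply/eqP; ring.
have n2 : nsq (eta * eta) = 1 by rewrite nsqM eta_nsq mulr1.
have Oe2 : O (eta * eta) by exact: eisensteinM.
set X := Re s in H1 H2 H3 R2 I2 R4 I4; set Y := s3 * Im s in H2 H3 R2 I2 R4 I4.
have half (r : R) : `|r / 2| = `|r| / 2 by rewrite normrM [`|2^-1|]ger0_norm.
have A4 : `|(- X - Y) / 2| = `|X + Y| / 2.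
  have -> : (- X - Y) / 2 = - ((X + Y) / 2) by field.
  by rewrite normrN half.
have A2 : `|(- X + Y) / 2| = `|X - Y| / 2.
  have -> : (- X + Y) / 2 = - ((X - Y) / 2) by field.
  by rewrite normrN half.
have X2 : `|2 * X| = 2 * `|X| by rewrite normrM [`|2|]ger0_norm.
have case1 : `|X + Y| <= 2 * `|X| -> `|X - Y| <= 2 * `|X| ->
    exists2 u : R[i], O u /\ nsq u = 1 & bowtie V (conjc u * conjc u * s).
  move=> M1 M2; exists 1; first by split; [exact: eisenstein1|exact: nsq1].
  by rewrite conj1; apply: (bt _ X Y).
have case2 : `|X - Y| <= `|X + Y| -> 2 * `|X| <= `|X + Y| ->
    exists2 u : R[i], O u /\ nsq u = 1 & bowtie V (conjc u * conjc u * s).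
  move=> M1 M2; exists (eta * eta) => //; apply: (bt _ _ _ R4 I4); rewrite A4.
  - lra.
  - have -> : (- X - Y) / 2 + (3 * X - Y) / 2 = X - Y by field.
    lra.
  - have -> : (- X - Y) / 2 - (3 * X - Y) / 2 = - (2 * X) by field.
    by rewrite normrN X2; lra.
have case3 : `|X + Y| <= `|X - Y| -> 2 * `|X| <= `|X - Y| ->
    exists2 u : R[i], O u /\ nsq u = 1 & bowtie V (conjc u * conjc u * s).
  move=> M1 M2; exists eta => //; apply: (bt _ _ _ R2 I2); rewrite A2.
  - lra.
  - have -> : (- X + Y) / 2 + - (3 * X + Y) / 2 = - (2 * X) by field.
    by rewrite normrN X2; lra.
  - have -> : (- X + Y) / 2 - - (3 * X + Y) / 2 = X + Y by field.
    lra.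
have [M1|/ltW M1] := lerP `|X - Y| `|X + Y|.
  have [M2|/ltW M2] := lerP `|X + Y| (2 * `|X|); last exact: case2.
  by apply: case1 => //; apply: (le_trans M1).
have [M2|/ltW M2] := lerP `|X - Y| (2 * `|X|); last exact: case3.
by apply: case1 => //; apply: (le_trans M1).
Qed.

(** Lexicographic minimisation: first the length of [v] over all bases of the coset, then that of
    [w] over the bases with minimal [v]. A diagonal matrix of units finally rotates [hs] into the
    bowtie. *)
Lemma redc_exists g : exists2 k, SL2O R k & redc (SL2C_mul g k).
Proof.
have [[a0 c0] /= [k1 Ok1 [k1a k1c]] kmin] : exists2 p : R[i] * R[i],
    (exists2 k, SL2O R k & k 0 0 = p.1 /\ k 1 0 = p.2) &
    forall q : R[i] * R[i], (exists2 k, SL2O R k & k 0 0 = q.1 /\ k 1 0 = q.2) -> hq g p.1 p.2 <= hq g q.1 q.2.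
  apply: eis_min.
    exists (SL2C_one R 0 0, SL2C_one R 1 0); exists (SL2C_one R) => //; exact: SL2O1.
  by move=> p [k Ok [<- <-]].
have vmin k : SL2O R k -> hv (SL2C_mul g k1) <= hv (SL2C_mul g k).
  by move=> Ok; rewrite [leLHS]hv_mul [leRHS]hv_mul k1a k1c; apply: (kmin (k 0 0, k 1 0)); exists k.
have [[b1 d1] /= [k2 [Ok2 k2v] [k2b k2d]] wmin'] : exists2 p : R[i] * R[i],
    (exists2 k, SL2O R k /\ hv (SL2C_mul g k) = hv (SL2C_mul g k1) & k 0 1 = p.1 /\ k 1 1 = p.2) &
    forall q : R[i] * R[i], (exists2 k, SL2O R k /\ hv (SL2C_mul g k) = hv (SL2C_mul g k1)
      & k 0 1 = q.1 /\ k 1 1 = q.2) -> hq g p.1 p.2 <= hq g q.1 q.2.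
  apply: eis_min; first by exists (k1 0 1, k1 1 1); exists k1.
  by move=> p [k [Ok _] [<- <-]].
have wmin k : SL2O R k -> hv (SL2C_mul g k) = hv (SL2C_mul g k1) ->
    hw (SL2C_mul g k2) <= hw (SL2C_mul g k).
  by move=> Ok kv; rewrite [leLHS]hw_mul [leRHS]hw_mul k2b k2d; apply: (wmin' (k 0 1, k 1 1)); exists k.
set h := SL2C_mul g k2 in k2v wmin.
(* The exchange (v, w) -> (w, -v) has determinant 1, so [w] is also the first column of a basis in
   the coset. *)
have vw : hv h <= hw h.
  have D : \det (mx22 0 (-1) 1 0 : 'M[R[i]]_2) = 1 by rewrite det22 !mxE /=; ring.
  have Ow : SL2O R (mk22 D).
    apply: SL2O_mk; [exact: eisenstein0|exact/eisensteinN/eisenstein1|exact: eisenstein1|exact: eisenstein0].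
  have := vmin _ (SL2OM Ok2 Ow); rewrite -k2v SL2C_mulA [leRHS]hv_mul !mxE /=.
  by rewrite hq01.
have shift e : O e -> hw h <= hq h e 1.
  move=> Oe; have D : \det (mx22 1 e 0 1 : 'M[R[i]]_2) = 1 by rewrite det22 !mxE /=; ring.
  have Ou : SL2O R (mk22 D).
    by apply: SL2O_mk => //; [exact: eisenstein1|exact: eisenstein0|exact: eisenstein1].
  have := wmin _ (SL2OM Ok2 Ou); rewrite SL2C_mulA -/h => H.
  have := H _; rewrite [leRHS]hw_mul !mxE /=; apply.
  by rewrite -k2v [LHS]hv_mul !mxE /= hq10.
(* The six units give the six half-planes that bound the hexagonal cell. *)
have sh e : O e -> nsq e = 1 -> - hv h <= 2 * Re (conjc e * hs h).
  by move=> Oe ne; have := shift e Oe; rewrite /hq ne nsq1 !mul1r mulr1; lra.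
have [u [Ou nu] bt] : exists2 u : R[i], O u /\ nsq u = 1 & bowtie (hv h) (conjc u * conjc u * hs h).
  have S0 := s3_gt0 (R := R).
  have O1 := eisenstein1 (R := R).
  have Oe := eisenstein_eta (R := R).
  have Of := eisensteinM Oe Oe.
  have ne : nsq eta = 1 :> R.
    rewrite /nsq /=; transitivity ((1 + s3 * s3) / 4); first by field.
    by rewrite s3_sq; field.
  have nN (z : R[i]) : nsq (- z) = nsq z by rewrite /nsq !raddfN /= !sqrrN.
  have nf : nsq (eta * eta) = 1 :> R by rewrite nsqM ne mulr1.
  have H1 := sh _ O1 nsq1; have H2 := sh _ (eisensteinN O1); rewrite nN nsq1 in H2.
  have H3 := sh _ Oe ne; have H4 := sh _ (eisensteinN Oe); rewrite nN ne in H4.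
  have H5 := sh _ Of nf; have H6 := sh _ (eisensteinN Of); rewrite nN nf in H6.
  have {}H2 := H2 erefl; have {}H4 := H4 erefl; have {}H6 := H6 erefl.
  move: H1 H2 H3 H4 H5 H6; rewrite eta_sqr; case: (hs h) => a b /=.
  move=> H1 H2 H3 H4 H5 H6.
  apply: bowtie_rotate => /=.
  - by case: (ger0P a) => a0'; lra.
  - by case: (ger0P (a + s3 * b)) => a0'; lra.
  - by case: (ger0P (a - s3 * b)) => a0'; lra.
have D : \det (mx22 u 0 0 (conjc u) : 'M[R[i]]_2) = 1.
  rewrite det22 !mxE /= mulr0 subr0.
  move: nu; case: (u) => p q; rewrite /nsq /= => E.
  by apply/eqP; rewrite eq_complex /=; apply/andP; split; apply/eqP; [rewrite -E|]; ring.
have Oud : SL2O R (mk22 D).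
  by apply: SL2O_mk => //; [exact: eisenstein0|exact: eisenstein0|exact: eisenstein_conj].
exists (SL2C_mul k2 (mk22 D)); first exact: SL2OM.
rewrite SL2C_mulA -/h.
have E1 : hv (SL2C_mul h (mk22 D)) = hv h.
  by rewrite [LHS]hv_mul !mxE /= /hq nu !mulr0 mul0r /nsq /= expr0n /=; ring.
have nuc : nsq (conjc u) = 1.
  by rewrite -nu; case: (u) => p q; rewrite /nsq /= sqrrN.
have E2 : hw (SL2C_mul h (mk22 D)) = hw h.
  by rewrite [LHS]hw_mul !mxE /= hqE !mulr0 !add0r !nsqM nuc !mulr1.
have E3 : hs (SL2C_mul h (mk22 D)) = conjc u * conjc u * hs h.
  by rewrite [LHS]hs_diag !mxE.
by rewrite /redc E1 E2 E3 vw bt.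
Qed.

Lemma hermitian_normE (v : 'cV[R[i]]_2) :
  hermitian_norm v = Num.sqrt (nsq (v 0 0) + nsq (v 1 0)).
Proof.
rewrite /hermitian_norm !big_ord_recl big_ord0 addr0; congr Num.sqrt.
have H (z : R[i]) : ComplexField.Normc.normc z ^+ 2 = nsq z.
  by case: z => a b; rewrite /nsq /= sqr_sqrtr// addr_ge0 ?sqr_ge0.
by rewrite !H; congr (nsq (v _ _) + nsq (v _ _)); apply/val_inj.
Qed.

Lemma mulcV22 (A : 'M[R[i]]_2) (x : 'cV[R[i]]_2) i :
  (A *m x) i 0 = A i 0 * x 0 0 + A i 1 * x 1 0.
Proof.
rewrite mxE !big_ord_recl big_ord0 addr0.
by congr (A i _ * x _ _ + A i _ * x _ _); apply/val_inj.
Qed.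

Lemma hermitian_norm_mul (A : 'M[R[i]]_2) (x : 'cV[R[i]]_2) :
  hermitian_norm (A *m x) = Num.sqrt (hq A (x 0 0) (x 1 0)).
Proof. by rewrite hermitian_normE !mulcV22 hqE. Qed.

(** By [redc_min] the minimum is attained at the first column, so [xget] has exactly one candidate
    and does not fall back on 0. *)
Lemma shortest_length_redc g : redc g -> shortest_length (lattice_of g) = Num.sqrt (hv g).
Proof.
move=> rg; rewrite /shortest_length /=; set S := (X in X `&` _).
have Sv : S (Num.sqrt (hv g)).
  pose e : 'cV[R[i]]_2 := \col_i (i == 0)%:R.
  have e0 : e 0 0 = 1 by rewrite mxE.
  have e1 : e 1 0 = 0 by rewrite mxE.
  exists (SL2C_mx g *m e); last by rewrite hermitian_norm_mul e0 e1 hq10.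
  split.
    exists e => // i; rewrite mxE; case: (i == 0); [exact: eisenstein1|exact: eisenstein0].
  move=> E; have := hv_gt0 g.
  have F i : (SL2C_mx g *m e) i 0 = 0 by rewrite E mxE.
  have := F 0; have := F 1; rewrite !mulcV22 e0 e1 !mulr1 !mulr0 !addr0 => G1 G0.
  by rewrite /hv G0 G1 /nsq /= expr0n /= !addr0 ltxx.
have Slb : lbound S (Num.sqrt (hv g)).
  move=> _ [_ [[x Ox <-] x0] <-]; rewrite hermitian_norm_mul ler_wsqrtr//.
  apply: redc_min => //.
  apply/negP => /negP; rewrite negb_or !negbK => /andP[/eqP H1 /eqP H2]; apply: x0.
  apply/matrixP => i j; rewrite (ord1 j) mulcV22 H1 H2 !mulr0 addr0 mxE//.
apply: xget_unique; first by split.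
by move=> t [St tlb]; apply/eqP; rewrite eq_le tlb//= Slb.
Qed.

Lemma lattice_of_mul g k : SL2O R k -> lattice_of (SL2C_mul g k) = lattice_of g.
Proof.
have sub (A B : 'M[R[i]]_2) : (forall i j, O (B i j)) -> lattice_of (A *m B) `<=` lattice_of A.
  move=> OB _ [x Ox <-]; exists (B *m x); last by rewrite mulmxA.
  by move=> i; rewrite mulcV22; apply: eisensteinD; apply: eisensteinM.
move=> Ok; apply/seteqP; split; first exact: sub.
rewrite -{1}(SL2C_mulgK k g); exact: sub (SL2OV Ok).
Qed.

Definition ell g : R := shortest_length (lattice_of g).

Lemma ell_coset g h : coset_of g = coset_of h -> ell g = ell h.
Proof. by move=> /coset_ofP[k Ok ->]; rewrite /ell lattice_of_mul. Qed.

Lemma hq_mulmx A B x y : hq (A *m B) x y = hq A (B 0 0 * x + B 0 1 * y) (B 1 0 * x + B 1 1 * y).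
Proof. by rewrite !hqE !mul22E; congr (nsq _ + nsq _); ring. Qed.

Lemma ell_min g x y : O x -> O y -> (x != 0) || (y != 0) -> ell g <= Num.sqrt (hq g x y).
Proof.
move=> Ox Oy xy0; have [k Ok rk] := redc_exists g.
rewrite (@ell_coset g (SL2C_mul g k)); last by rewrite coset_of_mul.
rewrite /ell (shortest_length_redc rk) ler_wsqrtr//.
have -> : hq g x y = hq (SL2C_mul g k)
    (SL2C_inv k 0 0 * x + SL2C_inv k 0 1 * y) (SL2C_inv k 1 0 * x + SL2C_inv k 1 1 * y).
  by rewrite -hq_mulmx -[in LHS](SL2C_mulgK k g).
have OV := SL2OV Ok.
apply: redc_min => //; try by apply: eisensteinD; apply: eisensteinM.
apply: contraT; rewrite negb_or !negbK !mxE /= => /andP[/eqP E1 /eqP E2].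
have D := SL2C_detE k.
have x0 : x = 0.
  have : k 0 0 * (k 1 1 * x + - k 0 1 * y) + k 0 1 * (- k 1 0 * x + k 0 0 * y) = x.
    by rewrite -[RHS]mul1r -D; ring.
  by rewrite E1 E2 !mulr0 addr0 => <-.
have y0 : y = 0.
  have : k 1 0 * (k 1 1 * x + - k 0 1 * y) + k 1 1 * (- k 1 0 * x + k 0 0 * y) = y.
    by rewrite -[RHS]mul1r -D; ring.
  by rewrite E1 E2 !mulr0 addr0 => <-.
by move: xy0; rewrite x0 y0 eqxx.
Qed.

Lemma ell_attained g : exists x y, [/\ O x, O y, (x != 0) || (y != 0) & ell g = Num.sqrt (hq g x y)].
Proof.
have [k Ok rk] := redc_exists g.
exists (k 0 0), (k 1 0); split => //; first exact: SL2C_col_neq0.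
rewrite (@ell_coset g (SL2C_mul g k)); last by rewrite coset_of_mul.
by rewrite /ell (shortest_length_redc rk) -hv_mul.
Qed.

Lemma measurable_hq x y : measurable_fun setT (fun g : SL2C_borel R => hq (SL2C_mx g) x y).
Proof.
have -> : (fun g : SL2C_borel R => hq (SL2C_mx g) x y) = (fun g : SL2C_borel R =>
   nsq (SL2C_mx g 0 0 * x + SL2C_mx g 0 1 * y) + nsq (SL2C_mx g 1 0 * x + SL2C_mx g 1 1 * y)).
  by apply/funext => g; exact: hqE.
by apply: measurable_funD; apply: measurable_nsq; apply: mcplxD; apply: mcplxM;
  (exact: mcplx_entry || exact: mcplx_cst).
Qed.

(** The minimum is attained, so [ell g < t] means that one of countably many nonzero coordinate
    pairs gives a vector shorter than [t]. *)
Lemma measurable_ell : measurable_fun setT (ell : SL2C_borel R -> R).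
Proof.
apply: (measurability (@RGenInftyO.G R)) => [|_ [_ [t ->] <-]].
  exact: RGenInftyO.measurableE.
rewrite setTI.
pose xy (c : (int * int) * (int * int)) : R[i] * R[i] := (eis_of c.1, eis_of c.2).
have -> : (ell : SL2C_borel R -> R) @^-1` `]-oo, t[ =
   \bigcup_(c in [set c | ((xy c).1 != 0) || ((xy c).2 != 0)])
     [set g : SL2C_borel R | Num.sqrt (hq (SL2C_mx g) (xy c).1 (xy c).2) < t].
  apply/seteqP; split => [g /=|g [c /= c0 H]]; rewrite in_itv /=; last first.
    apply: (le_lt_trans (ell_min _ _ _ c0)) H; apply/eisensteinP;
    [by exists c.1.1, c.1.2|by exists c.2.1, c.2.2].
  have [x [y [Ox Oy xy0 ->]]] := ell_attained g => gt.
  have [a [b xE]] := (eisensteinP _).1 Ox; have [c [d yE]] := (eisensteinP _).1 Oy.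
  by exists ((a, b), (c, d)); rewrite /= /eis_of /= -?xE -?yE.
rewrite bigcup_mkcond; apply: countable_bigcupT_measurable => [|c]; first exact: countableP.
case: ifP => // _; apply: measurable_set_bool; apply: measurable_fun_ltr => //.
exact: (measurableT_comp measurable_sqrtr (measurable_hq _ _)).
Qed.

End Shortest.

(** * The law of the shortest length *)

Section Counting.
Context {R : realType}.
Notation G := (SL2C_borel R).
Notation X := (coset_borel R).

Definition red (o : bool) (A : 'M[R[i]]_2) : bool := if o then redo A else redc A.

(* [o = true] asks for the strict inequalities: a coset contains at least two
   elements of [red false] and at most two elements of [red true]. *)
Definition redF o (A : set R) (g : G) : \bar R :=
  ((red o (SL2C_mx g) && `[< A (Num.sqrt (hv (SL2C_mx g))) >])%:R)%:E.

Lemma redF_ge0 o A g : (0 <= redF o A g)%E.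
Proof. by rewrite lee_fin. Qed.

Lemma mcplx_hs : mcplx (fun g : G => hs (SL2C_mx g)).
Proof.
have mc (f : G -> R[i]) : mcplx f -> mcplx (fun g => conjc (f g)).
  move=> [f1 f2]; split.
    by have -> : (fun g => complex.Re (conjc (f g))) = (fun g => complex.Re (f g)) by apply/funext => g; case: (f g).
  have -> : (fun g => complex.Im (conjc (f g))) = (fun g => - complex.Im (f g)) by apply/funext => g; case: (f g).
  exact: measurable_funN.
by apply: mcplxD; apply: mcplxM; try apply: mc; exact: mcplx_entry.
Qed.

Lemma measurable_hv : measurable_fun setT (fun g : G => hv (SL2C_mx g)).
Proof. by apply: measurable_funD; apply: measurable_nsq; exact: mcplx_entry. Qed.

Lemma measurable_hw : measurable_fun setT (fun g : G => hw (SL2C_mx g)).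
Proof. by apply: measurable_funD; apply: measurable_nsq; exact: mcplx_entry. Qed.

Lemma measurable_normr_comp d (T : measurableType d) (f : T -> R) :
  measurable_fun setT f -> measurable_fun setT (fun x => `|f x|).
Proof. by move=> mf; exact: (measurableT_comp (@normr_measurable R setT) mf). Qed.

Lemma measurable_red o : measurable_fun setT (fun g : G => red o (SL2C_mx g)).
Proof.
have [s1 s2] := mcplx_hs.
have mv := measurable_hv; have mw := measurable_hw.
have n1 := measurable_normr_comp s1; have n2 := measurable_normr_comp s2.
have c1 : measurable_fun setT (fun g : G => 2 * `|complex.Re (hs (SL2C_mx g))|) by exact: measurable_funM.
have c2 : measurable_fun setT (fun g : G => Num.sqrt 3 * `|complex.Im (hs (SL2C_mx g))|) by exact: measurable_funM.
by case: o; apply: measurable_and; first [exact: measurable_fun_ltr|exact: measurable_fun_ler|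
  by apply: measurable_and; first [exact: measurable_fun_ltr|exact: measurable_fun_ler]].
Qed.

Lemma measurable_asbool_set d (T : measurableType d) (A : set T) :
  measurable A -> measurable_fun setT (fun x => `[< A x >]).
Proof.
move=> mA; apply: (measurable_fun_bool true).
rewrite setTI (_ : _ @^-1` _ = A)//.
by apply/seteqP; split => x /=; [move/asboolP|move=> Ax; apply/asboolP].
Qed.

Lemma measurable_redF o A : measurable A -> measurable_fun setT (redF o A).
Proof.
move=> mA.
have -> : redF o A = fun g : G => (if red o (SL2C_mx g) && `[< A (Num.sqrt (hv (SL2C_mx g))) >] then 1 else 0)%E.
  by apply/funext => g; rewrite /redF; case: ifP.
apply: measurable_fun_ifT => //; apply: measurable_and; first exact: measurable_red.
apply: (measurableT_comp (measurable_asbool_set mA)).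
exact: (measurableT_comp measurable_sqrtr measurable_hv).
Qed.

Lemma fsbig_opp (f : G -> \bar R) g :
  (\sum_(h \in [set g; SL2C_opp g]) f h = f g + f (SL2C_opp g))%E.
Proof.
rewrite fsbigU/= ?fsbig_set1//.
by move=> h [/= -> H]; have := SL2C_opp_neq (esym H).
Qed.

(** A reduced basis [g] exists in the coset, and [SL2C_opp g] is a second, distinct one with the
    same lengths. *)
Lemma le_redc_orbit_sum (A : set R) (x : X) :
  ((`[< A (ell (lift x)) >]%:R * 2)%:E <= orbit_sum (redF false A) x)%E.
Proof.
case: asboolP => Ax; last by rewrite mul0r; apply: orbit_sum_ge0 => g; exact: redF_ge0.
have [k Ok rk] := redc_exists (lift x).
set g := SL2C_mul _ _ in rk.
have gx : coset_of g = x by rewrite coset_of_mul// liftK.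
have F1 : redF false A g = 1%E.
  rewrite /redF /= rk /= -(shortest_length_redc rk) -/(ell g).
  by rewrite (@ell_coset _ g (lift x)) ?gx ?liftK// asboolT.
have F2 : redF false A (SL2C_opp g) = 1%E.
  by rewrite -F1 /redF /= redc_opp hv_opp.
apply: esum_ge; exists [set g; SL2C_opp g].
  split; first by rewrite finite_setU; split; exact: finite_set1.
  move=> h /= [->|->] //=; rewrite SL2C_oppE coset_of_mul//; exact: SL2O_opp1.
by rewrite fsbig_opp F1 F2 -EFinD lee_fin /=; lra.
Qed.

(** By [redo_unique] strictly reduced bases are among one [g] and its opposite. A coset whose
    reduced bases all lie on the boundary has none, hence only an inequality. *)
Lemma redo_orbit_sum_le (A : set R) (x : X) :
  (orbit_sum (redF true A) x <= (`[< A (ell (lift x)) >]%:R * 2)%:E)%E.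
Proof.
have [[g [gx Fg]]|none] := pselect (exists g : G, coset_of g = x /\ redF true A g != 0%E); last first.
  apply: (@le_trans _ _ 0%E); last by rewrite lee_fin mulr_ge0.
  rewrite /orbit_sum esum1// => g gx.
  by apply/eqP; apply: contra_notT none => Fg; exists g.
have [rg Ag] : redo (SL2C_mx g) /\ A (Num.sqrt (hv (SL2C_mx g))).
  move: Fg; rewrite /redF /=; case: (redo _) => /=; last by rewrite eqxx.
  by case: asboolP => //; rewrite eqxx.
have -> : `[< A (ell (lift x)) >].
  apply/asboolP; rewrite (@ell_coset _ _ g) ?liftK//.
  by rewrite /ell (shortest_length_redc (redoW rg)).
have F1 h : (redF true A h <= 1)%E by rewrite lee_fin lern1 leq_b1.
rewrite /orbit_sum esum_mkcond.
pose S : set G := [set g; SL2C_opp g].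
have fS : finite_set S by rewrite finite_setU; split; exact: finite_set1.
apply: (@le_trans _ _ (\esum_(h in S) redF true A h)%E).
  rewrite [leRHS]esum_mkcond; apply: le_esum => h _.
  case: ifPn => [/set_mem /= hx|_]; last by case: ifP => // _; exact: redF_ge0.
  case: ifPn => // /negP hS.
  have [//|] := leP (redF true A h) 0%E.
  move=> Fh; exfalso; apply: hS; rewrite inE.
  have [k Ok hk] : exists2 k, SL2O R k & h = SL2C_mul g k.
    by apply/coset_ofP; rewrite gx hx.
  have rh : redo (SL2C_mx h) by move: Fh; rewrite /redF /=; case: (redo _) => //=; rewrite ltxx.
  rewrite hk in rh; rewrite hk.
  by case: (redo_unique rg Ok rh) => ->; [left|right].
rewrite esum_fset//; last by move=> h _; exact: redF_ge0.
rewrite fsbig_opp; have -> : ((1 * 2)%:E = 1 + 1 :> \bar R)%E by rewrite -EFinD; congr EFin; lra.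
exact: leeD.
Qed.

Section Lam.
Variable mu : probability X R.
Local Open Scope ereal_scope.

Definition ell_law (A : set R) : \bar R := mu [set x | A (ell (lift x))].

Lemma measurable_ell_lift : measurable_fun setT (fun x : X => ell (lift x)).
Proof. exact: (measurableT_comp measurable_ell measurable_lift). Qed.

Lemma measurable_ell_set (A : set R) : measurable A -> measurable [set x : X | A (ell (lift x))].
Proof. by move=> mA; rewrite -[X in measurable X]setTI; exact: measurable_ell_lift. Qed.

Lemma ell_lawE A : measurable A ->
  \int[mu]_x (`[< A (ell (lift x)) >]%:R * 2)%:E = 2%:E * ell_law A.
Proof.
move=> mA; have mS := measurable_ell_set mA.
transitivity (\int[mu]_x (2%:E * (\1_[set x : X | A (ell (lift x))] x)%:E)).
  by apply: eq_integral => x _; rewrite -EFinM mulrC indicE; congr (2 * _%:R)%:E; apply/asboolP/idP; rewrite inE.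
rewrite ge0_integralZl//; last first.
  by apply/measurable_EFinP; exact: measurable_indic.
by rewrite integral_indic// setIT.
Qed.

Lemma redo_lam_le A : measurable A -> lam mu (redF true A) <= 2%:E * ell_law A.
Proof.
move=> mA; rewrite -ell_lawE//; apply: ge0_le_integral => //.
- by move=> x _; apply: orbit_sum_ge0 => g; exact: redF_ge0.
- by apply: measurable_orbit_sum => [|g]; [exact: measurable_redF|exact: redF_ge0].
- have -> : (fun x : X => (`[< A (ell (lift x)) >]%:R * 2)%:E) =
     (fun x => if `[< A (ell (lift x)) >] then 2%:E else 0 :> \bar R).
    by apply/funext => x; case: ifP => _; rewrite ?mul1r ?mul0r.
  apply: measurable_fun_ifT => //.
  exact: (measurableT_comp (measurable_asbool_set mA) measurable_ell_lift).
- by move=> x _; exact: redo_orbit_sum_le.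
Qed.

Lemma le_redc_lam A : measurable A -> 2%:E * ell_law A <= lam mu (redF false A).
Proof.
move=> mA; rewrite -ell_lawE//; apply: ge0_le_integral => //.
- have -> : (fun x : X => (`[< A (ell (lift x)) >]%:R * 2)%:E) =
     (fun x => if `[< A (ell (lift x)) >] then 2%:E else 0 :> \bar R).
    by apply/funext => x; case: ifP => _; rewrite ?mul1r ?mul0r.
  apply: measurable_fun_ifT => //.
  exact: (measurableT_comp (measurable_asbool_set mA) measurable_ell_lift).
- by apply: measurable_orbit_sum => [|g]; [exact: measurable_redF|exact: redF_ge0].
- by move=> x _; exact: le_redc_orbit_sum.
Qed.

End Lam.
End Counting.

(** * Haar measure of the reduced bases *)

Section IwasawaCoordinates.
Context {R : realType}.
Notation V4 := ((R * R) * (R * R))%type.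
Notation V8 := (V4 * V4)%type.

Definition nsq4 (v : V4) : R := nsq (p2c v.1) + nsq (p2c v.2).

(* [kmap v (z, d) = z v + d v^perp / |v|^2] is the column [w] such that
   [det (v, w) = d] and [<w, v> = z |v|^2]. *)
Definition kmap (v : V4) : V4 -> V4 :=
  linp (p2c v.1) (- conjc (p2c v.2) * (nsq4 v)^-1%:C)
       (p2c v.2) (conjc (p2c v.1) * (nsq4 v)^-1%:C).

(** The vectors v and v^perp / |v|^2 have determinant 1, so (z, d) are measure preserving
    coordinates for the second column. *)
Lemma scales_kmap v : nsq4 v != 0 -> scales leb4 1 (kmap v).
Proof.
move=> v0; apply: scales_linp.
have E : nsq4 v * (nsq4 v)^-1 = 1 by rewrite mulfV.
move: E; move: ((nsq4 v)^-1) => r; rewrite /nsq4 /nsq /= => E.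
by apply/eqP; rewrite eq_complex /= -[X in _ == X]E; apply/andP; split; apply/eqP; ring.
Qed.

Section At.
Variables (v p : V4).
Hypothesis v0 : nsq4 v != 0.
Let M : V8 := (v, kmap v p).
Let Vi : R := (nsq4 v)^-1.
Let VE : nsq4 v * Vi = 1. Proof. by rewrite mulfV. Qed.

Lemma detp_kmap : detp M = p2c p.2.
Proof.
rewrite /detp /M /= !c2pK.
move: VE; rewrite -/Vi; move: Vi => r; rewrite /nsq4 /nsq.
case: v => [[a1 a2] [c1 c2]]; case: p => [[z1 z2] [d1 d2]] /= E.
apply/eqP; rewrite eq_complex /=; apply/andP; split; apply/eqP.
  by rewrite -[RHS]mul1r -E; ring.
by rewrite -[RHS]mul1r -E; ring.
Qed.

Lemma hv_kmap : hv (mxp M) = nsq4 v.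
Proof. by rewrite /hv !mxE. Qed.

Lemma hw_kmap : hw (mxp M) = nsq (p2c p.1) * nsq4 v + nsq (p2c p.2) / nsq4 v.
Proof.
have -> : nsq (p2c p.2) / nsq4 v = nsq (p2c p.2) * (nsq4 v * Vi) * Vi.
  by rewrite VE mulr1.
rewrite /hw !mxE /= !c2pK -/Vi; move: Vi => r; rewrite /nsq4 /nsq.
case: v => [[a1 a2] [c1 c2]]; case: p => [[z1 z2] [d1 d2]] /=.
by ring.
Qed.

Lemma hs_kmap : hs (mxp M) = p2c p.1 * (nsq4 v)%:C.
Proof.
rewrite /hs !mxE /= !c2pK -/Vi; move: Vi => r; rewrite /nsq4 /nsq.
case: v => [[a1 a2] [c1 c2]]; case: p => [[z1 z2] [d1 d2]] /=.
by apply/eqP; rewrite eq_complex /=; apply/andP; split; apply/eqP; ring.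
Qed.
End At.

Lemma nsq_sqrtc (d : R[i]) : nsq (sqrtc d) = Num.sqrt (nsq d).
Proof. by rewrite -[in RHS](sqr_sqrtc d) expr2 nsqM -expr2 sqrtr_sqr ger0_norm// nsq_ge0. Qed.

Definition bowb (o : bool) (V : R) (s : R[i]) := if o then bowtie_oo V s else bowtie V s.

Definition lto (o : bool) (x y : R) := if o then x < y else x <= y.

(** For a basis of determinant 1 with |v| = t one has |w|^2 / |v|^2 = |z|^2 + t^-4, so this says
    that the basis is reduced. *)
Definition wset (o : bool) (t : R) (z : R[i]) : bool :=
  lto o 1 (nsq z + t ^- 4) && bowb o 1 z.

Lemma redE o A : red o A = lto o (hv A) (hw A) && bowb o (hv A) (hs A).
Proof. by case: o. Qed.

Lemma lto_pM2l o (a x y : R) : 0 < a -> lto o (a * x) (a * y) = lto o x y.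
Proof. by move=> a0; case: o; rewrite /lto ?ltr_pM2l ?ler_pM2l. Qed.

Lemma bowb_scale o (a V : R) s : 0 < a -> bowb o (a * V) (a%:C * s) = bowb o V s.
Proof.
move=> a0; have E1 : complex.Re (a%:C * s) = a * complex.Re s by case: (s) => p q /=; ring.
have E2 : complex.Im (a%:C * s) = a * complex.Im s by case: (s) => p q /=; ring.
case: o; rewrite /bowb /bowtie /bowtie_oo E1 E2 !normrM (gtr0_norm a0);
  have -> : 2 * (a * `|complex.Re s|) = a * (2 * `|complex.Re s|) by ring.
  have -> : Num.sqrt 3 * (a * `|complex.Im s|) = a * (Num.sqrt 3 * `|complex.Im s|) by ring.
  by rewrite !ltr_pM2l.
have -> : Num.sqrt 3 * (a * `|complex.Im s|) = a * (Num.sqrt 3 * `|complex.Im s|) by ring.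
by rewrite !ler_pM2l.
Qed.

Lemma hv_scale (k : R[i]) (A : 'M[R[i]]_2) : hv (k *: A) = nsq k * hv A.
Proof. by rewrite /hv !mxE !nsqM; ring. Qed.

Lemma hw_scale (k : R[i]) (A : 'M[R[i]]_2) : hw (k *: A) = nsq k * hw A.
Proof. by rewrite /hw !mxE !nsqM; ring. Qed.

Lemma hs_scale (k : R[i]) (A : 'M[R[i]]_2) : hs (k *: A) = (nsq k)%:C * hs A.
Proof.
have -> : (nsq k)%:C = k * conjc k.
  by case: k => x y; rewrite /nsq; apply/eqP; rewrite eq_complex /=; apply/andP; split; apply/eqP; ring.
by rewrite /hs !mxE !rmorphM /=; ring.
Qed.

Section Normalized.
Variables (M : V8).
Hypothesis M0 : detp M != 0.
Let D := Num.sqrt (nsq (detp M)).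
Let D0 : 0 < D. Proof. by rewrite sqrtr_gt0 lt_neqAle nsq_ge0 eq_sym nsq_eq0 M0. Qed.

Lemma hv_normalize : hv (SL2C_mx (normalize M)) = D^-1 * hv (mxp M).
Proof. by rewrite normalizeE// hv_scale nsqV nsq_sqrtc. Qed.

Lemma hw_normalize : hw (SL2C_mx (normalize M)) = D^-1 * hw (mxp M).
Proof. by rewrite normalizeE// hw_scale nsqV nsq_sqrtc. Qed.

Lemma hs_normalize : hs (SL2C_mx (normalize M)) = D^-1%:C * hs (mxp M).
Proof. by rewrite normalizeE// hs_scale nsqV nsq_sqrtc. Qed.
End Normalized.

(** Normalizing multiplies [hv], [hw] and [hs] by the same factor 1/|d|, so reducedness depends only
    on [z] and on the normalized length [t] of the first column. *)
Lemma red_normalize o (v p : V4) : nsq4 v != 0 -> p2c p.2 != 0 ->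
  let t := Num.sqrt (nsq4 v / Num.sqrt (nsq (p2c p.2))) in
  red o (SL2C_mx (normalize (v, kmap v p))) = wset o t (p2c p.1) /\
  Num.sqrt (hv (SL2C_mx (normalize (v, kmap v p)))) = t.
Proof.
move=> v0 d0 /=; set D := Num.sqrt (nsq _).
have Ed := detp_kmap p v0.
have M0 : detp (v, kmap v p) != 0 by rewrite Ed.
have D0 : 0 < D by rewrite sqrtr_gt0 lt_neqAle nsq_ge0 eq_sym nsq_eq0 d0.
have DD : D ^+ 2 = nsq (p2c p.2) by rewrite sqr_sqrtr// nsq_ge0.
have V0 : 0 < nsq4 v by rewrite lt_neqAle eq_sym v0 addr_ge0 ?nsq_ge0.
have T0 : 0 < D^-1 * nsq4 v by rewrite mulr_gt0 ?invr_gt0.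
rewrite redE hv_normalize// hw_normalize// hs_normalize// Ed -/D.
rewrite hv_kmap// hw_kmap// hs_kmap//; split; last by rewrite mulrC.
rewrite /wset; congr andb.
  rewrite -(lto_pM2l o 1 _ T0) mulr1; congr lto.
  have -> : Num.sqrt (nsq4 v / D) ^- 4 = (nsq4 v / D) ^- 2.
    rewrite -[4%N]/(2 * 2)%N exprM sqr_sqrtr// mulrC; exact: ltW.
  by rewrite -DD; field; rewrite v0 lt0r_neq0.
rewrite -(bowb_scale o 1 _ T0); congr bowb; first by rewrite mulr1.
by rewrite rmorphM /=; ring.
Qed.

End IwasawaCoordinates.

(** * The fundamental theorem of calculus and polar coordinates in C^2 *)

Section FTC.
Context {R : realType}.

Lemma leb1_itv_bnd (b0 b1 : bool) (x y : R) (f : R -> \bar R) :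
  measurable_fun setT f -> (forall t, t \in `[x, y] -> (0 <= f t)%E) ->
  (\int[leb1]_(t in [set` Interval (BSide b0 x) (BSide b1 y)]) f t =
   \int[@lebesgue_measure R]_(t in `[x, y]) f t)%E.
Proof.
move=> mf f0; rewrite leb1E//; first last.
- move=> t /= ti; apply: f0; move: ti; apply: subitvP.
  by rewrite subitvE; case: (b0); case: (b1); rewrite !bnd_simp.
- exact: measurable_funS mf.
by rewrite [LHS]integral_itv_bndoo ?[RHS]integral_itv_bndoo//; apply: measurable_funS mf.
Qed.

Lemma ftc_lebesgue (F f : R -> R) (x y : R) : x <= y ->
  (forall t, t \in `[x, y] -> is_derive t 1 F (f t)) ->
  {within `[x, y], continuous f} ->
  (\int[@lebesgue_measure R]_(t in `[x, y]) (f t)%:E = (F y - F x)%:E)%E.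
Proof.
rewrite le_eqVlt => /predU1P[<- _ _|xy dF cf].
  by rewrite set_itv1 integral_set1 subrr.
rewrite (@continuous_FTC2 _ f F)//.
  have cF t : t \in `[x, y] -> {for t, continuous F}.
    move=> /dF dt; apply: differentiable_continuous; apply/derivable1_diffP.
    exact: ex_derive.
  split.
  - by move=> t txy; have := dF t (subset_itv_oo_cc txy) => H; exact: ex_derive.
  - by apply: cvg_at_right_filter; apply: cF; rewrite in_itv /= lexx ltW.
  - by apply: cvg_at_left_filter; apply: cF; rewrite in_itv /= lexx ltW.
move=> t txy; rewrite derive1E; have H := dF t (subset_itv_oo_cc txy).
exact: derive_val.
Qed.

End FTC.

Section Radial.
Context {R : realType}.
Notation V4 := ((R * R) * (R * R))%type.
Local Open Scope ereal_scope.

Lemma leb1_itv (b0 b1 : bool) (x y : R) : (x <= y)%R ->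
  leb1 [set` Interval (BSide b0 x) (BSide b1 y)] = (y - x)%:E.
Proof.
move=> xy; rewrite /leb1 /= /leb1_set lebesgue_measure_itv /=.
case: ifPn => [_|]; first by rewrite EFinB.
rewrite lte_fin -leNgt => yx; have -> : x = y by apply/eqP; rewrite eq_le xy.
by rewrite subrr.
Qed.

Definition box2 (x y : R) : set (R * R) := `[x, y] `*` `[x, y].
Definition box4 (x y : R) : set V4 := box2 x y `*` box2 x y.

Lemma measurable_box2 x y : measurable (box2 x y).
Proof. by apply: measurableX. Qed.

Lemma leb2_box (x y : R) : (x <= y)%R -> leb2 (box2 x y) = ((y - x) ^+ 2)%:E.
Proof.
move=> xy; rewrite [LHS]product_measure1E//.
rewrite -[X in X * _]/(leb1 _) -[X in _ * X]/(leb1 _).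
by rewrite !leb1_itv// -EFinM expr2.
Qed.

Lemma leb4_box (x y : R) : (x <= y)%R -> leb4 (box4 x y) = ((y - x) ^+ 4)%:E.
Proof.
move=> xy; rewrite [LHS]product_measure1E//; try exact: measurable_box2.
rewrite -[X in X * _]/(leb2 _) -[X in _ * X]/(leb2 _) leb2_box// -EFinM -exprD//.
Qed.

Lemma mcplx_p2cT : mcplx (@p2c R).
Proof. exact: (mcplx_p2c (@measurable_id _ _ setT)). Qed.

Lemma measurable_nsq4 : measurable_fun setT (@nsq4 R).
Proof.
by apply: measurable_funD; apply: measurable_nsq; apply: mcplx_p2c;
  [exact: measurable_fst|exact: measurable_snd].
Qed.

Definition ball4 (r : R) : set V4 := [set v : V4 | (nsq4 v != 0)%R && (Num.sqrt (nsq4 v) < r)%R].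

Lemma measurable_ball4 r : measurable (ball4 r).
Proof.
apply: measurable_set_bool; apply: measurable_and.
  by apply: measurable_neg; apply: measurable_fun_eqr => //; exact: measurable_nsq4.
by apply: measurable_fun_ltr => //; exact: (measurableT_comp measurable_sqrtr measurable_nsq4).
Qed.

Lemma ball4_dilate (r : R) : (0 < r)%R -> leb4 (ball4 r) = (r ^+ 4)%:E * leb4 (ball4 1).
Proof.
move=> r0; have [ms /(_ (fun v => (\1_(ball4 r) v)%:E))] := scales_leb4_dilate r0.
rewrite (@integral_indic _ _ _ (@leb4 R) _ measurableT _ (measurable_ball4 r)) setIT.
have -> : (fun z : V4 => (\1_(ball4 r) ((r * z.1.1, r * z.1.2), (r * z.2.1, r * z.2.2))%R : R)%:E) = (fun z => (\1_(ball4 1) z : R)%:E).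
  apply/funext => z.
  suff E : (((r * z.1.1, r * z.1.2), (r * z.2.1, r * z.2.2))%R \in ball4 r) = (z \in ball4 1).
    by rewrite !indicE E.
  have E : nsq4 ((r * z.1.1, r * z.1.2), (r * z.2.1, r * z.2.2))%R = (r ^+ 2 * nsq4 z)%R.
    by rewrite /nsq4 /nsq /=; ring.
  suff K : ((r ^+ 2 * nsq4 z != 0) && (Num.sqrt (r ^+ 2 * nsq4 z) < r) = (nsq4 z != 0) && (Num.sqrt (nsq4 z) < 1))%R.
    by apply/idP/idP; rewrite !inE /ball4 /= E K.
  rewrite mulf_eq0 negb_or sqrf_eq0 gt_eqF// sqrtrM ?sqr_ge0// sqrtr_sqr gtr0_norm//.
  by rewrite -[X in (_ * _ < X)%R]mulr1 ltr_pM2l.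
rewrite (@integral_indic _ _ _ (@leb4 R) _ measurableT _ (measurable_ball4 1)) setIT.
move=> ->; last 2 first.
- by apply/measurable_EFinP; apply: measurable_indic; exact: measurable_ball4.
- by move=> x; rewrite lee_fin.
by rewrite muleA -EFinM mulfV ?mul1e// expf_neq0// gt_eqF.
Qed.

Lemma leb4_ball4_lt : leb4 (ball4 1) < +oo.
Proof.
apply: (@le_lt_trans _ _ (leb4 (box4 (-1) 1))); last first.
  by rewrite leb4_box ?ltry//; lra.
apply: le_measure; rewrite ?inE; [exact: measurable_ball4| |].
  by apply: measurableX; exact: measurable_box2.
move=> [[a b] [c e]] /andP[_ /=]; rewrite -[X in (_ < X)%R]sqrtr1 ltr_sqrt// /nsq4 /nsq /= => H.
have K (u : R) : (u ^+ 2 < 1)%R -> u \in `[-1, 1]%R.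
  by move=> u1; rewrite in_itv /=; apply/andP; split; nra.
have := sqr_ge0 a; have := sqr_ge0 b; have := sqr_ge0 c; have := sqr_ge0 e => h1 h2 h3 h4.
by split; split => /=; apply: K; lra.
Qed.

Lemma leb4_ball4_gt : 0 < leb4 (ball4 1).
Proof.
apply: (@lt_le_trans _ _ (leb4 (box4 4^-1 3^-1))).
  by rewrite leb4_box ?lte_fin ?exprn_gt0//; lra.
apply: le_measure; rewrite ?inE; [|exact: measurable_ball4|].
  by apply: measurableX; exact: measurable_box2.
move=> [[a b] [c e]] [[/= + +] [/= + +]]; rewrite !in_itv /= => /andP[a1 a2] /andP[b1 b2] /andP[c1 c2] /andP[e1 e2].
have K (u : R) : (4^-1 <= u)%R -> (u <= 3^-1)%R -> (0 < u ^+ 2 < 4^-1)%R.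
  by move=> u1 u2; apply/andP; split; nra.
have /andP[h1 h1'] := K a a1 a2; have /andP[h2 h2'] := K b b1 b2.
have /andP[h3 h3'] := K c c1 c2; have /andP[h4 h4'] := K e e1 e2.
rewrite /ball4 /nsq4 /nsq /=; apply/andP; split; first by apply: lt0r_neq0; lra.
by rewrite -[X in (_ < X)%R]sqrtr1 ltr_sqrt//; lra.
Qed.

(** The volume of the unit ball of C^2, a common factor of [mdens] and of the total mass that
    cancels in the law. *)
Definition cball : R := fine (leb4 (ball4 1)).

Lemma cballE : leb4 (ball4 1) = cball%:E.
Proof. by rewrite fineK// ge0_fin_numE ?leb4_ball4_lt. Qed.

Lemma cball_gt0 : (0 < cball)%R.
Proof. by rewrite -lte_fin -cballE leb4_ball4_gt. Qed.

(** The derivative of the volume of the ball of radius [t]; the maximum makes it vanish for negative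
    [t]. *)
Definition rdens (t : R) : R := (4 * cball * Num.max t 0 ^+ 3)%R.

Lemma rdens_ge0 t : (0 <= rdens t)%R.
Proof. by rewrite /rdens mulr_ge0// ?exprn_ge0 ?le_max ?lexx ?orbT// mulr_ge0// ltW// cball_gt0. Qed.

Lemma measurable_rdens : measurable_fun setT rdens.
Proof. by apply: measurable_funM => //; apply: measurable_funX; apply: measurable_maxr. Qed.

Definition rad_set (B : set R) : \bar R := leb4 [set v : V4 | nsq4 v != 0%R /\ B (Num.sqrt (nsq4 v))].
Definition den_set (B : set R) : \bar R := \int[leb1]_(t in B) (rdens t)%:E.

Lemma rad_set_itv (x : R) : rad_set `]-oo, x[ = leb4 (ball4 x).
Proof.
congr (leb4 _); apply/seteqP; split => v /=; rewrite /ball4 /= in_itv /=.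
  by case=> -> ->.
by move=> /andP[].
Qed.

Lemma ball4_neg (x : R) : (x <= 0)%R -> ball4 x = set0.
Proof.
move=> x0; apply/seteqP; split => v //; rewrite /ball4 /= => /andP[_ H].
have := sqrtr_ge0 (nsq4 v); lra.
Qed.

Lemma den_set_itv (x : R) : den_set `]-oo, x[ = leb4 (ball4 x).
Proof.
rewrite /den_set; have [x0|x0] := leP x 0%R.
  rewrite ball4_neg// measure0.
  have -> : \int[leb1]_(t in `]-oo, x[) (rdens t)%:E = \int[leb1]_(t in `]-oo, x[) 0.
    apply: eq_integral => t; rewrite inE /= in_itv /= => tx; congr EFin.
    by rewrite /rdens max_r ?expr0n ?mulr0//; lra.
  exact: integral0.
have -> : \int[leb1]_(t in `]-oo, x[) (rdens t)%:E = \int[leb1]_(t in `[0%R, x[) (rdens t)%:E.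
  rewrite [LHS]integral_mkcond [RHS]integral_mkcond; apply: eq_integral => t _.
  rewrite !patchE !mem_setE !in_itv /=; case: (ltP t x) => //= _; last by rewrite andbF.
  rewrite andbT; case: leP => // t0; congr EFin.
  by rewrite /rdens max_r ?expr0n ?mulr0//; lra.
rewrite leb1_itv_bnd//; last first.
- by move=> t _; rewrite lee_fin rdens_ge0.
- by apply/measurable_EFinP; exact: measurable_rdens.
transitivity (\int[@lebesgue_measure R]_(t in `[0%R, x]) (4 * cball * t ^+ 3)%:E).
  apply: eq_integral => t; rewrite inE /= in_itv /= => /andP[t0 _]; congr EFin.
  by rewrite /rdens max_l.
transitivity (cball * x ^+ 4 - cball * 0 ^+ 4)%:E; last first.
  by rewrite expr0n mulr0 subr0 ball4_dilate// cballE -EFinM mulrC.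
apply: (@ftc_lebesgue _ (fun t => cball * t ^+ 4)%R _ _ _ (ltW x0)); last first.
- apply: continuous_subspaceT => t; apply: cvgM; first exact: cvg_cst.
  exact: exprn_continuous.
- move=> t _; apply: is_derive_eq; rewrite /GRing.scale /=; ring.
Qed.

Lemma measurable_radial (B : set R) : measurable B ->
  measurable [set v : V4 | nsq4 v != 0%R /\ B (Num.sqrt (nsq4 v))].
Proof.
move=> mB; have -> : [set v : V4 | nsq4 v != 0%R /\ B (Num.sqrt (nsq4 v))] =
   [set v : V4 | (nsq4 v != 0)%R && `[< B (Num.sqrt (nsq4 v)) >]].
  by apply/seteqP; split => v /= => [[-> /asboolP]|/andP[-> /asboolP]].
apply: measurable_set_bool; apply: measurable_and.
  by apply: measurable_neg; apply: measurable_fun_eqr => //; exact: measurable_nsq4.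
apply: (measurableT_comp (measurable_asbool_set mB)).
exact: (measurableT_comp measurable_sqrtr measurable_nsq4).
Qed.

Fact rad_set0 : rad_set set0 = 0.
Proof. by rewrite /rad_set (_ : [set _ | _] = set0) ?measure0//; apply/seteqP; split => v // []. Qed.

Fact rad_set_ge0 B : 0 <= rad_set B. Proof. exact: measure_ge0. Qed.

Fact rad_set_sa : semi_sigma_additive rad_set.
Proof.
move=> F mF tF mU; rewrite /rad_set.
have -> : [set v : V4 | nsq4 v != 0%R /\ (\bigcup_k F k) (Num.sqrt (nsq4 v))] =
    \bigcup_k [set v : V4 | nsq4 v != 0%R /\ F k (Num.sqrt (nsq4 v))].
  by apply/seteqP; split => v /= => [[v0 [k _ Fk]]|[k _ [v0 Fk]]]; [exists k|split => //; exists k].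
apply: measure_semi_sigma_additive.
- by move=> k; exact: measurable_radial.
- by apply/trivIsetP => i j _ _ ij; apply/seteqP; split => v //= [[_ Fi] [_ Fj]];
    have /trivIsetP/(_ i j I I ij)/seteqP[/(_ (Num.sqrt (nsq4 v))) + _] := tF; apply.
- by apply: bigcup_measurable => k _; exact: measurable_radial.
Qed.
HB.instance Definition _ := isMeasure.Build _ _ _ rad_set rad_set0 rad_set_ge0 rad_set_sa.

Fact den_set0 : den_set set0 = 0. Proof. exact: integral_set0. Qed.
Fact den_set_ge0 B : 0 <= den_set B.
Proof. by apply: integral_ge0 => t _; rewrite lee_fin rdens_ge0. Qed.
Fact den_set_sa : semi_sigma_additive den_set.
Proof.
move=> F mF tF mU; rewrite /den_set ge0_integral_bigcup//; last first.
- by move=> t _; rewrite lee_fin rdens_ge0.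
- by apply/measurable_EFinP; exact: measurable_funS measurable_rdens.
apply: is_cvg_nneseries => n _ _; apply: integral_ge0 => t _; rewrite lee_fin; exact: rdens_ge0.
Qed.
HB.instance Definition _ := isMeasure.Build _ _ _ den_set den_set0 den_set_ge0 den_set_sa.

(** Polar coordinates: both sides are measures on the line, and they agree on the open half-lines,
    which generate, are stable under intersection and have finite measure. *)
Lemma rad_den (B : set R) : measurable B -> rad_set B = den_set B.
Proof.
move=> mB; apply: (@measure_unique _ R R (@RGenInftyO.G R) (fun n => `]-oo, n%:R[%classic)) => //.
- exact: RGenInftyO.measurableE.
- move=> _ _ [x ->] [y ->]; exists (Num.min x y).
  by apply/seteqP; split => t /=; rewrite !in_itv /= lt_min; [case=> -> ->|move=> /andP[]].
- by move=> n; exists n%:R.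
- apply/seteqP; split => t // _; exists (Num.bound `|t|) => //=; rewrite in_itv /=.
  exact: (le_lt_trans (ler_norm t) (archi_boundP (normr_ge0 t))).
- by move=> _ [x ->]; exact: etrans (rad_set_itv x) (esym (den_set_itv x)).
- move=> n; rewrite -[X in X < _]/(rad_set _) rad_set_itv.
  have [->|n0] := eqVneq (n%:R : R)%R 0%R; first by rewrite ball4_neg ?measure0.
  rewrite ball4_dilate; last by rewrite lt_neqAle eq_sym n0 ler0n.
  by rewrite cballE -EFinM ltry.
Qed.

End Radial.

(** * Haar measure of the reduced bases as an integral over the length *)

Section HaarRed.
Context {R : realType}.
Notation V4 := ((R * R) * (R * R))%type.
Local Open Scope ereal_scope.

Section Meas.
Context d (T : measurableType d).

Lemma measurable_lto o (f g : T -> R) : measurable_fun setT f -> measurable_fun setT g ->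
  measurable_fun setT (fun x => lto o (f x) (g x)).
Proof. by case: o => mf mg; [exact: measurable_fun_ltr|exact: measurable_fun_ler]. Qed.

Lemma measurable_wset o (f : T -> R) (g : T -> R[i]) : measurable_fun setT f -> mcplx g ->
  measurable_fun setT (fun x => wset o (f x) (g x)).
Proof.
move=> mf mg; have [g1 g2] := mg.
have n1 := measurable_normr_comp g1; have n2 := measurable_normr_comp g2.
have c1 : measurable_fun setT (fun x => 2 * `|complex.Re (g x)|)%R by exact: measurable_funM.
have c2 : measurable_fun setT (fun x => Num.sqrt 3 * `|complex.Im (g x)|)%R by exact: measurable_funM.
apply: measurable_and.
  apply: measurable_lto => //; apply: measurable_funD; first exact: measurable_nsq.
  by apply: (measurableT_comp measurable_invr); exact: measurable_funX.
by case: o; apply: measurable_and; first [exact: measurable_fun_ltr|exact: measurable_fun_ler].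
Qed.

Lemma measurable_ifE (b : T -> bool) : measurable_fun setT b ->
  measurable_fun setT (fun x => (b x)%:R%:E : \bar R).
Proof.
move=> mb; have -> : (fun x => (b x)%:R%:E : \bar R) = (fun x => if b x then 1 else 0).
  by apply/funext => x; case: (b x).
exact: measurable_fun_ifT.
Qed.
End Meas.

Definition cdisc (d : R * R) : bool := (p2c d != 0)%R && (nsq (p2c d) <= 1)%R.

Lemma measurable_cdisc : measurable_fun setT cdisc.
Proof.
apply: measurable_and.
  have -> : (fun d : R * R => (p2c d != 0)%R) = (fun d => (nsq (p2c d) != 0)%R).
    by apply/funext => M; rewrite nsq_eq0.
  by apply: measurable_neg; apply: measurable_fun_eqr => //; exact/measurable_nsq/mcplx_p2cT.
by apply: measurable_fun_ler => //; exact/measurable_nsq/mcplx_p2cT.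
Qed.

(** The factor |d|^2 is the Jacobian of the dilation of [v], in real dimension 4, by the square root
    of |d|, which removes [d] from the normalized length. *)
Definition ddens (d : R * R) : R := ((cdisc d)%:R * nsq (p2c d))%R.

Lemma ddens_ge0 d : (0 <= ddens d)%R.
Proof. by rewrite /ddens mulr_ge0 ?nsq_ge0. Qed.

Lemma measurable_ddens : measurable_fun setT ddens.
Proof.
apply: measurable_funM; last exact/measurable_nsq/mcplx_p2cT.
by apply/measurable_EFinP; apply: measurable_ifE; exact: measurable_cdisc.
Qed.

Definition cdet : \bar R := \int[leb2]_d (ddens d)%:E.

Lemma cdet_gt0 : 0 < cdet.
Proof.
pose e : R := (8^-1)%R.
apply: (@lt_le_trans _ _ (\int[leb2]_d (e%:E * (\1_(box2 4^-1 3^-1 : set (R * R)) d : R)%:E))).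
  rewrite ge0_integralZl//; last 2 first.
  - by apply/measurable_EFinP; apply: measurable_indic; exact: measurable_box2.
  - by rewrite lee_fin invr_ge0.
  rewrite (@integral_indic _ _ _ (@leb2 R) _ measurableT _ (measurable_box2 _ _)) setIT.
  rewrite -[X in _ < _ * X]/(leb2 _) leb2_box; last by lra.
  by rewrite -EFinM lte_fin mulr_gt0 ?invr_gt0// exprn_gt0//; lra.
apply: ge0_le_integral => //.
- by move=> d _; rewrite mule_ge0// lee_fin// invr_ge0.
- apply: emeasurable_funM => //; apply/measurable_EFinP.
  by apply: measurable_indic; exact: measurable_box2.
- by apply/measurable_EFinP; exact: measurable_ddens.
move=> d _; rewrite -EFinM lee_fin indicE; case: (boolP (d \in _)) => [|_]; last first.
  by rewrite mulr0 ddens_ge0.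
rewrite inE => -[/=]; rewrite !in_itv /= => /andP[a1 a2] /andP[b1 b2].
rewrite /ddens /cdisc -nsq_eq0.
have N : (8^-1 <= nsq (p2c d) <= 1)%R by rewrite /nsq /=; apply/andP; split; nra.
have /andP[N1 ->] := N; rewrite andbT mulr1.
by rewrite (_ : (nsq (p2c d) != 0)%R) ?mul1r//; apply: lt0r_neq0; lra.
Qed.

Lemma cdet_lt : cdet < +oo.
Proof.
apply: (@le_lt_trans _ _ (\int[leb2]_d (\1_(box2 (-1) 1 : set (R * R)) d : R)%:E)); last first.
  rewrite (@integral_indic _ _ _ (@leb2 R) _ measurableT _ (measurable_box2 _ _)) setIT.
  by rewrite -[X in X < _]/(leb2 _) leb2_box ?ltry//; lra.
apply: ge0_le_integral => //.
- by move=> d _; rewrite lee_fin ddens_ge0.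
- by apply/measurable_EFinP; exact: measurable_ddens.
- by apply/measurable_EFinP; apply: measurable_indic; exact: measurable_box2.
move=> d _; rewrite lee_fin indicE /ddens /cdisc; case: (boolP (_ && _)) => [|_]; last by rewrite mul0r.
move=> /andP[_ N]; rewrite mul1r; suff -> : d \in (box2 (-1) 1 : set (R * R)) by [].
have K (u : R) : (u ^+ 2 <= 1)%R -> u \in `[-1, 1]%R.
  by move=> u1; rewrite in_itv /=; apply/andP; split; nra.
have := sqr_ge0 d.1; have := sqr_ge0 d.2; rewrite /nsq /= in N => h1 h2.
by rewrite inE; split => /=; apply: K; lra.
Qed.

Definition wmeas (o : bool) (t : R) : \bar R := \int[leb2]_z (wset o t (p2c z))%:R%:E.

Section HaarOfReduced.
Variables (o : bool) (A : set R).
Hypothesis mA : measurable A.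

Let rg (v d : R * R * (R * R)) : R := Num.sqrt (nsq4 v / Num.sqrt (nsq (p2c d.2))).

Let g (x : V4 * V4) : \bar R := ((nsq4 x.1 != 0)%R && cdisc x.2.2 &&
  (wset o (rg x.1 x.2) (p2c x.2.1) && `[< A (rg x.1 x.2) >]))%:R%:E.

Let mg : measurable_fun setT g.
Proof.
have mn : measurable_fun setT (fun x : V4 * V4 => nsq4 x.1).
  exact: (measurableT_comp measurable_nsq4 measurable_fst).
have mr : measurable_fun setT (fun x : V4 * V4 => rg x.1 x.2).
  apply: (measurableT_comp measurable_sqrtr); apply: measurable_funM => //.
  apply: (measurableT_comp measurable_invr); apply: (measurableT_comp measurable_sqrtr).
  apply/measurable_nsq/mcplx_p2c.
  exact: (measurableT_comp measurable_snd measurable_snd).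
apply: measurable_ifE; apply: measurable_and; last first.
  apply: measurable_and; last exact: (measurableT_comp (measurable_asbool_set mA)).
  apply: measurable_wset => //; apply: mcplx_p2c.
  exact: (measurableT_comp measurable_fst measurable_snd).
apply: measurable_and; first by apply: measurable_neg; exact: measurable_fun_eqr.
apply: (measurableT_comp measurable_cdisc).
exact: (measurableT_comp measurable_snd measurable_snd).
Qed.

Let g0 x : 0 <= g x. Proof. by rewrite lee_fin. Qed.

Let inner v : \int[leb4]_w cone_fun (redF o A) (v, w) = \int[leb4]_p g (v, p).
Proof.
have mc := measurable_cone_fun (measurable_redF o mA).
have c0 M : 0 <= cone_fun (redF o A) M by apply: cone_fun_ge0 => h; exact: redF_ge0.
(* A vanishing first column makes the determinant vanish, so both integrands are 0. *)
have [v0|v0] := eqVneq (nsq4 v) 0%R.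
  rewrite !integral0_eq// => w _; first by rewrite /g /= v0 eqxx.
  have n0 (z : R[i]) : nsq z = 0%R -> z = 0%R by move/eqP; rewrite nsq_eq0 => /eqP.
  move/eqP: v0; rewrite paddr_eq0 ?nsq_ge0// => /andP[/eqP/n0 v1 /eqP/n0 v2].
  by rewrite /cone_fun /cone /detp /= v1 v2 mul0r mulr0 subrr eqxx.
have [_ /(_ (fun w => cone_fun (redF o A) (v, w)))] := scales_kmap v0.
rewrite mul1e => <- //; last exact: (measurable_fun_pair2 v mc).
apply: eq_integral => p _; rewrite /cone_fun /cone detp_kmap// /g /= v0 /= /cdisc.
have [d0|//] := boolP (p2c p.2 != 0)%R.
case: ifP => _ //=; have [E1 E2] := red_normalize o v0 d0.
by rewrite /redF E1 E2.
Qed.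

Let B (z : R * R) : set R := [set t | wset o t (p2c z) && `[< A t >]].

Let mB z : measurable (B z).
Proof.
apply: measurable_set_bool; apply: measurable_and; last exact: measurable_asbool_set.
by apply: measurable_wset => //; exact: mcplx_cst.
Qed.

Let outer p : \int[leb4]_v g (v, p) = (ddens p.2)%:E * den_set (B p.1).
Proof.
rewrite /ddens; have [c1|c1] := boolP (cdisc p.2); last first.
  rewrite mul0r mul0e integral0_eq// => v _; by rewrite /g /= (negbTE c1) andbF.
have /andP[d0 _] := c1.
set D := Num.sqrt (nsq (p2c p.2)).
have D0 : (0 < D)%R by rewrite sqrtr_gt0 lt_neqAle nsq_ge0 eq_sym nsq_eq0 d0.
pose a := (Num.sqrt D)^-1%R.
have a0 : (0 < a)%R by rewrite invr_gt0 sqrtr_gt0.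
have aD : (a ^+ 2 = D^-1)%R by rewrite exprVn sqr_sqrtr// ltW.
rewrite -(rad_den (mB p.1)) /rad_set.
have mr := measurable_radial (mB p.1); set S := [set _ | _] in mr *.
have [_ /(_ (fun v => (\1_S v : R)%:E))] := scales_leb4_dilate a0.
rewrite (@integral_indic _ _ _ (@leb4 R) _ measurableT _ mr) setIT mul1r.
have -> : (a ^- 4 = nsq (p2c p.2))%R.
  by rewrite -[4%N]/(2 * 2)%N exprM aD exprVn invrK sqr_sqrtr// nsq_ge0.
move=> <-; last 2 first.
- by apply/measurable_EFinP; exact: measurable_indic.
- by move=> x; rewrite lee_fin.
apply: eq_integral => v _; rewrite /g /= c1 andbT -/D indicE.
have E : nsq4 ((a * v.1.1, a * v.1.2), (a * v.2.1, a * v.2.2))%R = (nsq4 v / D)%R.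
  by rewrite -aD /nsq4 /nsq /=; ring.
have Er : rg v p = Num.sqrt (nsq4 v / D) by [].
congr (_%:R%:E); congr nat_of_bool; apply/idP/idP; rewrite !inE /S /= E Er.
  move=> /andP[v0 H]; split => //; by rewrite mulf_neq0// invr_neq0// gt_eqF.
by rewrite mulf_eq0 negb_or => -[/andP[-> _] ->].
Qed.

(** For fixed [v] the second column is parametrised by (z, d); for fixed (z, d) the integral over
    [v] is radial; for fixed length [t] the area of the admissible [z] remains. The variable [d]
    separates into the constant [cdet]. *)
Lemma haar_redF : haar (redF o A) =
  cdet * \int[leb1]_t ((`[< A t >]%:R * rdens t)%:E * wmeas o t).
Proof.
have mc := measurable_cone_fun (measurable_redF o mA).
have c0 M : 0 <= cone_fun (redF o A) M by apply: cone_fun_ge0 => h; exact: redF_ge0.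
rewrite /haar [LHS]prodm_tonelli1//.
under eq_integral do rewrite inner.
rewrite -(prodm_tonelli1 leb4 leb4 mg g0) (prodm_tonelli2 leb4 leb4 mg g0).
under eq_integral do rewrite outer.
have mwt : measurable_fun setT (fun x : (R * R) * R => wset o x.2 (p2c x.1)).
  by apply: measurable_wset => //; apply: mcplx_p2c; exact: measurable_fst.
pose k (x : (R * R) * R) : \bar R := ((wset o x.2 (p2c x.1) && `[< A x.2 >])%:R * rdens x.2)%:E.
have mk : measurable_fun setT k.
  apply/measurable_EFinP; apply: measurable_funM; last exact: (measurableT_comp measurable_rdens measurable_snd).
  apply/measurable_EFinP; apply: measurable_ifE; apply: measurable_and => //.
  exact: (measurableT_comp (measurable_asbool_set mA) measurable_snd).
have k0 x : 0 <= k x by rewrite lee_fin mulr_ge0// rdens_ge0.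
have denE z : den_set (B z) = \int[leb1]_t k (z, t).
  rewrite /den_set integral_mkcond; apply: eq_integral => t _.
  rewrite patchE /k /=; have -> : (t \in B z) = wset o t (p2c z) && `[< A t >].
    by apply/idP/idP; rewrite inE.
  by case: ifP => _; rewrite ?mul1r ?mul0r.
have md : measurable_fun setT (fun z => den_set (B z)).
  have -> : (fun z => den_set (B z)) = (fun z => \int[leb1]_t k (z, t)).
    by apply/funext => z; exact: denE.
  exact: (measurable_int1 leb1 mk k0).
have d0 z : 0 <= den_set (B z) by exact: den_set_ge0.
have mdd : measurable_fun setT (fun d => (ddens d)%:E) by apply/measurable_EFinP; exact: measurable_ddens.
rewrite [LHS]prodm_tonelli1/=; first last.
- by move=> x; rewrite mule_ge0// lee_fin ddens_ge0.
- apply: emeasurable_funM; first exact: (measurableT_comp mdd measurable_snd).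
  exact: (measurableT_comp md measurable_fst).
have cd0 : 0 <= cdet by exact/ltW/cdet_gt0.
transitivity (\int[leb2]_z (cdet * den_set (B z))).
  apply: eq_integral => z _; rewrite ge0_integralZr// => d _; by rewrite lee_fin ddens_ge0.
rewrite ge0_integralZl//; congr (_ * _).
under eq_integral do rewrite denE.
rewrite -(prodm_tonelli1 leb2 leb1 mk k0) (prodm_tonelli2 leb2 leb1 mk k0).
apply: eq_integral => t _; rewrite /wmeas -ge0_integralZl//; first last.
- by rewrite lee_fin mulr_ge0// rdens_ge0.
- by apply: measurable_ifE; exact: (measurable_fun_pair1 t mwt).
apply: eq_integral => z _; rewrite /k /= -EFinM; congr EFin.
by case: (wset _ _ _); case: (asbool _); rewrite /= ?mul1r ?mul0r ?mulr0 ?mulr1.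
Qed.

End HaarOfReduced.
End HaarRed.

(** * The area of the part of the cell outside a disc *)

Section Slices.
Context {R : realType}.
Local Open Scope ereal_scope.
Notation s3 := (Num.sqrt 3 : R).

Lemma int_even (g : R -> \bar R) : measurable_fun setT g -> (forall x, 0 <= g x) ->
  \int[leb1]_x g `|x|%R = 2%:E * \int[leb1]_(x in `[0%R, +oo[) g x.
Proof.
move=> mg g0.
have mgn : measurable_fun setT (fun x : R => g `|x|%R).
  exact: (measurableT_comp mg (@normr_measurable R setT)).
have -> : [set: R] = `]-oo, 0%R[ `|` `[0%R, +oo[.
  by apply/seteqP; split => x //= _; rewrite !in_itv /= andbT; case: ltP; [left|right].
rewrite ge0_integral_setU//=; last 2 first.
- exact: measurable_funS mgn.
- apply/disj_setPS => x [] /=; rewrite !in_itv /= andbT => a b.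
  by move: (lt_le_trans a b); rewrite ltxx.
have E1 : \int[leb1]_(x in `[0%R, +oo[) g `|x|%R = \int[leb1]_(x in `[0%R, +oo[) g x.
  by apply: eq_integral => x; rewrite inE /= in_itv /= andbT => x0; rewrite ger0_norm.
rewrite E1.
have [_ /(_ (fun x => if (0 <= x)%R then g x else 0))] := scales_mul (ltr0_neq0 (ltrN10 R)).
rewrite normrN1 invr1 mul1e => H.
suff -> : \int[leb1]_(x in `]-oo, 0%R[) g `|x|%R = \int[leb1]_(x in `[0%R, +oo[) g x.
  have -> : (2%:E = 1 + 1 :> \bar R) by rewrite -EFinD; congr EFin; lra.
  by rewrite ge0_muleDl// mul1e.
have -> : \int[leb1]_(x in `[0%R, +oo[) g x = \int[leb1]_x (if (0 <= x)%R then g x else 0).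
  by rewrite integral_mkcond; apply: eq_integral => x _; rewrite patchE mem_setE in_itv /= andbT.
rewrite -H; first last.
- by move=> x; case: ifP.
- by apply: measurable_fun_ifT => //; exact: measurable_fun_ler.
have -> : \int[leb1]_(x in `]-oo, 0%R[) g `|x|%R = \int[leb1]_(x in `]-oo, 0%R]) g `|x|%R.
  rewrite (leb1E (D := `]-oo, 0%R[))// ?(leb1E (D := `]-oo, 0%R]))//; last 2 first.
  - exact: measurable_funS mgn.
  - exact: measurable_funS mgn.
  by rewrite integral_itv_bndo_bndc//; exact: measurable_funS mgn.
rewrite integral_mkcond; apply: eq_integral => x _; rewrite patchE mem_setE in_itv /=.
rewrite mulN1r oppr_ge0; case: ifP => // x0; by rewrite ler0_norm.
Qed.

Definition kcond o (t x q : R) : bool :=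
  [&& lto o 1 (x ^+ 2 * (1 + q ^+ 2) + t ^- 4)%R, lto o (2 * `|x|)%R 1%R & lto o (s3 * `|q|)%R 1%R].

Lemma measurable_kcond d (T : measurableType d) o (t x q : T -> R) :
  measurable_fun setT t -> measurable_fun setT x -> measurable_fun setT q ->
  measurable_fun setT (fun u => kcond o (t u) (x u) (q u)).
Proof.
move=> mt mx mq; have nx := measurable_normr_comp mx; have nq := measurable_normr_comp mq.
apply: measurable_and; last apply: measurable_and; apply: measurable_lto => //;
  try exact: measurable_funM.
apply: measurable_funD; last by apply: (measurableT_comp measurable_invr); exact: measurable_funX.
apply: measurable_funM; first exact: measurable_funX.
by apply: measurable_funD => //; exact: measurable_funX.
Qed.

(** The substitution y = x q has Jacobian |x| and turns the sector condition into a bound on [q]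
    alone. *)
Lemma wset_slice o t (x : R) : \int[leb1]_y (wset o t (p2c (x, y)))%:R%:E =
  \int[leb1]_q (`|x| * (kcond o t x q)%:R)%:E.
Proof.
have mw : measurable_fun setT (fun y : R => wset o t (p2c (x, y))).
  by apply: measurable_wset => //; apply: mcplx_p2c; exact: measurable_fun_pair.
(* For x = 0 the slice contains at most the point y = 0, a null set. *)
have [x0|x0] := eqVneq x 0%R.
  rewrite x0 in mw *; rewrite normr0 [RHS]integral0_eq; last by move=> q _; rewrite mul0r.
  have := @integral_set1 _ (fun y : R => (wset o t (p2c (0%R, y)))%:R%:E) 0%R.
  rewrite -leb1E//; last exact: (measurable_funS measurableT _ (measurable_ifE mw)).
  rewrite integral_mkcond => H; rewrite -[RHS]H; apply: eq_integral => y _.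
  rewrite patchE; have [//|/negP y0] := boolP (y \in _).
  have {}y0 : y != 0%R by apply/eqP => yE; apply: y0; rewrite inE.
  have sy : (0 < s3 * `|y|)%R by rewrite mulr_gt0 ?s3_gt0 ?normr_gt0.
  rewrite /wset /bowb /bowtie /bowtie_oo /=; case: o {mw H} => /=;
    by rewrite normr0 ?(lt_gtF sy) ?(lt_geF sy) !andbF.
have [_ /(_ (fun y => (wset o t (p2c (x, y)))%:R%:E))] := scales_mul x0.
move=> H; have nx : (0 < `|x|)%R by rewrite normr_gt0.
transitivity (`|x|%:E * \int[leb1]_q (wset o t (p2c (x, x * q)%R))%:R%:E).
  rewrite H//; last exact: measurable_ifE.
  by rewrite muleA -EFinM mulfV ?mul1e// normr_eq0.
rewrite -ge0_integralZl//; last first.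
  by apply: measurable_ifE; apply: measurable_wset => //; apply: mcplx_p2c; apply: measurable_fun_pair => //; exact: measurable_funM.
apply: eq_integral => q _; rewrite -EFinM /kcond /wset.
have -> : nsq (p2c (x, (x * q)%R)) = (x ^+ 2 * (1 + q ^+ 2))%R by rewrite /nsq /=; ring.
congr (_ * _%:R)%:E; congr nat_of_bool; congr andb.
have E : (s3 * `|x * q| = `|x| * (s3 * `|q|))%R by rewrite normrM; ring.
rewrite /bowb /bowtie /bowtie_oo /lto /= E; case: o {mw H} => /=; congr andb.
  by rewrite -[X in (_ < X)%R]mulr1 ltr_pM2l.
by rewrite -[X in (_ <= X)%R]mulr1 ler_pM2l.
Qed.

(* With [y = x q], the area of the slice of [wset] in the direction [q] is the
   integral of [|x|] over [r / (1 + q^2) <= x^2 <= 1 / 4]. *)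
Definition Jr (r q : R) : R := Num.max (4^-1 - Num.max r 0%R / (1 + q ^+ 2))%R 0%R.

Lemma q1_gt0 (q : R) : (0 < 1 + q ^+ 2)%R.
Proof. by rewrite ltr_pwDl ?sqr_ge0. Qed.

Lemma kcond_slice o t q : \int[leb1]_x (`|x| * (kcond o t x q)%:R)%:E =
  ((lto o (s3 * `|q|)%R 1%R)%:R * Jr (1 - t ^- 4) q)%:E.
Proof.
have [c1|c1] := boolP (lto o (s3 * `|q|)%R 1%R); last first.
  by rewrite mul0r integral0_eq// => x _; rewrite /kcond (negbTE c1) !andbF mulr0.
rewrite mul1r; set r := (1 - t ^- 4)%R.
pose g (x : R) : \bar R := (Num.max x 0 * (kcond o t x q)%:R)%:E.
have mg : measurable_fun setT g.
  apply/measurable_EFinP; apply: measurable_funM; first exact: measurable_maxr.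
  by apply/measurable_EFinP; apply: measurable_ifE; exact: measurable_kcond.
have g0 x : 0 <= g x by rewrite lee_fin mulr_ge0// le_max lexx orbT.
transitivity (\int[leb1]_x g `|x|%R).
  apply: eq_integral => x _; rewrite /g max_l//; congr (_ * _%:R)%:E.
  by rewrite /kcond normr_id real_normK// num_real.
rewrite int_even//.
set x0 : R := Num.sqrt (Num.max r 0 / (1 + q ^+ 2))%R.
have x00 : (0 <= x0)%R by exact: sqrtr_ge0.
have m0 : (0 <= Num.max r 0)%R by rewrite le_max lexx orbT.
have q0 := q1_gt0 q.
have x0E : (x0 ^+ 2 = Num.max r 0 / (1 + q ^+ 2))%R by rewrite sqr_sqrtr// divr_ge0// ltW.
(* The ends are open for [o = true] and closed otherwise, so that membership matches [kcond]
   exactly. *)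
transitivity (2%:E * \int[leb1]_(x in [set` Interval (BSide (~~ o) x0) (BSide o 2^-1%R)]) (Num.max x 0)%R%:E).
  congr (_ * _); rewrite [LHS]integral_mkcond [RHS]integral_mkcond; apply: eq_integral => x _.
  rewrite !patchE !mem_setE /g.
  have [xneg|xpos] := ltP x 0%R.
    by rewrite mul0r; do 2 case: ifP => _.
  have [->|xn0] := eqVneq x 0%R; first by rewrite mul0r; do 2 case: ifP => _.
  have {xn0}xgt : (0 < x)%R by rewrite lt_neqAle eq_sym xn0.
  rewrite {1}in_itv /= xpos /=.
  have -> : x \in Interval (BSide (~~ o) x0) (BSide o 2^-1%R) = kcond o t x q.
    rewrite /kcond c1 andbT ger0_norm// itv_boundlr.
    have x2 : (r < x ^+ 2 * (1 + q ^+ 2))%R = (Num.max r 0 < x ^+ 2 * (1 + q ^+ 2))%R.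
      by rewrite gt_max mulr_gt0 ?exprn_gt0// andbT.
    have x3 : (r <= x ^+ 2 * (1 + q ^+ 2))%R = (Num.max r 0 <= x ^+ 2 * (1 + q ^+ 2))%R.
      by rewrite ge_max mulr_ge0 ?exprn_ge0 ?(ltW q0)// andbT.
    case: (o) => /=; rewrite !bnd_simp; congr andb.
    + rewrite -[RHS]ltrBlDr -/r x2 -ltr_pdivrMr// -x0E.
      by rewrite ltr_pXn2r// nnegrE.
    + by apply/idP/idP; lra.
    + rewrite -[RHS]lerBlDr -/r x3 -ler_pdivrMr// -x0E.
      by rewrite ler_pXn2r// nnegrE.
    + by apply/idP/idP; lra.
  by case: ifP => _; rewrite ?mulr1 ?mulr0.
rewrite leb1_itv_bnd; first last.
- by move=> x _; rewrite lee_fin le_max lexx orbT.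
- by apply/measurable_EFinP; exact: measurable_maxr.
rewrite /Jr -x0E.
have [x2|x2] := leP x0 (2^-1)%R; last first.
  rewrite set_itv_ge ?integral_set0 ?mule0; last by rewrite bnd_simp -ltNge.
  by rewrite max_r//; nra.
rewrite max_l; last by nra.
transitivity (2%:E * (2^-1 * 2^-1 ^+ 2 - 2^-1 * x0 ^+ 2)%R%:E); last first.
  by rewrite -EFinM; congr EFin; field.
congr (_ * _); transitivity (\int[@lebesgue_measure R]_(x in `[x0, 2^-1%R]) x%:E).
  apply: eq_integral => x; rewrite inE /= in_itv /= => /andP[a b]; rewrite max_l//; lra.
apply: (@ftc_lebesgue _ (fun x => 2^-1 * x ^+ 2)%R (fun x => x) _ _ x2).
  move=> x _; apply: is_derive_eq; rewrite /GRing.scale /=; by field.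
by apply: continuous_subspaceT => x; exact: cvg_id.
Qed.

Lemma measurable_norm_kcond o t : measurable_fun setT (fun z : R * R => (`|z.1| * (kcond o t z.1 z.2)%:R)%:E).
Proof.
apply/measurable_EFinP; apply: measurable_funM.
  by apply: measurable_normr_comp; exact: measurable_fst.
by apply/measurable_EFinP; apply: measurable_ifE; apply: measurable_kcond.
Qed.

Lemma wmeas_kcond o t : wmeas o t = \int[leb1]_q \int[leb1]_x (`|x| * (kcond o t x q)%:R)%:E.
Proof.
rewrite /wmeas [LHS]prodm_tonelli1//; last first.
  by apply: measurable_ifE; apply: measurable_wset => //; exact: mcplx_p2cT.
under eq_integral do rewrite wset_slice.
have k0 (z : R * R) : 0 <= (`|z.1| * (kcond o t z.1 z.2)%:R)%:E by rewrite lee_fin mulr_ge0.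
exact: etrans (esym (prodm_tonelli1 leb1 leb1 (measurable_norm_kcond o t) k0)) (prodm_tonelli2 leb1 leb1 (measurable_norm_kcond o t) k0).
Qed.

Lemma measurable_Jr r : measurable_fun setT (Jr r).
Proof.
apply: measurable_maxr => //; apply: measurable_funB => //; apply: measurable_funM => //.
apply: (measurableT_comp measurable_invr); exact: measurable_funD.
Qed.

Lemma Jr_ge0 r q : (0 <= Jr r q)%R.
Proof. by rewrite /Jr le_max lexx orbT. Qed.

(** The flag [o] disappears because the intervals differ only at their ends. Hence strictly and
    weakly reduced bases have the same Haar measure. *)
Lemma wmeasE o t : wmeas o t =
  2%:E * \int[@lebesgue_measure R]_(q in `[0%R, s3^-1%R]) (Jr (1 - t ^- 4) q)%:E.
Proof.
rewrite wmeas_kcond; under eq_integral do rewrite kcond_slice.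
pose g (q : R) : \bar R := ((lto o (s3 * q)%R 1%R)%:R * Jr (1 - t ^- 4) q)%:E.
have mg : measurable_fun setT g.
  apply/measurable_EFinP; apply: measurable_funM; last exact: measurable_Jr.
  apply/measurable_EFinP; apply: measurable_ifE; exact: measurable_lto.
transitivity (\int[leb1]_q g `|q|%R).
  by apply: eq_integral => q _; rewrite /g /Jr real_normK// num_real.
rewrite int_even//; last by move=> x; rewrite lee_fin mulr_ge0// Jr_ge0.
congr (_ * _); rewrite -(@leb1_itv_bnd _ true o); first last.
- by move=> x _; rewrite lee_fin Jr_ge0.
- by apply/measurable_EFinP; exact: measurable_Jr.
rewrite [LHS]integral_mkcond [RHS]integral_mkcond; apply: eq_integral => q _.
rewrite !patchE !mem_setE /g; have [q0|q0] := ltP q 0%R.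
  by rewrite !in_itv /= leNgt q0.
rewrite in_itv /= q0 /= itv_boundlr bnd_simp q0 /=.
have S0 := s3_gt0 (R := R).
have -> : (BRight q <= BSide o s3^-1%R)%O = lto o (s3 * q)%R 1%R.
  by case: (o); rewrite bnd_simp /= -[in LHS](mulr1 s3^-1%R) ?ltr_pdivlMl ?ler_pdivlMl.
by case: ifP => _; rewrite ?mul1r ?mul0r.
Qed.

End Slices.

Section ClosedForm.
Context {R : realType}.
Local Open Scope ereal_scope.
Notation s3 := (Num.sqrt 3 : R).

Lemma pi6_lt : (0 < (pi : R) / 6 < pi / 2)%R.
Proof. by have := pi_gt0 R => p; apply/andP; split; lra. Qed.

(** The cosine of three times pi / 6 vanishes, and the triple angle formula leaves 4 c^2 = 3 because
    c > 0. *)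
Lemma cos_pi6 : cos (pi / 6) = (s3 / 2)%R :> R.
Proof.
have /andP[p1 p2] := pi6_lt.
have c0 : (0 < cos (pi / 6 : R))%R by apply: cos_gt0_pihalf; apply/andP; split; lra.
have := @cos_pihalf R; have -> : (pi / 2 = pi / 6 + (pi / 6) *+ 2 :> R)%R by rewrite mulr2n; field.
rewrite cosD sin_mulr2n cos_mulr2n => H.
have c2 : (cos (pi / 6 : R) ^+ 2 = 3 / 4)%R.
  have := cos2Dsin2 (pi / 6 : R); move: H c0; set c := cos _; set s := sin _ => H c0 E.
  have : (c * (4 * c ^+ 2 - 3) = 0)%R.
    transitivity (c * (c ^+ 2 *+ 2 - 1) - (1 - c ^+ 2) * c *+ 2)%R; first by ring.
    have -> : (1 - c ^+ 2 = s ^+ 2)%R by rewrite -E; ring.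
    by rewrite -[RHS]H; ring.
  by move/eqP; rewrite mulf_eq0 (gt_eqF c0) /= => /eqP; lra.
apply/eqP; rewrite -(eqrXn2 (n := 2))//; first by apply/eqP; rewrite c2 exprMn expr2 s3_sq; field.
exact: ltW.
Qed.

Lemma sin_pi6 : sin (pi / 6) = 2^-1%R :> R.
Proof.
have /andP[p1 p2] := pi6_lt.
apply/eqP; rewrite -(eqrXn2 (n := 2))//; last first.
- by apply: sin_ge0_pi; have := pi_gt0 R => p; apply/andP; split; lra.
- by apply/eqP; rewrite sin2cos2 cos_pi6 exprMn expr2 s3_sq; field.
Qed.

Lemma s3_neq0 : s3 != 0%R. Proof. exact/lt0r_neq0/s3_gt0. Qed.

Lemma atan_s3V : atan s3^-1%R = (pi / 6)%R :> R.
Proof.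
have /andP[p1 p2] := pi6_lt; have S0 := s3_neq0.
rewrite -[RHS]tanK; last by rewrite in_itv /=; apply/andP; split; lra.
by congr atan; rewrite /tan sin_pi6 cos_pi6; field.
Qed.

Definition Fr (r q : R) : R := (q / 4 - r * atan q)%R.

(** The point where 1/4 - r / (1 + q^2) changes sign. For 4 r < 1 the square root of a negative
    number is 0, and the integration starts at 0. *)
Definition qr (r : R) : R := Num.sqrt (4 * r - 1)%R.

(** Half the area of the bowtie outside the disc of squared radius [r]. The condition fails for r >
    1/3, when the disc contains the whole cell, of circumradius 1 / sqrt 3. *)
Definition Wr (r : R) : R :=
  if (qr r <= s3^-1)%R then (Fr (Num.max r 0) s3^-1 - Fr (Num.max r 0) (qr r))%R else 0%R.

Lemma int_Jr r : \int[@lebesgue_measure R]_(q in `[0%R, s3^-1%R]) (Jr r q)%:E = (Wr r)%:E.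
Proof.
have S0 : (0 <= s3^-1)%R by rewrite invr_ge0 sqrtr_ge0.
have Q0 : (0 <= qr r)%R by exact: sqrtr_ge0.
set m := Num.max r 0%R.
have Jq q : (qr r <= q)%R -> Jr r q = (4^-1 - m / (1 + q ^+ 2))%R.
  move=> qq; rewrite /Jr max_l// subr_ge0 ler_pdivrMr ?q1_gt0//.
  rewrite /m; case: (leP r 0%R) => _; first by have := sqr_ge0 q; lra.
  have q2 : (qr r ^+ 2 <= q ^+ 2)%R by rewrite ler_pXn2r// nnegrE// (le_trans Q0).
  have [r4|r4] := leP 1%R (4 * r)%R; last by have := sqr_ge0 q; lra.
  have : (qr r ^+ 2 = 4 * r - 1)%R by rewrite sqr_sqrtr// subr_ge0.
  lra.
have J0 q : (0 <= q)%R -> (q < qr r)%R -> Jr r q = 0%R.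
  move=> q0 qq; have [r4|r4] := leP 1%R (4 * r)%R; last first.
    have E : qr r = 0%R by rewrite /qr ler0_sqrtr//; lra.
    by move: qq; rewrite E ltNge q0.
  rewrite /Jr max_r// subr_le0 ler_pdivlMr ?q1_gt0// max_l; last lra.
  have q2 : (q ^+ 2 <= qr r ^+ 2)%R by rewrite ler_pXn2r// ?nnegrE// ltW.
  have : (qr r ^+ 2 = 4 * r - 1)%R by rewrite sqr_sqrtr// subr_ge0.
  lra.
rewrite /Wr -/m; case: leP => qs.
  transitivity (\int[@lebesgue_measure R]_(q in `[qr r, s3^-1%R]) (4^-1 - m / (1 + q ^+ 2))%:E).
    rewrite [LHS]integral_mkcond [RHS]integral_mkcond; apply: eq_integral => q _.
    rewrite !patchE !mem_setE !in_itv /=; have [q0|q0] := leP (qr r) q.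
      by rewrite (le_trans Q0 q0) /= Jq.
    by case: ifP => // /andP[q0' _]; rewrite J0.
  apply: (@ftc_lebesgue _ (Fr m) _ _ _ qs).
    move=> q _; apply: is_derive_eq; rewrite /GRing.scale /=; field.
    by apply: lt0r_neq0; exact: q1_gt0.
  apply: continuous_subspaceT => q; apply: cvgB; first exact: cvg_cst.
  apply: cvgM; first exact: cvg_cst.
  apply: cvgV; first by apply: lt0r_neq0; exact: q1_gt0.
  by apply: cvgD; [exact: cvg_cst|exact: exprn_continuous].
apply: integral0_eq => q; rewrite /= in_itv /= => /andP[q0 q1].
by rewrite J0//; exact: le_lt_trans qs.
Qed.

Lemma qr_le0 r : (4 * r <= 1)%R -> qr r = 0%R.
Proof. by move=> H; rewrite /qr ler0_sqrtr//; lra. Qed.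

Lemma s3V_gt0 : (0 < s3^-1)%R. Proof. by rewrite invr_gt0 s3_gt0. Qed.

Lemma s3_s3V : (s3^-1 = s3 / 3)%R.
Proof. by rewrite -[X in (_ / X)%R]s3_sq; field; exact: s3_neq0. Qed.

Lemma Fr0 r : Fr r 0 = 0%R.
Proof. by rewrite /Fr mul0r atan0 mulr0 subr0. Qed.

(** The factor 6 stands for the full hexagon, three bowties of area [2 * Wr r]; here no disc is
    removed from its area sqrt 3 / 2. *)
Lemma Wr_neg r : (r <= 0)%R -> (6 * Wr r = s3 / 2)%R.
Proof.
move=> r0; rewrite /Wr qr_le0; last lra.
by rewrite (ltW s3V_gt0) max_r// Fr0 /Fr atan_s3V s3_s3V; field.
Qed.

(** Up to the squared inradius 1/4 the disc lies inside the hexagon and its whole area is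
    removed. *)
Lemma Wr_mid r : (0 <= r)%R -> (4 * r <= 1)%R -> (6 * Wr r = s3 / 2 - pi * r)%R.
Proof.
move=> r0 r4; rewrite /Wr qr_le0// (ltW s3V_gt0) max_l// Fr0 /Fr atan_s3V s3_s3V; by field.
Qed.

Lemma qr_le_s3V r : (1 <= 4 * r)%R -> (qr r <= s3^-1)%R = (3 * r <= 1)%R.
Proof.
move=> r4; rewrite -[LHS](@ler_pXn2r _ 2)// ?nnegrE ?sqrtr_ge0 ?invr_ge0 ?sqrtr_ge0//.
rewrite /qr sqr_sqrtr; last by lra.
by rewrite exprVn [X in (_ <= X^-1)%R]expr2 s3_sq; apply/idP/idP; lra.
Qed.

Lemma Wr_hi r : (1 <= 4 * r)%R -> (3 * r <= 1)%R ->
  (6 * Wr r = s3 / 2 - pi * r + 6 * r * atan (qr r) - 3 / 2 * qr r)%R.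
Proof.
move=> r4 r3; rewrite /Wr qr_le_s3V// r3 max_l; last lra.
by rewrite /Fr atan_s3V s3_s3V; field.
Qed.

Lemma Wr_out r : (1 < 3 * r)%R -> Wr r = 0%R.
Proof. by move=> r3; rewrite /Wr qr_le_s3V; [case: ifP => //; lra|lra]. Qed.

Lemma wmeas_Wr o (t : R) : wmeas o t = (2 * Wr (1 - t ^- 4))%:E.
Proof. by rewrite wmeasE int_Jr EFinM. Qed.

Lemma Wr_ge0 r : (0 <= Wr r)%R.
Proof. by rewrite -lee_fin -int_Jr; apply: integral_ge0 => q _; rewrite lee_fin Jr_ge0. Qed.

End ClosedForm.

Lemma is_derive_lnc (R : realType) (g : R -> R) (x b : R) : is_derive x 1 g b ->
  0 < g x -> is_derive x 1 (fun y => ln (g y)) (b / g x).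
Proof.
move=> dg g0; have dl := is_derive1_ln g0.
have := @is_derive1_comp _ _ g x _ _ dl dg.
by rewrite mulrC.
Qed.

(** * The total mass as an integral in one variable *)

Section Total.
Context {R : realType}.
Local Open Scope ereal_scope.
Notation s3 := (Num.sqrt 3 : R).

Definition mass (A : set R) : \bar R :=
  \int[leb1]_t (`[< A t >]%:R * (rdens t * (2 * Wr (1 - t ^- 4))))%:E.

Lemma mass_redF o (A : set R) : measurable A -> haar (redF o A) = cdet * mass A.
Proof.
move=> mA; rewrite haar_redF//; congr (_ * _); apply: eq_integral => t _.
by rewrite wmeas_Wr -EFinM mulrA.
Qed.

(** What remains in [q] after integrating |x| / (1 - x^2 (1 + q^2)) over |x| < 1/2; the denominator
    comes from the integration in [t]. *)
Definition bfun (q : R) : R := (ln (4 / (3 - q ^+ 2)) / (1 + q ^+ 2))%R.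

Lemma sqr_s3_lt q : (s3 * `|q| < 1)%R -> (0 <= q ^+ 2 < 3^-1)%R.
Proof.
move=> q1; rewrite -real_normK ?num_real// sqr_ge0 /=.
have : ((s3 * `|q|) ^+ 2 < 1 ^+ 2)%R.
  by rewrite ltr_pXn2r ?nnegrE// mulr_ge0// sqrtr_ge0.
by rewrite exprMn [X in (X * _ < _)%R]expr2 s3_sq expr1n; lra.
Qed.

Lemma slice_gt0 q x : (s3 * `|q| < 1)%R -> (2 * `|x| <= 1)%R ->
  (0 < 1 - x ^+ 2 * (1 + q ^+ 2))%R.
Proof.
move=> /sqr_s3_lt/andP[q0 q2] x1; have := normr_ge0 x => x0.
have : (0 <= x ^+ 2 <= 4^-1)%R by rewrite -real_normK ?num_real// sqr_ge0 /=; nra.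
by move=> /andP[? ?]; nra.
Qed.

Lemma rdens_slice x q : \int[leb1]_t (rdens t * (`|x| * (kcond true t x q)%:R))%:E =
  ((lto true (s3 * `|q|)%R 1%R)%:R * (cball * ((lto true (2 * `|x|)%R 1%R)%:R * (`|x| / (1 - x ^+ 2 * (1 + q ^+ 2))))))%:E.
Proof.
rewrite /kcond; have [q1|q1] := boolP (lto true (s3 * `|q|)%R 1%R); last first.
  by rewrite mul0r integral0_eq// => t _; rewrite !andbF !mulr0.
have [x1|x1] := boolP (lto true (2 * `|x|)%R 1%R); last first.
  by rewrite mul0r !mulr0 integral0_eq// => t _; rewrite !andbF !mulr0.
rewrite !mul1r; set s := (x ^+ 2 * (1 + q ^+ 2))%R.
have x2 : (0 <= x ^+ 2 < 4^-1)%R.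
  by rewrite -real_normK ?num_real// sqr_ge0 /=; move: x1 => /=; have := normr_ge0 x; nra.
have q2 := sqr_s3_lt q1.
have s1 : (0 <= s < 1)%R by move: x2 q2 => /andP[? ?] /andP[? ?]; apply/andP; split; rewrite /s; nra.
have [s0 {}s1] := andP s1.
pose b := Num.sqrt (Num.sqrt (1 - s)^-1).
have b0 : (0 < b)%R by rewrite !sqrtr_gt0 invr_gt0 subr_gt0.
have b4 : (b ^+ 4 = (1 - s)^-1)%R.
  by rewrite -[4%N]/(2 * 2)%N exprM !sqr_sqrtr ?sqrtr_ge0// invr_ge0; lra.
transitivity (`|x|%:E * den_set (`]-oo, b[%classic : set R)).
  rewrite /den_set -ge0_integralZl//; last 2 first.
  - by apply: measurable_funTS; apply/measurable_EFinP; exact: measurable_rdens.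
  - by move=> t _; rewrite lee_fin rdens_ge0.
  rewrite [RHS]integral_mkcond; apply: eq_integral => t _; rewrite patchE mem_setE in_itv /=.
  have [t0|t0] := leP t 0%R.
    have -> : rdens t = 0%R by rewrite /rdens max_r// expr0n mulr0.
    by rewrite !mul0r; case: ifP => _; rewrite ?mule0.
  have -> : (1 < s + t ^- 4)%R = (t < b)%R.
    rewrite -[RHS](@ltr_pXn2r _ 4)// ?nnegrE ?ltW// b4.
    rewrite -ltrBlDl -[RHS]ltf_pV2 ?posrE ?invr_gt0 ?exprn_gt0 ?subr_gt0//.
    by rewrite invrK.
  by case: ifP => _; rewrite ?mulr1 ?mulr0 ?mule0// -EFinM mulrC.
rewrite den_set_itv ball4_dilate// b4 cballE -!EFinM; congr EFin; ring.
Qed.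

Lemma x_slice (q : R) : (s3 * `|q| < 1)%R ->
  \int[leb1]_x ((lto true (2 * `|x|)%R 1%R)%:R * (`|x| / (1 - x ^+ 2 * (1 + q ^+ 2))))%:E = (bfun q)%:E.
Proof.
move=> q1.
have q2 := sqr_s3_lt q1.
have {q2}[q0 q2] := andP q2.
have D0 (x : R) : (0 <= x <= 2^-1)%R -> (0 < 1 - x ^+ 2 * (1 + q ^+ 2))%R.
  by move=> /andP[x0 x1]; apply: slice_gt0 => //; rewrite ger0_norm//; lra.
pose h (x : R) := Num.max (x / (1 - x ^+ 2 * (1 + q ^+ 2)))%R 0%R.
have mh : measurable_fun setT h.
  apply: measurable_maxr => //; apply: measurable_funM => //.
  apply: (measurableT_comp measurable_invr); apply: measurable_funB => //.
  exact: measurable_funM.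
pose g (x : R) : \bar R := ((lto true (2 * x)%R 1%R)%:R * h x)%:E.
have mg : measurable_fun setT g.
  apply/measurable_EFinP; apply: measurable_funM => //.
  apply/measurable_EFinP; apply: measurable_ifE; exact: measurable_fun_ltr.
have h0 x : (0 <= h x)%R by rewrite /h le_max lexx orbT.
transitivity (\int[leb1]_x g `|x|%R).
  apply: eq_integral => x _; rewrite /g /h real_normK ?num_real//.
  have [x1|_] := boolP (lto true (2 * `|x|)%R 1%R); last by rewrite !mul0r.
  rewrite max_l// divr_ge0// -real_normK ?num_real//; apply/ltW/D0; rewrite normr_ge0 /=.
  by move: x1 => /=; lra.
rewrite int_even//; last by move=> x; rewrite lee_fin mulr_ge0.
transitivity (2%:E * \int[leb1]_(x in [set` Interval (BSide true 0%R) (BSide true 2^-1%R)]) (h x)%:E).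
  congr (_ * _); rewrite [LHS]integral_mkcond [RHS]integral_mkcond; apply: eq_integral => x _.
  rewrite !patchE !mem_setE /g !in_itv /= andbT; have [x0|//] := leP 0%R x.
  have -> : (2 * x < 1)%R = (x < 2^-1)%R by apply/idP/idP; lra.
  by case: ltP => _; rewrite ?mul1r ?mul0r.
rewrite leb1_itv_bnd; first last.
- by move=> x _; rewrite lee_fin.
- by apply/measurable_EFinP.
have E0 : (1 + q ^+ 2 != 0)%R by apply: lt0r_neq0; exact: q1_gt0.
pose H x : R := (- (2 * (1 + q ^+ 2))^-1 * ln (1 - x ^+ 2 * (1 + q ^+ 2)))%R.
transitivity (2%:E * (H 2^-1 - H 0)%:E).
  congr (_ * _); transitivity (\int[@lebesgue_measure R]_(x in `[0%R, 2^-1%R]) (x / (1 - x ^+ 2 * (1 + q ^+ 2)))%:E).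
    apply: eq_integral => x; rewrite inE /= in_itv /= => x01.
    by rewrite /h max_l// divr_ge0 ?(andP x01).1// ltW// D0.
  apply: (@ftc_lebesgue _ H).
  - by [].
  - move=> x; rewrite in_itv /= => x01; have dx := D0 x x01.
    have di : is_derive x 1%R (fun y : R => 1 - y ^+ 2 * (1 + q ^+ 2))%R (- (2 * x * (1 + q ^+ 2)))%R.
      apply: is_derive_eq; rewrite /GRing.scale /=; ring.
    have dc := is_derive_lnc di dx.
    apply: (@is_derive_eq _ _ _ _ _ _ _ _ (is_deriveZ _ dc)).
    rewrite /GRing.scale /=; field.
    by rewrite E0 gt_eqF.
  apply: continuous_in_subspaceT => x; rewrite inE /= in_itv /= => x01.
  apply: cvgM; first exact: cvg_id.
  apply: cvgV; first by rewrite gt_eqF// D0.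
  apply: cvgB; first exact: cvg_cst.
  by apply: cvgM; [exact: exprn_continuous|exact: cvg_cst].
rewrite -EFinM; congr EFin; rewrite /H /bfun expr0n mul0r subr0 ln1 mulr0 subr0.
have -> : (1 - 2^-1 ^+ 2 * (1 + q ^+ 2) = (4 / (3 - q ^+ 2))^-1)%R.
  by field; apply: lt0r_neq0; lra.
rewrite lnV ?posrE; last by rewrite divr_gt0//; lra.
by field.
Qed.

(** Rather than the closed form with its arctangent, the triple integral is computed, in the order
    t, x, q; the first two integrations are elementary. *)
Lemma mass_total : mass setT = (2 * cball)%:E * \int[@lebesgue_measure R]_(q in `[0%R, s3^-1%R]) (bfun q)%:E.
Proof.
pose k (z : R * (R * R)) : \bar R := (rdens z.1 * (`|z.2.1| * (kcond true z.1 z.2.1 z.2.2)%:R))%:E.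
have m2 : measurable_fun setT (fun z : R * (R * R) => z.2.1) by exact: (measurableT_comp measurable_fst measurable_snd).
have m3 : measurable_fun setT (fun z : R * (R * R) => z.2.2) by exact: (measurableT_comp measurable_snd measurable_snd).
have mk : measurable_fun setT k.
  apply/measurable_EFinP; apply: measurable_funM; first exact: (measurableT_comp measurable_rdens measurable_fst).
  apply: measurable_funM; first exact: measurable_normr_comp.
  by apply/measurable_EFinP; apply: measurable_ifE; exact: measurable_kcond.
have k0 z : 0 <= k z by rewrite lee_fin mulr_ge0 ?rdens_ge0// mulr_ge0.
have E1 t : (`[< [set: R] t >]%:R * (rdens t * (2 * Wr (1 - t ^- 4))))%:E = \int[leb2]_z k (t, z).
  rewrite asboolT// mul1r EFinM -(wmeas_Wr true) wmeas_kcond.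
  rewrite (prodm_tonelli2 leb1 leb1 (measurable_fun_pair2 t mk))//.
  rewrite -ge0_integralZl ?lee_fin ?rdens_ge0//; last 2 first.
  - by apply: (measurable_int2 leb1 (measurable_norm_kcond true t)) => z; rewrite lee_fin mulr_ge0.
  - by move=> q _; apply: integral_ge0 => x _; rewrite lee_fin mulr_ge0.
  apply: eq_integral => q _; rewrite -ge0_integralZl ?lee_fin ?rdens_ge0//.
  - exact: (measurable_fun_pair1 q (measurable_norm_kcond true t)).
rewrite /mass; under eq_integral do rewrite E1.
rewrite -(prodm_tonelli1 leb1 leb2 mk k0) (prodm_tonelli2 leb1 leb2 mk k0).
pose w (z : R * R) : \bar R := \int[leb1]_t k (t, z).
have mw : measurable_fun setT w by exact: (measurable_int2 leb1 mk k0).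
have w0 z : 0 <= w z by exact: integral_ge0.
rewrite (prodm_tonelli2 leb1 leb1 mw w0) /w.
pose g (q : R) : \bar R := ((lto true (s3 * q)%R 1%R)%:R * Num.max (bfun q) 0)%R%:E.
have g0 q : 0 <= g q by rewrite lee_fin mulr_ge0// le_max lexx orbT.
have mb : measurable_fun setT bfun.
  apply: measurable_funM.
    apply: (measurableT_comp (@measurable_ln R)); apply: measurable_funM => //.
    by apply: (measurableT_comp measurable_invr); exact: measurable_funB.
  by apply: (measurableT_comp measurable_invr); exact: measurable_funD.
have mmb : measurable_fun setT (fun q => Num.max (bfun q) 0%R) by exact: measurable_maxr.
have mg : measurable_fun setT g.
  apply/measurable_EFinP; apply: measurable_funM => //.
  apply/measurable_EFinP; apply: measurable_ifE; exact: measurable_fun_ltr.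
have b0 (q : R) : (0 <= q)%R -> (s3 * q < 1)%R -> (0 <= bfun q)%R.
  move=> q0 q1.
  have q2 : (0 <= q ^+ 2 < 3^-1)%R by apply: sqr_s3_lt; rewrite ger0_norm.
  rewrite /bfun divr_ge0// ?(ltW (q1_gt0 q))// ln_ge0// ler_pdivlMr ?mul1r; lra.
transitivity (\int[leb1]_q (cball%:E * g `|q|%R)).
  apply: eq_integral => q _; rewrite /k /=.
  under eq_integral do rewrite rdens_slice.
  have [q1|q1] := boolP (lto true (s3 * `|q|)%R 1%R); last first.
    by rewrite /g (negbTE q1) mul0r mule0 integral0_eq// => x _; rewrite mul0r.
  have bE : bfun `|q|%R = bfun q by rewrite /bfun real_normK ?num_real.
  rewrite /g q1 mul1r max_l ?b0// bE -(x_slice q1) -ge0_integralZl//.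
  - by apply: eq_integral => x _; rewrite mul1r EFinM.
  - apply/measurable_EFinP; apply: measurable_funM.
      apply/measurable_EFinP; apply: measurable_ifE; apply: measurable_fun_ltr => //.
      by apply: measurable_funM => //; exact: normr_measurable.
    apply: measurable_funM; first exact: normr_measurable.
    apply: (measurableT_comp measurable_invr); apply: measurable_funB => //.
    exact: measurable_funM.
  - move=> x _; rewrite lee_fin; have [x1|_] := boolP (lto _ _ _); last by rewrite mul0r.
    by rewrite mul1r divr_ge0//; apply/ltW/slice_gt0 => //; exact: ltW.
  - by rewrite lee_fin ltW// cball_gt0.
rewrite ge0_integralZl//; last 2 first.
- exact: (measurableT_comp mg (@normr_measurable R setT)).
- by rewrite lee_fin ltW// cball_gt0.
rewrite int_even// EFinM muleCA muleA; congr (_ * _).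
transitivity (\int[leb1]_(x in [set` Interval (BSide true 0%R) (BSide true s3^-1%R)]) (Num.max (bfun x) 0%R)%:E).
  rewrite [LHS]integral_mkcond [RHS]integral_mkcond; apply: eq_integral => x _.
  rewrite !patchE !mem_setE /g !in_itv /= andbT; have [x0|//] := leP 0%R x.
  have -> : (s3 * x < 1)%R = (x < s3^-1)%R.
    by rewrite -[RHS](ltr_pM2l s3_gt0) mulfV// s3_neq0.
  by case: ltP => _; rewrite ?mul1r ?mul0r.
rewrite leb1_itv_bnd; first last.
- by move=> x _; rewrite lee_fin le_max lexx orbT.
- by apply/measurable_EFinP.
rewrite -[LHS](@integral_itv_bndo_bndc _ (BLeft 0%R)); last by apply: measurable_funTS; exact/measurable_EFinP.
rewrite -[RHS](@integral_itv_bndo_bndc _ (BLeft 0%R)); last by apply: measurable_funTS; exact/measurable_EFinP.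
apply: eq_integral => q; rewrite inE /= in_itv /= => /andP[q0 q1]; rewrite max_l// b0//.
by rewrite -[X in (_ < X)%R](mulfV s3_neq0) ltr_pM2l// s3_gt0.
Qed.

End Total.

(** * The Lobachevsky function and the dilogarithm *)

Section Lobachevsky.
Context {R : realType}.
Notation s3 := (Num.sqrt 3 : R).
Notation mu := (@lebesgue_measure R).
Implicit Types x y t : R.

Lemma eq_is_derive0 (f : R -> R) (a b x y : R) : (forall t, a < t < b -> is_derive t 1 f 0) ->
  a < x < b -> a < y < b -> f x = f y.
Proof.
move=> df; wlog xy : x y / x < y => [H|].
  have [xy|xy|->//] := ltgtP x y; first exact: H.
  by move=> h1 h2; rewrite (H y x).
move=> /andP[ax xb] /andP[ay yb].
have [t|t|c _] := @MVT R f (fun=> 0) x y xy _ _.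
- by rewrite in_itv /= => /andP[xt ty]; apply: df; rewrite (lt_trans ax)//= (lt_trans ty).
- apply: derivable_within_continuous => {}t; rewrite in_itv /= => /andP[xt ty].
  by have H : is_derive t 1 f 0; [apply: df; rewrite (lt_le_trans ax)//= (le_lt_trans ty)|exact: ex_derive].
- by rewrite mul0r => /eqP; rewrite subr_eq0 => /eqP.
Qed.

Lemma sin_ge_half t : pi / 6 <= t <= 5 * (pi / 6) -> 2^-1 <= sin t.
Proof.
have p0 := pi_gt0 R.
have H u : pi / 6 <= u <= pi / 2 -> 2^-1 <= sin u.
  move=> /andP[u1 u2]; rewrite -sin_pi6 leNgt ltr_sin ?in_itv/= -?leNgt//; apply/andP; split; lra.
move=> /andP[t1 t2]; have [t3|t3] := leP t (pi / 2); first by apply: H; rewrite t1 t3.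
have -> : sin t = sin (pi - t) by rewrite sinB sinpi cospi; ring.
by apply: H; apply/andP; split; lra.
Qed.

Lemma cos_ge_half t : 0 <= t <= pi / 6 -> 2^-1 <= cos t.
Proof.
have p0 := pi_gt0 R; move=> /andP[t1 t2].
have E : cos t = sin (pi / 2 - t) by rewrite sinB sin_pihalf cos_pihalf; ring.
by rewrite E; apply: sin_ge_half; apply/andP; split; lra.
Qed.

Lemma sin_ge_lin t : 0 <= t <= pi / 6 -> t / 2 <= sin t.
Proof.
move=> /andP[]; rewrite le_eqVlt => /predU1P[<- _|t0 t1]; first by rewrite sin0 mul0r.
case: (@MVT R sin cos 0 t t0) => [|c].
- by apply: derivable_within_continuous => u _; exact: derivable_sin.
- rewrite in_itv /= sin0 !subr0 => /andP[c0 ct] ->.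
  have : 2^-1 <= cos c by apply: cos_ge_half; apply/andP; split; lra.
  nra.
Qed.

Definition tcot t : R := t * cos t / sin t.

(** Beyond 2 pi / 3, the largest argument whose value is used, and below pi, where the sine vanishes
    again. *)
Notation u0 := (3 * (pi / 4) : R).

(** Near 0 the bound sin t >= t / 2 gives at most 2; from pi / 6 on sin t >= 1/2 gives at most 2
    pi. *)
Lemma tcot_bound t : 0 <= t <= u0 -> `|tcot t| <= 2 + 2 * pi.
Proof.
have p0 := pi_gt0 R; move=> /andP[t0 t1].
have [->|tn0] := eqVneq t 0; first by rewrite /tcot !mul0r normr0; lra.
have {tn0}t0 : 0 < t by rewrite lt_neqAle eq_sym tn0.
have s0 : 0 < sin t by apply: sin_gt0_pi; apply/andP; split; lra.
rewrite /tcot 2!normrM (gtr0_norm t0) normfV (gtr0_norm s0) ler_pdivrMr//.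
have c1 := cos_max t; have c0 := normr_ge0 (cos t).
have [t2|t2] := leP t (pi / 6).
  have := @sin_ge_lin t; rewrite t2 (ltW t0) => /(_ isT) H; nra.
have := @sin_ge_half t => H; have : 2^-1 <= sin t by apply: H; apply/andP; split; lra.
nra.
Qed.

Lemma continuous_tcot t : 0 < t < pi -> {for t, continuous tcot}.
Proof.
move=> t0; apply: cvgM; first by apply: cvgM; [exact: cvg_id|exact: continuous_cos].
by apply: cvgV; [apply: lt0r_neq0; exact: sin_gt0_pi|exact: continuous_sin].
Qed.

Lemma integrable_tcot : mu.-integrable `[0, u0] (EFin \o tcot).
Proof.
apply: measurable_bounded_integrable => //.
- by have := @leb1_itv R true false 0 u0; rewrite /leb1 /= /leb1_set => ->; rewrite ?ltry//; have := pi_gt0 R; lra.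
- apply: measurable_funTS; apply: measurable_funM.
    by apply: measurable_funM => //; apply: continuous_measurable_fun; exact: continuous_cos.
  apply: (measurableT_comp measurable_invr).
  by apply: continuous_measurable_fun; exact: continuous_sin.
- exists (2 + 2 * pi); split; first by rewrite num_real.
  by move=> M HM t; rewrite /= in_itv /= => /tcot_bound H; apply: (le_trans H); exact: ltW.
Qed.

Definition icot x : R := (\int[mu]_(t in `[0, x]) tcot t)%R.

Lemma is_derive_icot x : 0 < x < u0 -> is_derive x 1 icot (tcot x).
Proof.
have p0 := pi_gt0 R; move=> /andP[x0 x1].
have xpi : 0 < x < pi by apply/andP; split; lra.
have x0' : ((0%:E : \bar R) < (x%:E : \bar R))%E by rewrite lte_fin.
have [d1 d2] := continuous_FTC1 x1 integrable_tcot x0' (continuous_tcot xpi).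
rewrite derive1E in d2.
exact: DeriveDef d1 d2.
Qed.

Lemma icot_cvg0 : icot x @[x --> 0] --> 0.
Proof.
by apply: (parameterized_integral_cvg_left _ integrable_tcot); have := pi_gt0 R; lra.
Qed.

(* [tcot] is the derivative of the regular part of the primitive, so that the
   logarithmic singularity of the integrand [-ln (2 sin x)] is explicit. *)
Definition lob x : R := icot x - x * ln (2 * sin x).

Lemma is_derive_lob x : 0 < x < u0 -> is_derive x 1 lob (- ln (2 * sin x)).
Proof.
have p0 := pi_gt0 R; move=> x01; have di := is_derive_icot x01.
have s0 : 0 < sin x by case/andP: x01 => a b; apply: sin_gt0_pi; apply/andP; split; lra.
have ds : is_derive x 1 (fun t => 2 * sin t) (2 * cos x).
  by apply: is_derive_eq; rewrite /GRing.scale /=.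
have dl := is_derive_lnc ds (mulr_gt0 (ltr0Sn _ 1) s0).
apply: is_derive_eq; rewrite /GRing.scale /= /tcot; field.
by rewrite gt_eqF.
Qed.

(** This is ln y < y at y = x^(-1/2), multiplied by 2 x. *)
Lemma ln_ge_sqrt x : 0 < x -> - (2 * Num.sqrt x) <= x * ln x.
Proof.
move=> x0; have s0 : 0 < Num.sqrt x by rewrite sqrtr_gt0.
have := ln_sublinear (x := (Num.sqrt x)^-1); rewrite invr_gt0 => /(_ s0).
rewrite lnV ?posrE// => H.
have -> : ln x = 2 * ln (Num.sqrt x).
  by rewrite -{1}(sqr_sqrtr (ltW x0)) lnXn// mulr_natl.
have E : x = Num.sqrt x * Num.sqrt x by rewrite -expr2 sqr_sqrtr// ltW.
rewrite {2}E; move: H; set y := Num.sqrt x in s0 * => H.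
have : - ln y * y < 1 by rewrite -(mulVf (lt0r_neq0 s0)) ltr_pM2r.
nra.
Qed.

Lemma lob_cvg0 : lob x @[x --> 0] --> 0.
Proof.
have p0 := pi_gt0 R.
rewrite -[X in _ --> X](subr0 0); apply: cvgB; first exact: icot_cvg0.
have sq : 2 * Num.sqrt `|x| @[x --> (0:R)] --> 0.
  have H : {for (0:R), continuous (@Num.sqrt R \o (fun x : R => `|x|))}.
    by apply: continuous_comp; [exact: norm_continuous|exact: sqrt_continuous].
  rewrite -[X in _ --> X](mulr0 2); apply: cvgM; first exact: cvg_cst.
  by move: H; rewrite /prop_for /continuous_at /= normr0 sqrtr0.
have sqN : - (2 * Num.sqrt `|x|) @[x --> (0:R)] --> 0.
  by rewrite -[X in _ --> X]oppr0; exact: cvgN.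
apply: (squeeze_cvgr _ sqN sq); near=> x.
have x1 : `|x| < pi / 6 by near: x; apply: (@nbhs0_lt R R); lra.
(* The limit is two-sided; for x <= 0 the argument of [ln] is nonpositive and [ln] has its default
   value 0. *)
have [x0|x0] := ltP 0 x; last first.
  rewrite ln0; first by rewrite mulr0 oppr_le0 mulr_ge0 ?sqrtr_ge0.
  have -> : sin x = - sin (- x) by rewrite sinN opprK.
  rewrite ler0_norm// in x1.
  have : 0 <= sin (- x) by apply: sin_ge0_pi; apply/andP; split; lra.
  lra.
rewrite gtr0_norm// in x1 *.
have s1 : x <= 2 * sin x by have := @sin_ge_lin x; rewrite (ltW x0) (ltW x1) => /(_ isT); lra.
have s2 : 2 * sin x <= 1.
  have : sin x < sin (pi / 6) by rewrite ltr_sin ?in_itv//=; apply/andP; split; lra.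
  rewrite sin_pi6; lra.
apply/andP; split.
  apply: (le_trans (ln_ge_sqrt x0)); rewrite ler_pM2l// ler_ln ?posrE//; lra.
apply: (@le_trans _ _ 0); last by rewrite mulr_ge0 ?sqrtr_ge0.
by rewrite mulr_ge0_le0 ?(ltW x0)// ln_le0.
Unshelve. all: by end_near. Qed.

Lemma lob0 : lob 0 = 0.
Proof. by rewrite /lob /icot set_itv1 Rintegral_set1 mul0r subrr. Qed.

Lemma continuous_lob x : 0 <= x < u0 -> {for x, continuous lob}.
Proof.
move=> /andP[]; rewrite le_eqVlt => /predU1P[<- _|x0 x1].
  by rewrite /prop_for /continuous_at lob0; exact: lob_cvg0.
apply: differentiable_continuous; apply/derivable1_diffP.
by have H : is_derive x 1 lob (- ln (2 * sin x)); [apply: is_derive_lob; rewrite x0 x1|exact: ex_derive].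
Qed.

Lemma is_derive_lobc (f : R -> R) x a : is_derive x 1 f a -> 0 < f x < u0 ->
  is_derive x 1 (fun t => lob (f t)) (- a * ln (2 * sin (f x))).
Proof.
move=> df f0; have := @is_derive1_comp _ _ f x _ _ (is_derive_lob f0) df.
by rewrite mulNr mulNr mulrC.
Qed.

Lemma lob_sym x : pi / 4 < x < u0 -> lob x + lob (pi - x) = 2 * lob (pi / 2).
Proof.
have p0 := pi_gt0 R.
pose f t := lob t + lob (pi - t).
have df t : pi / 4 < t < u0 -> is_derive t 1 f 0.
  move=> /andP[t1 t2].
  have d1 : is_derive t 1 lob (- ln (2 * sin t)) by apply: is_derive_lob; apply/andP; split; lra.
  have d2 : is_derive t 1 (fun s => pi - s) (-1).
    by apply: is_derive_eq; ring.
  have d3 := is_derive_lobc d2 _.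
  have {}d3 : is_derive t 1 (fun s => lob (pi - s)) (- -1 * ln (2 * sin (pi - t))).
    by apply: d3; apply/andP; split; lra.
  apply: is_derive_eq; rewrite opprK mul1r sinB sinpi cospi.
  have -> : 0 * cos t - -1 * sin t = sin t by ring.
  by rewrite addNr.
move=> x1; rewrite -/(f x) (eq_is_derive0 df x1 (y := pi / 2)); last by apply/andP; split; lra.
rewrite /f; have -> : pi - pi / 2 = pi / 2 :> R by field.
by ring.
Qed.

(** The duplication formula says that this vanishes; its derivative cancels by sin 2x = 2 sin x cos
    x. *)
Definition dup x : R := lob (2 * x) - 2 * lob x + 2 * lob (pi / 2 - x).

Lemma is_derive_dup t : 0 < t < 3 * (pi / 8) -> is_derive t 1 dup 0.
Proof.
have p0 := pi_gt0 R; move=> /andP[t1 t2].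
have d1 : is_derive t 1 lob (- ln (2 * sin t)) by apply: is_derive_lob; apply/andP; split; lra.
have d2 : is_derive t 1 (fun s => lob (pi / 2 - s)) (- -1 * ln (2 * sin (pi / 2 - t))).
  apply: is_derive_lobc; last by apply/andP; split; lra.
  by apply: is_derive_eq; ring.
have d3 : is_derive t 1 (fun s => lob (2 * s)) (- 2 * ln (2 * sin (2 * t))).
  apply: is_derive_lobc; last by apply/andP; split; lra.
  by apply: is_derive_eq; rewrite /GRing.scale /= mulr1.
apply: is_derive_eq; rewrite /GRing.scale /=.
have s0 : 0 < sin t by apply: sin_gt0_pi; apply/andP; split; lra.
have c0 : 0 < cos t by apply: cos_gt0_pihalf; apply/andP; split; lra.
have -> : sin (pi / 2 - t) = cos t by rewrite sinB sin_pihalf cos_pihalf; ring.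
have -> : 2 * sin (2 * t) = (2 * sin t) * (2 * cos t).
  have -> : 2 * t = t *+ 2 by ring.
  by rewrite sin_mulr2n; ring.
by rewrite lnM ?posrE ?mulr_gt0//; ring.
Qed.

(** [dup] is constant, its value at pi / 4 is [lob (pi / 2)], and its limit at 0 from the right is
    twice that number. *)
Lemma lob_pihalf : lob (pi / 2) = 0.
Proof.
have p0 := pi_gt0 R.
have H : dup (pi / 4) = lob (pi / 2).
  rewrite /dup; have -> : pi / 2 - pi / 4 = pi / 4 :> R by field.
  have -> : 2 * (pi / 4) = pi / 2 :> R by field.
  by ring.
have L : dup x @[x --> 0^'+] --> 2 * lob (pi / 2).
  apply: cvg_at_right_filter.
  have -> : 2 * lob (pi / 2) = lob (2 * 0) - 2 * lob 0 + 2 * lob (pi / 2 - 0).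
    by rewrite mulr0 lob0 subr0; ring.
  apply: cvgD; [apply: cvgB|].
  - have H2 : {for (0:R), continuous (lob \o (fun x : R => 2 * x))}; last exact: H2.
    apply: continuous_comp; first by apply: cvgM; [exact: cvg_cst|exact: cvg_id].
    by apply: continuous_lob; apply/andP; split; lra.
  - by apply: cvgM; [exact: cvg_cst|apply: continuous_lob; apply/andP; split; lra].
  - apply: cvgM; first exact: cvg_cst.
    have H2 : {for (0:R), continuous (lob \o (fun x : R => pi / 2 - x))}; last exact: H2.
    apply: continuous_comp; first by apply: cvgB; [exact: cvg_cst|exact: cvg_id].
    by apply: continuous_lob; apply/andP; split; lra.
have L' : dup x @[x --> 0^'+] --> dup (pi / 4).
  apply: cvg_near_cst; near=> x.
  apply/esym/(eq_is_derive0 is_derive_dup); apply/andP; split; try lra.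
  - by near: x; exact: nbhs_right_gt.
  - by near: x; apply: nbhs_right_lt; lra.
have /(_ _) := @cvg_unique _ (@Rhausdorff R) _ _ _ _ L L'.
rewrite H; lra.
Unshelve. all: by end_near. Qed.

Lemma lob_pi6 : lob (pi / 6) = 3 / 2 * lob (pi / 3).
Proof.
have p0 := pi_gt0 R.
have : dup (pi / 6) = dup (pi / 4) by apply: (eq_is_derive0 is_derive_dup); apply/andP; split; lra.
rewrite /dup; have -> : pi / 2 - pi / 4 = pi / 4 :> R by field.
have -> : 2 * (pi / 4) = pi / 2 :> R by field.
have -> : 2 * (pi / 6) = pi / 3 :> R by field.
have -> : pi / 2 - pi / 6 = pi / 3 :> R by field.
rewrite lob_pihalf; lra.
Qed.

(** By [lob_pi6] it suffices to look at pi / 6: up to there 2 sin t < 1, so the derivative of [lob]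
    is positive. *)
Lemma lob_pi3_gt0 : 0 < lob (pi / 3).
Proof.
have p0 := pi_gt0 R.
suff : 0 < lob (pi / 6) by rewrite lob_pi6; lra.
have p6 : 0 < pi / 6 :> R by lra.
case: (@MVT R lob (fun t => - ln (2 * sin t)) 0 (pi / 6) p6) => [c||c].
- by rewrite in_itv /= => /andP[? ?]; apply: is_derive_lob; apply/andP; split; lra.
- apply: continuous_in_subspaceT => x; rewrite inE /= in_itv /= => /andP[? ?].
  by apply: continuous_lob; apply/andP; split; lra.
- rewrite in_itv /= lob0 !subr0 => /andP[c0 c1] ->.
  apply: mulr_gt0; last lra.
  rewrite oppr_gt0 ln_lt0//.
  have s0 : 0 < sin c by apply: sin_gt0_pi; apply/andP; split; lra.
  have : sin c < sin (pi / 6) by rewrite ltr_sin ?in_itv//=; apply/andP; split; lra.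
  by rewrite sin_pi6 => ?; apply/andP; split; lra.
Qed.

Lemma lob_2pi3 : lob (2 * (pi / 3)) = - lob (pi / 3).
Proof.
have p0 := pi_gt0 R.
have := @lob_sym (pi / 3); rewrite lob_pihalf.
have -> : pi - pi / 3 = 2 * (pi / 3) :> R by field.
move=> H; have /H : pi / 4 < (pi : R) / 3 < u0 by apply/andP; split; lra.
lra.
Qed.

End Lobachevsky.

(** * The value of the total mass and the law of the length *)

Section Normalization.
Context {R : realType}.
Notation s3 := (Num.sqrt 3 : R).

Lemma cos_atan_gt0 (x : R) : 0 < cos (atan x).
Proof. by rewrite cos_atan invr_gt0 sqrtr_gt0 q1_gt0. Qed.

Lemma atan_itv (q : R) : 0 < q <= s3^-1 -> 0 < atan q <= pi / 6.
Proof.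
move=> /andP[q0 q1]; rewrite -{1}atan0 lt_atan//= -atan_s3V; exact: le_atan.
Qed.

(** With q = tan t one has dq / (1 + q^2) = dt and sin 3t = sin t (3 - q^2) cos^2 t, so ln(4 / (3 -
    q^2)) = 2 ln(2 sin 2t) - ln(2 sin t) - ln(2 sin 3t). The three terms are primitives of these
    logarithms. *)
Definition lobG (q : R) : R := 3^-1 * lob (3 * atan q) + lob (atan q) - lob (2 * atan q).

Lemma is_derive_lobG q : 0 < q <= s3^-1 -> is_derive q 1 lobG (bfun q).
Proof.
have p0 := pi_gt0 R; move=> q01; have /andP[t0 t1] := atan_itv q01.
set t := atan q in t0 t1.
have d0 := is_derive1_atan q.
have d1 : is_derive q 1 (fun s => lob (atan s)) (- (1 + q ^+ 2)^-1 * ln (2 * sin t)).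
  by apply: is_derive_lobc; apply/andP; split; rewrite -/t; lra.
have dM (c : R) : is_derive q 1 (fun s => c * atan s) (c * (1 + q ^+ 2)^-1).
  by apply: is_derive_eq; rewrite /GRing.scale /=.
have d2 : is_derive q 1 (fun s => lob (2 * atan s)) (- (2 * (1 + q ^+ 2)^-1) * ln (2 * sin (2 * t))).
  by apply: is_derive_lobc; apply/andP; split; rewrite -/t; lra.
have d3 : is_derive q 1 (fun s => lob (3 * atan s)) (- (3 * (1 + q ^+ 2)^-1) * ln (2 * sin (3 * t))).
  by apply: is_derive_lobc; apply/andP; split; rewrite -/t; lra.
have s0 : 0 < sin t by apply: sin_gt0_pi; apply/andP; split; lra.
have c0 : 0 < cos t by exact: cos_atan_gt0.
have S2 : sin (2 * t) = 2 * sin t * cos t.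
  by have -> : 2 * t = t *+ 2 by [ring]; rewrite sin_mulr2n; ring.
have q2 : q = sin t / cos t by rewrite -[LHS]atanK.
have c2 : cos t ^+ 2 = 1 - sin t ^+ 2 by rewrite cos2sin2.
have S3 : sin (3 * t) = sin t * (3 - q ^+ 2) * cos t ^+ 2.
  have -> : 3 * t = t *+ 2 + t by ring.
  rewrite sinD sin_mulr2n cos_mulr2n q2.
  transitivity (sin t * (4 * cos t ^+ 2 - 1)); first by ring.
  transitivity (sin t * (3 * cos t ^+ 2 - sin t ^+ 2)); last by field; rewrite gt_eqF.
  by rewrite c2; ring.
have q3 : 0 < 3 - q ^+ 2.
  have : 0 < sin (3 * t) by apply: sin_gt0_pi; apply/andP; split; lra.
  by rewrite S3 pmulr_lgt0 ?exprn_gt0// pmulr_rgt0.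
apply: is_derive_eq; rewrite /GRing.scale /= /bfun S2 S3.
have -> : 2 * (2 * sin t * cos t) = (2 * sin t) * (2 * cos t) by ring.
have -> : 2 * (sin t * (3 - q ^+ 2) * cos t ^+ 2) = (2 * sin t) * ((2 * cos t) ^+ 2 * ((3 - q ^+ 2) / 4)) by field.
rewrite !lnM ?posrE ?mulr_gt0 ?exprn_gt0 ?divr_gt0 ?invr_gt0//.
rewrite !lnV ?posrE//.
by field; apply: lt0r_neq0; exact: q1_gt0.
Qed.

(** At the upper end atan is pi / 6 and the value is lob(pi/2) / 3 + lob(pi/6) - lob(pi/3). At 0
    only continuity of [lobG] is used, the derivative being taken on the open interval. *)
Lemma int_bfun : (\int[@lebesgue_measure R]_(q in `[0%R, s3^-1%R]) (bfun q)%:E = (lob (pi / 3) / 2)%:E)%E.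
Proof.
have p0 := pi_gt0 R; have S0 := @s3V_gt0 R.
have q3 (q : R) : 0 <= q <= s3^-1 -> 0 < 3 - q ^+ 2.
  move=> /andP[q0 q1]; have : q ^+ 2 <= s3^-1 ^+ 2 by rewrite ler_pXn2r// nnegrE// ltW.
  rewrite exprVn [X in _ <= X^-1]expr2 s3_sq; lra.
have cL (c : R) : 0 < c <= 3 -> forall q : R, 0 <= q <= s3^-1 -> {for q, continuous (fun s => lob (c * atan s))}.
  move=> /andP[c0 c3] q /andP[q0 q1].
  have a0 : 0 <= atan q by rewrite -atan0 le_atan.
  have a1 : atan q <= pi / 6 by rewrite -atan_s3V le_atan.
  have H : {for q, continuous (lob \o (fun s : R => c * atan s))}; last exact: H.
  apply: continuous_comp; first by apply: cvgM; [exact: cvg_cst|exact: continuous_atan].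
  by apply: continuous_lob; apply/andP; split; nra.
have cG (q : R) : 0 <= q <= s3^-1 -> {for q, continuous lobG}.
  move=> q01; have H1 := cL 1; have H2 := cL 2; have H3 := cL 3.
  apply: cvgB; last by apply: H2 => //; apply/andP; split; lra.
  apply: cvgD.
    by apply: cvgM; [exact: cvg_cst|apply: H3 => //; apply/andP; split; lra].
  have : {for q, continuous (fun s : R => lob (1 * atan s))} by apply: H1 => //; apply/andP; split; lra.
  have -> : (fun s : R => lob (1 * atan s)) = (fun s => lob (atan s)) by apply/funext => s; rewrite mul1r.
  exact.
rewrite (@continuous_FTC2 _ bfun lobG)//.
- rewrite -EFinB; congr EFin; rewrite /lobG atan0 atan_s3V !mulr0 lob0.
  have -> : 3 * (pi / 6) = pi / 2 :> R by field.
  have -> : 2 * (pi / 6) = pi / 3 :> R by field.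
  by rewrite lob_pihalf lob_pi6; field.
- apply: continuous_in_subspaceT => q; rewrite inE /= in_itv /= => q01.
  have qq := q3 q q01; have r0 : 0 < 4 / (3 - q ^+ 2) by rewrite divr_gt0.
  apply: cvgM.
    have H : {for q, continuous (@ln R \o (fun s : R => 4 / (3 - s ^+ 2)))}; last exact: H.
    apply: continuous_comp; last exact: continuous_ln.
    apply: cvgM; first exact: cvg_cst.
    apply: cvgV; first exact: lt0r_neq0.
    by apply: cvgB; [exact: cvg_cst|exact: exprn_continuous].
  apply: cvgV; first by apply: lt0r_neq0; exact: q1_gt0.
  by apply: cvgD; [exact: cvg_cst|exact: exprn_continuous].
- split.
  + move=> q; rewrite in_itv /= => /andP[q0 q1].
    have H : is_derive q 1 lobG (bfun q) by apply: is_derive_lobG; rewrite q0 ltW.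
    exact: ex_derive.
  + by apply: cvg_at_right_filter; apply: cG; rewrite lexx ltW.
  + by apply: cvg_at_left_filter; apply: cG; rewrite lexx ltW.
- move=> q; rewrite in_itv /= => /andP[q0 q1]; rewrite derive1E.
  have H : is_derive q 1 lobG (bfun q) by apply: is_derive_lobG; rewrite q0 ltW.
  exact: derive_val.
Qed.

Local Open Scope ereal_scope.

Lemma massT : mass setT = (cball * lob (pi / 3))%:E :> \bar R.
Proof. by rewrite mass_total int_bfun -EFinM; congr EFin; field. Qed.

Lemma measurable_Wr : measurable_fun setT (@Wr R).
Proof.
have mq : measurable_fun setT (@qr R).
  by apply: (measurableT_comp measurable_sqrtr); apply: measurable_funB => //; exact: measurable_funM.
have mat : measurable_fun setT (@atan R).
  by apply: continuous_measurable_fun => x; exact: continuous_atan.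
have mx : measurable_fun setT (fun r : R => Num.max r 0%R) by exact: measurable_maxr.
apply: measurable_fun_ifT => //; first exact: measurable_fun_ler.
apply: measurable_funB; apply: measurable_funB => //; try exact: measurable_funM.
apply: measurable_funM => //; exact: (measurableT_comp mat mq).
Qed.

Definition mdens (t : R) : R := (rdens t * (2 * Wr (1 - t ^- 4)))%R.

Lemma mdens_ge0 t : (0 <= mdens t)%R.
Proof. by rewrite mulr_ge0 ?rdens_ge0// mulr_ge0// Wr_ge0. Qed.

Lemma measurable_mdens : measurable_fun setT mdens.
Proof.
apply: measurable_funM; first exact: measurable_rdens.
apply: measurable_funM => //; apply: (measurableT_comp measurable_Wr).
apply: measurable_funB => //; apply: (measurableT_comp measurable_invr); exact: measurable_funX.
Qed.

Lemma massE (A : set R) : measurable A ->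
  mass A = \int[@lebesgue_measure R]_(t in A) (mdens t)%:E.
Proof.
move=> mA; rewrite -leb1E//; last 2 first.
- by apply: measurable_funTS; apply/measurable_EFinP; exact: measurable_mdens.
- by move=> t _; rewrite lee_fin mdens_ge0.
rewrite [RHS]integral_mkcond; apply: eq_integral => t _; rewrite patchE -/(mdens t).
case: asboolP => At; first by rewrite mul1r mem_set.
by rewrite mul0r memNset.
Qed.

Lemma mass_ge0 (A : set R) : 0 <= mass A.
Proof. by apply: integral_ge0 => t _; rewrite lee_fin mulr_ge0// mdens_ge0. Qed.

Lemma le_massT (A : set R) : measurable A -> mass A <= mass setT.
Proof.
move=> mA; apply: ge0_le_integral => //.
- by move=> t _; rewrite lee_fin mulr_ge0// mdens_ge0.
- apply/measurable_EFinP; apply: measurable_funM; last exact: measurable_mdens.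
  by apply/measurable_EFinP; apply: measurable_ifE; exact: measurable_asbool_set.
- apply/measurable_EFinP; apply: measurable_funM; last exact: measurable_mdens.
  by apply/measurable_EFinP; apply: measurable_ifE; exact: measurable_asbool_set.
- move=> t _; rewrite lee_fin; apply: ler_wpM2r; first exact: mdens_ge0.
  by rewrite [`[< setT t >]]asboolT// ler_nat leq_b1.
Qed.

Lemma mule_fin_inj (k : R) (x y : \bar R) : k != 0%R -> x * k%:E = y * k%:E -> x = y.
Proof.
move=> k0 H; have := congr1 (fun z => z * (k^-1)%:E) H.
by rewrite /= -!muleA -EFinM mulfV// !mule1.
Qed.

Lemma SL2C_invK : involutive (@SL2C_inv R).
Proof. by move=> g; rewrite -[LHS](SL2C_mulgKV g) SL2C_mulVg SL2C_mul1g. Qed.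

Section Law.
Variable mu : probability (coset_borel R) R.
Hypothesis mu_inv : SL2C_invariant mu.

(** [lam_haar] with one fixed test function [f] is applied to the strict and to the weak indicator;
    the factor on the right is the total mass. *)
Lemma ell_law_mass A : measurable A ->
  mass A = ell_law mu A * (cball * lob (pi / 3))%:E.
Proof.
move=> mA.
have L0 := @lob_pi3_gt0 R; have c0 := @cball_gt0 R.
pose T : R := (cball * lob (pi / 3))%R.
have T0 : (0 < T)%R by exact: mulr_gt0.
pose c : R := fine (@cdet R).
have cE : @cdet R = c%:E by rewrite fineK// ge0_fin_numE ?cdet_lt// ltW// cdet_gt0.
have cc0 : (0 < c)%R by rewrite -lte_fin -cE cdet_gt0.
pose FT : SL2C_borel R -> \bar R := redF true setT.
have mFT : measurable_fun setT FT by exact: measurable_redF.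
have FT0 g : 0 <= FT g by exact: redF_ge0.
(* The inverse makes the second Haar integral in [lam_haar] the known number [c * T]. *)
pose f : SL2C_borel R -> \bar R := FT \o @SL2C_inv R.
have mf : measurable_fun setT f by apply: (measurableT_comp mFT); exact: measurable_SL2C_inv.
have fV : f \o @SL2C_inv R = FT by apply/funext => g; rewrite /f /= SL2C_invK.
have hT : haar (f \o @SL2C_inv R) = (c * T)%:E by rewrite fV mass_redF// massT cE -EFinM.
have hfin o (B : set R) : measurable B -> haar (redF o B) \is a fin_num.
  move=> mB; rewrite mass_redF// ge0_fin_numE; last by rewrite mule_ge0 ?mass_ge0// ltW// cdet_gt0.
  apply: lte_mul_pinfty; [exact/ltW/cdet_gt0|by rewrite cE|].
  by apply: (le_lt_trans (le_massT mB)); rewrite massT ltry.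
have key o (B : set R) : measurable B -> lam mu f * (cdet * mass B) = lam mu (redF o B) * (c * T)%:E.
  move=> mB; rewrite -(mass_redF o mB) -hT.
  apply: (lam_haar mu_inv mf) => //.
  - by move=> g; exact: FT0.
  - exact: measurable_redF.
  - by move=> g; exact: redF_ge0.
  - exact: hfin.
  - by rewrite hT.
have cT0 : (c * T != 0)%R by rewrite mulf_neq0// gt_eqF.
have E o : lam mu f = lam mu (redF o setT).
  by apply: (mule_fin_inj cT0); rewrite -(key o setT)// massT cE -EFinM.
(* This number is both the expected number of strictly reduced bases, at most 2, and that of weakly
   reduced ones, at least 2. *)
have lf : lam mu f = 2%:E.
  have P1 : ell_law mu setT = 1 by rewrite /ell_law -[X in mu X]/setT; exact: probability_setT.
  apply/eqP; rewrite eq_le; apply/andP; split.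
    by rewrite (E true) (le_trans (redo_lam_le mu measurableT))// P1 mule1.
  by rewrite (E false) (le_trans _ (le_redc_lam mu measurableT))// P1 mule1.
(* Equal Haar measures force equal values of [lam], so both inequalities of the squeeze are
   equalities. *)
have El : lam mu (redF true A) = lam mu (redF false A).
  by apply: (mule_fin_inj cT0); exact: etrans (esym (key true A mA)) (key false A mA).
have PA : lam mu (redF true A) = 2%:E * ell_law mu A.
  by apply/eqP; rewrite eq_le redo_lam_le//= El le_redc_lam.
have := key true A mA; rewrite lf PA cE => H.
have c2 : (2 * c != 0)%R by rewrite mulf_neq0// gt_eqF.
apply: (mule_fin_inj c2).
transitivity (2%:E * (c%:E * mass A)); first by rewrite muleA -EFinM muleC.
rewrite H -/T [2%:E * _]muleC -!muleA -!EFinM; congr (_ * _%:E); ring.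
Qed.

Lemma ell_law_density A : measurable A ->
  ell_law mu A = \int[@lebesgue_measure R]_(t in A) ((cball * lob (pi / 3))^-1 * mdens t)%:E.
Proof.
move=> mA; have T0 : (0 < cball * lob (pi / 3) :> R)%R by rewrite mulr_gt0 ?cball_gt0 ?lob_pi3_gt0.
have mD : measurable_fun A (fun t => (mdens t)%:E : \bar R).
  by apply: measurable_funTS; apply/measurable_EFinP; exact: measurable_mdens.
under eq_integral do rewrite EFinM.
rewrite ge0_integralZl//.
- rewrite -massE// (ell_law_mass mA) muleC -muleA -EFinM mulfV ?mule1// gt_eqF//.
- by move=> t _; rewrite lee_fin mdens_ge0.
- by rewrite lee_fin invr_ge0 ltW.
Qed.

End Law.
End Normalization.

(** * The dilogarithm at exp(i pi / 3) *)

Section MeanValue.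
Context {R : realType}.

(** The mean value theorem for g - s f with s = 1 and s = -1: it integrates a bound on the
    derivative without integrals. *)
Lemma mean_value_le (f g f' g' : R -> R) (a b : R) : a <= b ->
  (forall t, a < t < b -> is_derive t 1 f (f' t)) ->
  (forall t, a < t < b -> is_derive t 1 g (g' t)) ->
  {within `[a, b], continuous f} -> {within `[a, b], continuous g} ->
  (forall t, a < t < b -> `|f' t| <= g' t) ->
  `|f b - f a| <= g b - g a.
Proof.
rewrite le_eqVlt => /predU1P[<-|ab] df dg cf cg fg; first by rewrite !subrr normr0.
have H (s : R) : s * s = 1 -> s * (f b - f a) <= g b - g a.
  move=> s1; pose k t := g t - s * f t.
  have dk t : t \in `]a, b[ -> is_derive t 1 k (g' t - s * f' t).
    rewrite in_itv /= => tab; have d1 := df t tab; have d2 := dg t tab.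
    by apply: is_derive_eq; rewrite /GRing.scale /=.
  have ck : {within `[a, b], continuous k}.
    move=> t; apply: cvgB; first exact: cg.
    by apply: cvgM; [exact: cvg_cst|exact: cf].
  have [c] := MVT ab dk ck; rewrite in_itv /= => cab E.
  have sn : `|s| = 1 by apply/eqP; rewrite -sqrp_eq1// -normrX expr2 s1 normr1.
  have : s * f' c <= g' c.
    by apply: (le_trans _ (fg c cab)); rewrite -[leRHS]mul1r -sn -normrM ler_norm.
  have : 0 <= (g' c - s * f' c) * (b - a) -> s * (f b - f a) <= g b - g a.
    by rewrite -E /k; lra.
  by move=> h h'; apply: h; rewrite mulr_ge0 ?subr_ge0// ltW.
have H1 := H 1 (mul1r 1); have H2 := H (-1); rewrite mulrNN mulr1 in H2.
by have {}H2 := H2 erefl; rewrite ler_norml; apply/andP; split; lra.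
Qed.

End MeanValue.

Section Dilogarithm.
Context {R : realType}.
Notation s3 := (Num.sqrt 3 : R).
Implicit Types u : R.

Definition zeta6 : R[i] := (1 +i* s3) / 2.

(** This is sin(n pi / 3), handled through the recurrence [sigSS] and the bound 1. *)
Definition sig (n : nat) : R := complex.Im (zeta6 ^+ n).

Lemma zeta6E : zeta6 = 2^-1 +i* (s3 / 2).
Proof.
rewrite /zeta6; have -> : (2 : R[i])^-1 = (2^-1)%:C.
  by rewrite fmorphV rmorph_nat.
by apply/eqP; rewrite eq_complex /=; apply/andP; split; apply/eqP; ring.
Qed.

Lemma zeta6_sqr : zeta6 ^+ 2 = zeta6 - 1.
Proof.
rewrite expr2 zeta6E; apply/eqP; rewrite eq_complex /=; apply/andP; split; apply/eqP; last by field.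
transitivity ((1 - s3 * s3) / 4); first by field.
by rewrite s3_sq; field.
Qed.

Lemma sigSS n : sig n.+2 = sig n.+1 - sig n.
Proof.
rewrite /sig -addn2 exprD zeta6_sqr mulrBr mulr1 -exprSr.
by case: (_ ^+ n.+1) => a b; case: (_ ^+ n).
Qed.

Lemma nsq_zeta6X n : nsq (zeta6 ^+ n) = 1.
Proof.
elim: n => [|n IH]; first by rewrite expr0 nsq1.
rewrite exprS nsqM IH mulr1 zeta6E /nsq /=; transitivity ((1 + s3 * s3) / 4); first by field.
by rewrite s3_sq; field.
Qed.

Lemma zeta6X_le1 n : `|complex.Re (zeta6 ^+ n)| <= 1 /\ `|complex.Im (zeta6 ^+ n)| <= 1.
Proof.
have := nsq_zeta6X n; rewrite /nsq; case: (_ ^+ n) => a b /= H.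
have := sqr_ge0 a; have := sqr_ge0 b => h1 h2.
by split; rewrite ler_norml; apply/andP; split; nra.
Qed.

Lemma sig_le1 n : `|sig n| <= 1. Proof. by case: (zeta6X_le1 n). Qed.

Lemma sig0 : sig 0 = 0. Proof. by rewrite /sig expr0. Qed.
Lemma sig1 : sig 1 = s3 / 2. Proof. by rewrite /sig expr1 zeta6E. Qed.

(** With z = [zeta6], the three sums are the imaginary parts of partial sums of z / (1 - u z), -
    ln(1 - u z) and the dilogarithm of u z. Each controls the derivative of the next, so explicit
    remainders can be carried up to u = 1. *)
Definition geoN N u : R := \sum_(n < N) u ^+ n * sig n.+1.
Definition logN N u : R := \sum_(n < N) u ^+ n.+1 * (sig n.+1 / n.+1%:R).
Definition diloN N u : R := \sum_(n < N) u ^+ n.+1 * (sig n.+1 / n.+1%:R ^+ 2).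

Lemma is_derive_pow N u : is_derive u 1 (fun t : R => t ^+ N.+1) (N.+1%:R * u ^+ N).
Proof.
elim: N => [|N IH].
  rewrite expr0 mulr1 (_ : (fun t : R => t ^+ 1) = id); first exact: is_derive_id.
  by apply/funext => t; rewrite expr1.
rewrite (_ : (fun t : R => t ^+ N.+2) = (fun t => t * t ^+ N.+1)); last first.
  by apply/funext => t; rewrite exprS.
by apply: is_derive_eq; rewrite /GRing.scale /= !exprS -[N.+2]add1n natrD; ring.
Qed.

Lemma is_derive_mulc (f : R -> R) (c x a : R) : is_derive x 1 f a ->
  is_derive x 1 (fun t => f t * c) (a * c).
Proof. by move=> df; apply: is_derive_eq; rewrite /GRing.scale /=; ring. Qed.

(** The product of 1 - u z and its conjugate is 1 - u + u^2, so the geometric sum telescopes through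
    [sigSS]. *)
Lemma geoNE N u : (1 - u + u ^+ 2) * geoN N u = sig 1 - u ^+ N * sig N.+1 + u ^+ N.+1 * sig N.
Proof.
elim: N => [|N IH]; first by rewrite /geoN big_ord0 mulr0 expr0 sig0 mul1r mulr0 addr0 subrr.
by rewrite /geoN big_ord_recr /= -/(geoN N u) mulrDr IH sigSS !exprS; ring.
Qed.

Lemma is_derive_logN N u : is_derive u 1 (logN N) (geoN N u).
Proof.
elim: N => [|N IH].
  rewrite (_ : logN 0 = cst 0); last by apply/funext => t; rewrite /logN big_ord0.
  by rewrite /geoN big_ord0; exact: is_derive_cst.
rewrite (_ : logN N.+1 = (fun t => logN N t + t ^+ N.+1 * (sig N.+1 / N.+1%:R))); last first.
  by apply/funext => t; rewrite /logN big_ord_recr.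
rewrite /geoN big_ord_recr /= -/(geoN N u).
have d := is_derive_mulc (sig N.+1 / N.+1%:R) (is_derive_pow N u).
apply: is_derive_eq; congr +%R; have : (N.+1%:R : R) != 0 by rewrite pnatr_eq0.
by move: (N.+1%:R : R) => k k0; field.
Qed.

Lemma is_derive_diloN N u : 0 < u -> is_derive u 1 (diloN N) (logN N u / u).
Proof.
move=> u0; elim: N => [|N IH].
  rewrite (_ : diloN 0 = cst 0); last by apply/funext => t; rewrite /diloN big_ord0.
  by rewrite /logN big_ord0 mul0r; exact: is_derive_cst.
rewrite (_ : diloN N.+1 = (fun t => diloN N t + t ^+ N.+1 * (sig N.+1 / N.+1%:R ^+ 2))); last first.
  by apply/funext => t; rewrite /diloN big_ord_recr.
rewrite /logN big_ord_recr /= -/(logN N u).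
have d := is_derive_mulc (sig N.+1 / N.+1%:R ^+ 2) (is_derive_pow N u).
apply: is_derive_eq; rewrite mulrDl [u ^+ N.+1]exprS; congr +%R; have : (N.+1%:R : R) != 0 by rewrite pnatr_eq0.
by move: (N.+1%:R : R) => k k0; field; rewrite k0 gt_eqF.
Qed.

(** The number 1 - u [zeta6] = (2 - u) / 2 - i sqrt 3 u / 2 has argument - phi u for u < 2. *)
Definition phi u : R := atan (s3 * u / (2 - u)).

Lemma quad_ge u : 3 / 4 <= 1 - u + u ^+ 2.
Proof. by have := sqr_ge0 (u - 2^-1); rewrite !expr2; lra. Qed.

Lemma is_derive_phi u : u < 2 -> is_derive u 1 phi (s3 / 2 / (1 - u + u ^+ 2)).
Proof.
move=> u2; have u0 : 2 - u != 0 by rewrite gt_eqF// subr_gt0.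
have q := quad_ge u.
have d1 : is_derive u 1 (fun t => s3 * t / (2 - t)) (2 * s3 / (2 - u) ^+ 2).
  have d2 : is_derive u 1 (fun t : R => 2 - t) (-1) by apply: is_derive_eq; ring.
  have d3 : is_derive u 1 (fun t : R => (2 - t)^-1) (- (2 - u) ^- 2 *: (-1)).
    exact: (@is_deriveV R (fun t : R => 2 - t) u (-1) 1 u0 d2).
  apply: is_derive_eq; rewrite /GRing.scale /=; by field.
have H := @is_derive1_comp _ _ (fun t => s3 * t / (2 - t)) _ _ _ (is_derive1_atan _) d1.
apply: (is_derive_eq (f := phi) H).
have E : 1 + (s3 * u / (2 - u)) ^+ 2 = 4 * (1 - u + u ^+ 2) / (2 - u) ^+ 2.
  rewrite !exprMn [s3 ^+ 2]expr2 s3_sq exprVn; by field.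
have D0 : 1 - u + u ^+ 2 != 0 by apply: lt0r_neq0; lra.
by rewrite E; move: (1 - u + u ^+ 2) D0 => D D0; field; rewrite u0 D0.
Qed.

Lemma continuous_diloN N : continuous (diloN N).
Proof.
elim: N => [|N IH].
  by rewrite (_ : diloN 0 = cst 0); [move=> ?; exact: cvg_cst|apply/funext => t; rewrite /diloN big_ord0].
rewrite (_ : diloN N.+1 = (fun t => diloN N t + t ^+ N.+1 * (sig N.+1 / N.+1%:R ^+ 2))); last first.
  by apply/funext => t; rewrite /diloN big_ord_recr.
move=> t; apply: cvgD; first exact: IH.
by apply: cvgM; [exact: exprn_continuous|exact: cvg_cst].
Qed.

Lemma logN0 N : logN N 0 = 0.
Proof. by rewrite /logN big1// => i _; rewrite expr0n mul0r. Qed.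
Lemma diloN0 N : diloN N 0 = 0.
Proof. by rewrite /diloN big1// => i _; rewrite expr0n mul0r. Qed.
Lemma phi0 : phi 0 = 0. Proof. by rewrite /phi mulr0 mul0r atan0. Qed.

Lemma is_derive_powN (c : R) N u : is_derive u 1 (fun t : R => c * t ^+ N.+1) (c * (N.+1%:R * u ^+ N)).
Proof. by have d := is_derive_pow N u; apply: is_derive_eq; rewrite /GRing.scale. Qed.

(** The derivative of the difference is at most 2 t^N divided by 1 - t + t^2 >= 3/4, and 3 rounds up
    8/3. *)
Lemma phi_logN N u : 0 <= u <= 1 -> `|phi u - logN N u| <= 3 / N.+1%:R * u ^+ N.+1.
Proof.
move=> /andP[u0 u1].
have dd (t : R) : t < 2 -> is_derive t 1 (fun t => phi t - logN N t) (s3 / 2 / (1 - t + t ^+ 2) - geoN N t).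
  by move=> t2; have d1 := is_derive_phi t2; have d2 := is_derive_logN N t; apply: is_derive_eq.
have := @mean_value_le R (fun t => phi t - logN N t) (fun t => 3 / N.+1%:R * t ^+ N.+1)
  (fun t => s3 / 2 / (1 - t + t ^+ 2) - geoN N t) (fun t => 3 / N.+1%:R * (N.+1%:R * t ^+ N)) 0 u u0.
rewrite phi0 logN0 expr0n /= mulr0 !subr0; apply.
- by move=> t /andP[t0 t1]; apply: dd; lra.
- by move=> t _; exact: is_derive_powN.
- apply: derivable_within_continuous => t; rewrite in_itv /= => /andP[t0 t1].
  have H : is_derive t 1 (fun t => phi t - logN N t) (s3 / 2 / (1 - t + t ^+ 2) - geoN N t).
    by apply: dd; lra.
  exact: ex_derive.
- apply: derivable_within_continuous => t _; have H := is_derive_powN (3 / N.+1%:R) N t.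
  exact: ex_derive.
- move=> t /andP[t0 t1].
  have q := quad_ge t; set D := 1 - t + t ^+ 2 in q *.
  have D0 : 0 < D by lra.
  have E : s3 / 2 / D - geoN N t = (t ^+ N * sig N.+1 - t ^+ N.+1 * sig N) / D.
    have := geoNE N t; rewrite -/D sig1 => G.
    apply: (mulfI (lt0r_neq0 D0)); rewrite mulrBr G; field; exact: lt0r_neq0.
  rewrite E mulrA divfK ?pnatr_eq0// normrM normfV (gtr0_norm D0) ler_pdivrMr//.
  have tN : 0 <= t ^+ N by rewrite exprn_ge0// ltW.
  have tN1 : t ^+ N.+1 <= t ^+ N by rewrite exprS ler_piMl//; lra.
  have tN0 : 0 <= t ^+ N.+1 by rewrite exprn_ge0// ltW.
  have a1 := sig_le1 N; have a2 := sig_le1 N.+1.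
  apply: (@le_trans _ _ (t ^+ N + t ^+ N)); last by nra.
  apply: (le_trans (ler_normB _ _)); apply: lerD.
    by rewrite normrM (ger0_norm tN) ler_piMr.
  apply: (le_trans _ tN1); by rewrite normrM (ger0_norm tN0) ler_piMr.
Qed.

Lemma phi_ge0 u : 0 <= u < 2 -> 0 <= phi u.
Proof.
move=> /andP[u0 u2]; rewrite /phi -atan0 le_atan// divr_ge0 ?mulr_ge0 ?sqrtr_ge0//; lra.
Qed.

Lemma atan_s3 : atan s3 = pi / 3 :> R.
Proof.
have p0 := pi_gt0 R; rewrite -[RHS]tanK; last by rewrite in_itv /=; apply/andP; split; lra.
congr atan; have -> : pi / 3 = pi / 2 - pi / 6 :> R by field.
rewrite /tan sinB cosB sin_pihalf cos_pihalf sin_pi6 cos_pi6.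
by field.
Qed.

Lemma phi1 : phi 1 = pi / 3.
Proof. by rewrite /phi -atan_s3; congr atan; field. Qed.

Lemma phi_itv u : 0 < u <= 1 -> 0 < phi u <= pi / 3.
Proof.
move=> /andP[u0 u1]; have S0 := @s3_gt0 R; apply/andP; split.
  by rewrite /phi -{1}atan0 lt_atan// divr_gt0 ?mulr_gt0//; lra.
rewrite -phi1 /phi le_atan// ler_pdivrMr; last lra.
have -> : s3 * 1 / (2 - 1) * (2 - u) = s3 * (2 - u) by field.
by rewrite ler_pM2l//; lra.
Qed.

(* A primitive of [phi u / u], where [phi u] is the imaginary part of
   [- ln (1 - u zeta6)]; hence [dilA u] is that of the dilogarithm at [u zeta6]. *)
Definition dilA u : R := phi u * ln u + lob (phi u) - lob (phi u + pi / 3) + lob (pi / 3).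

Lemma is_derive_dilA u : 0 < u <= 1 -> is_derive u 1 dilA (phi u / u).
Proof.
have p0 := pi_gt0 R; move=> u01; have /andP[t0 t1] := phi_itv u01; have /andP[u0 u1] := u01.
have d1 : is_derive u 1 phi (s3 / 2 / (1 - u + u ^+ 2)) by apply: is_derive_phi; lra.
move: d1; set p := _ / _ => d1.
have d2 : is_derive u 1 (fun t => lob (phi t)) (- p * ln (2 * sin (phi u))).
  by apply: is_derive_lobc => //; apply/andP; split; lra.
have d3' : is_derive u 1 (fun t => phi t + pi / 3) p by apply: is_derive_eq; rewrite addr0.
have d3 : is_derive u 1 (fun t => lob (phi t + pi / 3)) (- p * ln (2 * sin (phi u + pi / 3))).
  by apply: is_derive_lobc => //; apply/andP; split; lra.
have d4 := is_derive1_ln u0.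
apply: is_derive_eq; rewrite /GRing.scale /=.
have s0 : 0 < sin (phi u) by apply: sin_gt0_pi; apply/andP; split; lra.
have s1 : 0 < sin (phi u + pi / 3) by apply: sin_gt0_pi; apply/andP; split; lra.
have c0 : cos (phi u) != 0 by apply: lt0r_neq0; exact: cos_atan_gt0.
(* The law of sines in the triangle 0, 1, u [zeta6], with angle pi / 3 at 0 and angle phi u at 1. It
   cancels the logarithms in the derivative. *)
have E : sin (phi u) = u * sin (phi u + pi / 3).
  have tE : sin (phi u) / cos (phi u) = s3 * u / (2 - u) by rewrite -/(tan _) atanK.
  have {}tE : sin (phi u) * (2 - u) = s3 * u * cos (phi u).
    have u2 : 2 - u != 0 by apply: lt0r_neq0; lra.
    have := congr1 (fun x => x * cos (phi u) * (2 - u)) tE.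
    by rewrite /= divfK// => ->; field.
  have -> : pi / 3 = pi / 2 - pi / 6 :> R by field.
  rewrite sinD sinB cosB sin_pihalf cos_pihalf sin_pi6 cos_pi6.
  by lra.
rewrite E !lnM ?posrE ?mulr_gt0//; field.
by rewrite gt_eqF.
Qed.

Lemma dilA_cvg0 : dilA x @[x --> (0 : R)] --> (0 : R).
Proof.
have p0 := pi_gt0 R.
have cphi : {for (0 : R), continuous phi}.
  apply: differentiable_continuous; apply/derivable1_diffP.
  have H : is_derive (0:R) 1 phi (s3 / 2 / (1 - 0 + 0 ^+ 2)) by apply: is_derive_phi.
  exact: ex_derive.
have c1 : lob (phi x) @[x --> (0:R)] --> lob (phi 0).
  have c : {for (0:R), continuous (lob \o phi)}; last exact: c.
  by apply: continuous_comp => //; rewrite phi0; apply: continuous_lob; apply/andP; split; lra.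
have c2 : lob (phi x + pi / 3) @[x --> (0:R)] --> lob (phi 0 + pi / 3).
  have c : {for (0:R), continuous (lob \o (fun t => phi t + pi / 3))}; last exact: c.
  apply: continuous_comp; first by apply: cvgD => //; exact: cvg_cst.
  by rewrite phi0; apply: continuous_lob; apply/andP; split; lra.
have E : (0 : R) = 0 + lob (phi 0) - lob (phi 0 + pi / 3) + lob (pi / 3) by rewrite phi0 lob0 !add0r addNr.
rewrite [X in _ --> X]E.
apply: cvgD; last exact: cvg_cst.
apply: cvgB; last exact: c2.
apply: cvgD; last exact: c1.
(* Here 6 = 3 * 2, from phi x <= 3 x, which is [phi_logN] for N = 0, and from [ln_ge_sqrt]. *)
have sq : 6 * Num.sqrt `|x| @[x --> (0:R)] --> 0.
  have H : {for (0:R), continuous (@Num.sqrt R \o (fun x : R => `|x|))}.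
    by apply: continuous_comp; [exact: norm_continuous|exact: sqrt_continuous].
  rewrite -[X in _ --> X](mulr0 6); apply: cvgM; first exact: cvg_cst.
  by move: H; rewrite /prop_for /continuous_at /= normr0 sqrtr0.
have sqN : - (6 * Num.sqrt `|x|) @[x --> (0:R)] --> 0.
  by rewrite -[X in _ --> X]oppr0; exact: cvgN.
apply: (squeeze_cvgr _ sqN sq); near=> x.
have x1 : `|x| < 1 by near: x; apply: (@nbhs0_lt R R).
have [x0|x0] := ltP 0 x; last first.
  by rewrite ln0// mulr0 oppr_le0 mulr_ge0 ?sqrtr_ge0.
rewrite gtr0_norm// in x1 *.
have x01 : 0 <= x <= 1 by rewrite !ltW.
have f0 : 0 <= phi x by apply: phi_ge0; apply/andP; split; lra.
have := phi_logN 0 x01; rewrite /logN big_ord0 subr0 ger0_norm// divr1 expr1 => f3.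
have l0 := ln_ge_sqrt x0; have l1 : ln x <= 0 by rewrite ln_le0 ?ltW.
by apply/andP; split; nra.
Unshelve. all: by end_near. Qed.

Lemma dilA0 : dilA 0 = 0.
Proof. by rewrite /dilA phi0 mul0r lob0 !add0r addNr. Qed.

Lemma dilA1 : dilA 1 = 3 * lob (pi / 3).
Proof.
rewrite /dilA ln1 mulr0 add0r phi1; have -> : pi / 3 + pi / 3 = 2 * (pi / 3) :> R by ring.
by rewrite lob_2pi3; ring.
Qed.

(** The bound of [phi_logN] divided by [t] is integrated once more; an explicit remainder at u = 1
    takes the place of Abel's theorem. *)
Lemma dilA_diloN N : `|3 * lob (pi / 3) - diloN N 1| <= 3 / N.+1%:R ^+ 2.
Proof.
have dd (t : R) : 0 < t <= 1 -> is_derive t 1 (fun t => dilA t - diloN N t) (phi t / t - logN N t / t).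
  move=> t01; have d1 := is_derive_dilA t01; have /andP[t0 _] := t01.
  by have d2 := is_derive_diloN N t0; apply: is_derive_eq.
have := @mean_value_le R (fun t => dilA t - diloN N t) (fun t => 3 / N.+1%:R ^+ 2 * t ^+ N.+1)
  (fun t => phi t / t - logN N t / t) (fun t => 3 / N.+1%:R ^+ 2 * (N.+1%:R * t ^+ N)) 0 1 ler01.
rewrite dilA0 dilA1 diloN0 expr0n /= mulr0 !subr0 expr1n mulr1; apply.
- by move=> t /andP[t0 t1]; apply: dd; rewrite t0 ltW.
- by move=> t _; exact: is_derive_powN.
- apply: continuous_in_subspaceT => t; rewrite inE /= in_itv /= => /andP[].
  rewrite le_eqVlt => /predU1P[<- _|t0 t1].
    apply: cvgB; last exact: continuous_diloN.
    by rewrite dilA0; exact: dilA_cvg0.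
  apply: differentiable_continuous; apply/derivable1_diffP.
  have H : is_derive t 1 (fun t => dilA t - diloN N t) (phi t / t - logN N t / t).
    by apply: dd; rewrite t0 t1.
  exact: ex_derive.
- apply: derivable_within_continuous => t _; have H := is_derive_powN (3 / N.+1%:R ^+ 2) N t.
  exact: ex_derive.
- move=> t /andP[t0 t1]; rewrite -mulrBl normrM normfV (gtr0_norm t0) ler_pdivrMr//.
  have t01 : 0 <= t <= 1 by rewrite !ltW.
  apply: (le_trans (phi_logN N t01)).
  rewrite exprSr le_eqVlt; apply/orP; left; apply/eqP; have : (N.+1%:R : R) != 0 by rewrite pnatr_eq0.
  by move: (N.+1%:R : R) => k k0; field.
Qed.

Lemma cvg_inv_succ : (N.+1%:R : R)^-1 @[N --> \oo] --> (0 : R).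
Proof. exact: cvg_harmonic. Qed.

Lemma cvg_diloN1 : diloN N 1 @[N --> \oo] --> 3 * lob (pi / 3).
Proof.
have H : 3 * (N.+1%:R : R)^-1 @[N --> \oo] --> (0 : R).
  by rewrite -[X in _ --> X](mulr0 3); apply: cvgM; [exact: cvg_cst|exact: cvg_inv_succ].
apply/cvgrPdist_le => e e0; have /cvgrPdist_le/(_ e e0) := H.
apply: filterS => N; rewrite sub0r normrN => HN.
apply: (le_trans (dilA_diloN N)); apply: (le_trans _ HN); apply: (le_trans _ (ler_norm _)).
rewrite ler_pM2l// lef_pV2 ?posrE ?exprn_gt0// expr2 ler_peMr// ?ler1n//.
Qed.

Lemma is_cvg_inv_sqr : cvgn (series (fun n : nat => (n.+1%:R ^+ 2 : R)^-1)).
Proof.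
(* Comparison with the telescoping series of general term 2 / ((n + 1)(n + 2)). *)
pose v (n : nat) : R := 2 * n.+1%:R^-1.
have cv : v N @[N --> \oo] --> (0 : R).
  by rewrite -[X in _ --> X](mulr0 2); apply: cvgM; [exact: cvg_cst|exact: cvg_inv_succ].
pose w n := v n - v n.+1.
have wE n : w n = 2 / (n.+1%:R * n.+2%:R).
  rewrite /w /v; have k0 : (n.+1%:R : R) != 0 by rewrite pnatr_eq0.
  have k1 : (n.+2%:R : R) = n.+1%:R + 1 by rewrite -natr1.
  have k2 : (n.+1%:R + 1 : R) != 0 by rewrite -k1 pnatr_eq0.
  by rewrite k1; move: (n.+1%:R : R) k0 k2 => k k0 k2; field; rewrite k0 k2.
have cw : cvgn (series w).
  apply/cvg_ex; exists (v 0 - 0).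
  have -> : series w = (fun N => v 0 - v N).
    apply/funext => N; rewrite /series /=; elim: N => [|N IH]; first by rewrite big_geq// subrr.
    by rewrite big_nat_recr//= IH /w; ring.
  by apply: cvgB => //; exact: cvg_cst.
apply: (series_le_cvg _ _ _ cw) => n.
- by rewrite invr_ge0 exprn_ge0.
- by rewrite wE divr_ge0// mulr_ge0.
- rewrite wE ler_pdivlMr ?mulr_gt0// ler_pdivrMl ?exprn_gt0//.
  have k1 : (n.+2%:R : R) = n.+1%:R + 1 by rewrite -natr1.
  have k0 : 1 <= n.+1%:R :> R by rewrite ler1n.
  rewrite k1; nra.
Qed.

Lemma cvg_complex (w : nat -> R[i]) (a b : R) :
  complex.Re (w n) @[n --> \oo] --> a -> complex.Im (w n) @[n --> \oo] --> b ->
  w n @[n --> \oo] --> a +i* b.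
Proof.
move=> ca cb; apply/cvgrPdist_lt => -[e e'].
rewrite ltcE /= => /andP[/eqP e'0 e0]; have {e'0} -> : e' = 0 by [].
have e2 : 0 < e / 2 by rewrite divr_gt0.
have /cvgrPdist_lt/(_ _ e2) := ca; have /cvgrPdist_lt/(_ _ e2) := cb.
move=> Hb Ha; near=> n.
have h1 : `|a - complex.Re (w n)| < e / 2 by near: n.
have h2 : `|b - complex.Im (w n)| < e / 2 by near: n.
rewrite (_ : a +i* b - w n = (a - complex.Re (w n)) +i* (b - complex.Im (w n))); last by case: (w n).
move: h1 h2; move: (a - _) (b - _) => x y h1 h2.
have -> : `|x +i* y| = (Num.sqrt (x ^+ 2 + y ^+ 2))%:C by rewrite normc_def.
rewrite ltcR -[ltRHS]gtr0_norm// -sqrtr_sqr ltr_sqrt ?exprn_gt0//.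
rewrite -[x ^+ 2]real_normK ?num_real// -[y ^+ 2]real_normK ?num_real//.
have := normr_ge0 x; have := normr_ge0 y; nra.
Unshelve. all: by end_near. Qed.

(** A limit in [R[i]] requires the real parts to converge as well, hence the comparison with the
    series of inverse squares. *)
Lemma Im_dilog : complex.Im (dilog zeta6) = 3 * lob (pi / 3).
Proof.
rewrite /dilog; set w := series _.
have wE N : w N = (\sum_(n < N) complex.Re (zeta6 ^+ n.+1) / n.+1%:R ^+ 2) +i* diloN N 1.
  rewrite /w /series /= big_mkord /diloN; elim: N => [|N IH]; first by rewrite !big_ord0.
  rewrite !big_ord_recr /= IH expr1n mul1r.
  have -> : zeta6 ^+ N.+1 / N.+1%:R ^+ 2 = (complex.Re (zeta6 ^+ N.+1) / N.+1%:R ^+ 2) +i* (sig N.+1 / N.+1%:R ^+ 2).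
    rewrite /sig; case: (zeta6 ^+ N.+1) => x y.
    have -> : (N.+1%:R ^+ 2 : R[i])^-1 = ((N.+1%:R ^+ 2)^-1)%:C by rewrite fmorphV rmorphXn rmorph_nat.
    by apply/eqP; rewrite eq_complex /=; apply/andP; split; apply/eqP; ring.
  by apply/eqP; rewrite eq_complex /= !eqxx.
have cRe : cvgn (fun N => \sum_(n < N) complex.Re (zeta6 ^+ n.+1) / n.+1%:R ^+ 2 : R).
  have -> : (fun N => \sum_(n < N) complex.Re (zeta6 ^+ n.+1) / n.+1%:R ^+ 2 : R) =
      series (fun n => complex.Re (zeta6 ^+ n.+1) / n.+1%:R ^+ 2).
    by apply/funext => N; rewrite /series /= big_mkord.
  apply: normed_cvg; apply: (series_le_cvg _ _ _ is_cvg_inv_sqr) => n /=.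
  - exact: normr_ge0.
  - by rewrite invr_ge0 exprn_ge0.
  - rewrite normrM normfV [`|_ ^+ 2|]ger0_norm ?exprn_ge0// ler_piMl ?invr_ge0 ?exprn_ge0//.
    by case: (zeta6X_le1 n.+1).
have /cvg_ex[a ca] := cRe.
have cw : w n @[n --> \oo] --> (a +i* (3 * lob (pi / 3)) : R[i]).
  apply: cvg_complex.
    by under eq_fun do rewrite wE /=.
  under eq_fun do rewrite wE /=; exact: cvg_diloN1.
have H : hausdorff_space R[i] by exact: norm_hausdorff.
by rewrite (cvg_lim H cw).
Qed.

End Dilogarithm.

(** * The density *)

Section Density.
Context {R : realType}.
Notation s3 := (Num.sqrt 3 : R).

Definition shape (t : R) : R :=
       (0 < t < 1)%R%:R * (t ^+ 3 * (Num.sqrt 3 / 2))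
     + (1 < t < (4 / 3) `^ (1 / 4))%R%:R *
         (t ^+ 3 * (Num.sqrt 3 / 2 - pi * (1 - 1 / t ^+ 4)))
     + ((4 / 3) `^ (1 / 4) < t < (3 / 2) `^ (1 / 4))%R%:R *
         (t ^+ 3 * (Num.sqrt 3 / 2 - pi * (1 - 1 / t ^+ 4)
            + 6 * (1 - 1 / t ^+ 4) * atan (Num.sqrt (3 - 4 / t ^+ 4))
            - 3 / 2 * Num.sqrt (3 - 4 / t ^+ 4))).

Lemma powR4 (a : R) : 0 <= a -> (a `^ (1 / 4)) ^+ 4 = a.
Proof. by move=> a0; rewrite -powR_mulrn ?powR_ge0// -powRrM div1r mulVf// powRr1. Qed.

Lemma lt_powR4 (a t : R) : 0 <= a -> 0 <= t -> (t < a `^ (1 / 4)) = (t ^+ 4 < a).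
Proof.
move=> a0 t0; rewrite -[X in _ = (_ < X)](powR4 a0).
by rewrite ltr_pXn2r// nnegrE// powR_ge0.
Qed.

Lemma gt_powR4 (a t : R) : 0 <= a -> 0 <= t -> (a `^ (1 / 4) < t) = (a < t ^+ 4).
Proof.
move=> a0 t0; rewrite -[X in _ = (X < _)](powR4 a0).
by rewrite ltr_pXn2r// nnegrE// powR_ge0.
Qed.

Lemma qrE (t : R) : qr (1 - t ^- 4) = Num.sqrt (3 - 4 / t ^+ 4).
Proof. by rewrite /qr; congr Num.sqrt; ring. Qed.

(** The open ranges omit t^4 = 1 and t^4 = 4/3, where [shape] is 0 but [Wr] is positive; so the
    agreement with [mdens] is stated off a finite set. *)
Lemma shape_branches (t : R) : 0 < t ->
  shape t = t ^+ 3 *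
    if t ^+ 4 < 1 then 6 * Wr (1 - t ^- 4)
    else if (1 < t ^+ 4) && (t ^+ 4 != 4 / 3) && (t ^+ 4 < 3 / 2) then 6 * Wr (1 - t ^- 4)
    else 0.
Proof.
move=> t0; have t0' := ltW t0.
have T0 : 0 < t ^+ 4 by rewrite exprn_gt0.
have t1 : (t < 1) = (t ^+ 4 < 1) by rewrite -[X in _ = (_ < X)](expr1n _ 4) ltr_pXn2r// nnegrE.
have t2 : (1 < t) = (1 < t ^+ 4) by rewrite -[X in _ = (X < _)](expr1n _ 4) ltr_pXn2r// nnegrE.
rewrite /shape -qrE t0 t1 t2 !lt_powR4// ?gt_powR4//; rewrite ![1 / t ^+ 4]div1r.
move: (t ^+ 4) (t ^+ 3) T0 {t1 t2} => T t3 T0.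
have TV : 0 < T^-1 by rewrite invr_gt0.
have TT : T * T^-1 = 1 by rewrite mulfV// gt_eqF.
have [h1|h1] := ltP T 1.
  have -> : (1 < T) = false by apply/negbTE; rewrite -leNgt ltW.
  have -> : (4 / 3 < T) = false by apply/negbTE; rewrite -leNgt; lra.
  rewrite !andFb mul1r !mul0r !addr0 Wr_neg//; nra.
rewrite mul0r add0r; have [h2|h2] := ltP 1 T; last first.
  have -> : (4 / 3 < T) = false by apply/negbTE; rewrite -leNgt; lra.
  by rewrite /= !mul0r addr0 mulr0.
have [h3|h3|h3] := ltgtP T (4 / 3).
- have -> : T < 3 / 2 by lra.
  by rewrite /= mul1r mul0r addr0 Wr_mid; [|nra..].
- rewrite /= mul0r add0r; have [h4|h4] := ltP T (3 / 2); last by rewrite mul0r mulr0.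
  by rewrite mul1r Wr_hi; [|nra..].
- by rewrite /= !mul0r addr0 mulr0.
Qed.

Lemma shape_neg (t : R) : t <= 0 -> shape t = 0.
Proof.
move=> t0; rewrite /shape.
have -> : (0 < t) = false by rewrite ltNge t0.
have -> : (1 < t) = false by rewrite ltNge (le_trans t0).
have -> : ((4 / 3) `^ (1 / 4) < t) = false by rewrite ltNge (le_trans t0)// powR_ge0.
by rewrite /= !mul0r !addr0.
Qed.

Lemma shape_ge0 t : 0 <= shape t.
Proof.
have [t0|t0] := leP t 0; first by rewrite shape_neg.
rewrite shape_branches// mulr_ge0 ?exprn_ge0 ?(ltW t0)//.
by case: ifP => _; [|case: ifP => _//]; rewrite mulr_ge0// Wr_ge0.
Qed.

(** Both sides are 8 t^3 Wr(1 - t^-4) / lob(pi / 3) for t > 0: on the left 6 divided by 3/4, on the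
    right 4 from the radial density times 2 from the two halves of the bowtie. *)
Lemma shape_mdens (t : R) : t != 1 -> t != (4 / 3) `^ (1 / 4) -> t != (3 / 2) `^ (1 / 4) ->
  (4^-1 * (3 * lob (pi / 3)))^-1 * shape t = (cball * lob (pi / 3))^-1 * mdens t.
Proof.
move=> n1 n2 n3; have L0 := lt0r_neq0 (@lob_pi3_gt0 R); have c0 := lt0r_neq0 (@cball_gt0 R).
have [t0|t0] := leP t 0.
  by rewrite shape_neg// /mdens /rdens max_r// expr0n /= !(mulr0, mul0r).
have t0' := ltW t0.
have neq (a : R) : 0 <= a -> t != a `^ (1 / 4) -> t ^+ 4 != a.
  move=> a0; apply: contra_neq => E; apply/eqP; rewrite eq_le !leNgt gt_powR4// lt_powR4// E ltxx//.
have m1 : t ^+ 4 != 1.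
  by apply: contra_neq n1 => /eqP; rewrite pexpr_eq1// => /eqP.
have m2 := neq (4 / 3) _ n2; have m3 := neq (3 / 2) _ n3.
have {}m2 : t ^+ 4 != 4 / 3 by apply: m2; lra.
have {}m3 : t ^+ 4 != 3 / 2 by apply: m3; lra.
have T0 : 0 < t ^+ 4 by rewrite exprn_gt0.
suff -> : shape t = t ^+ 3 * (6 * Wr (1 - t ^- 4)).
  by rewrite /mdens /rdens max_l//; field; rewrite L0 c0.
rewrite shape_branches//; congr (_ * _).
case: (ltgtP (t ^+ 4) 1) m1 => //= h1 _; rewrite m2 /=.
case: (ltgtP (t ^+ 4) (3 / 2)) m3 => //= h3 _.
rewrite Wr_out ?mulr0//; have TV : 0 < t ^- 4 by rewrite invr_gt0.
have TT : t ^+ 4 * t ^- 4 = 1 by rewrite mulfV// gt_eqF.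
move: (t ^+ 4) (t ^- 4) TT TV T0 h1 h3 => T V TT TV T0 h1 h3; nra.
Qed.

Lemma measurable_shape : measurable_fun setT shape.
Proof.
have m3 : measurable_fun setT (fun t : R => t ^+ 3) by exact: measurable_funX.
have m4 : measurable_fun setT (fun t : R => (t ^+ 4)^-1).
  by apply: (measurableT_comp measurable_invr); exact: measurable_funX.
have m1 (c : R) : measurable_fun setT (fun t : R => c / t ^+ 4) by exact: measurable_funM.
have mb (x y : R) : measurable_fun setT (fun t : R => (x < t < y)%R%:R : R).
  by apply/measurable_EFinP; apply: measurable_ifE; apply: measurable_and; exact: measurable_fun_ltr.
have mr : measurable_fun setT (fun t : R => 1 - 1 / t ^+ 4) by exact: measurable_funB.
have mq : measurable_fun setT (fun t : R => Num.sqrt (3 - 4 / t ^+ 4)).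
  by apply: (measurableT_comp measurable_sqrtr); exact: measurable_funB.
have ma : measurable_fun setT (fun t : R => atan (Num.sqrt (3 - 4 / t ^+ 4))).
  have mat : measurable_fun setT (@atan R).
    by apply: continuous_measurable_fun => x; exact: continuous_atan.
  exact: (measurableT_comp mat mq).
have mp : measurable_fun setT (fun t : R => s3 / 2 - pi * (1 - 1 / t ^+ 4)).
  by apply: measurable_funB => //; exact: measurable_funM.
apply: measurable_funD; [apply: measurable_funD|]; apply: measurable_funM => //; apply: measurable_funM => //.
apply: measurable_funB; last exact: measurable_funM.
apply: measurable_funD => //; apply: measurable_funM => //; exact: measurable_funM.
Qed.

End Density.

Theorem proposition21 (R : realType) (mu : probability (coset_borel R) R)
    (mu_inv : SL2C_invariant mu)
    (d : measure_display) (Omega : measurableType d) (P : probability Omega R)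
    (g : Omega -> SL2C R) (g_law : has_law P (fun w => coset_of (g w)) mu) :
  let v : R := 4^-1 * complex.Im (dilog ((1 +i* Num.sqrt 3) / 2)) in
  has_density P (fun w => shortest_length (lattice_of (g w)))
    (fun t : R => v^-1 * (
       (0 < t < 1)%R%:R * (t ^+ 3 * (Num.sqrt 3 / 2))
     + (1 < t < (4 / 3) `^ (1 / 4))%R%:R *
         (t ^+ 3 * (Num.sqrt 3 / 2 - pi * (1 - 1 / t ^+ 4)))
     + ((4 / 3) `^ (1 / 4) < t < (3 / 2) `^ (1 / 4))%R%:R *
         (t ^+ 3 * (Num.sqrt 3 / 2 - pi * (1 - 1 / t ^+ 4)
            + 6 * (1 - 1 / t ^+ 4) * atan (Num.sqrt (3 - 4 / t ^+ 4))
            - 3 / 2 * Num.sqrt (3 - 4 / t ^+ 4))))).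
Proof.
move=> v; have vE : v = 4^-1 * (3 * lob (pi / 3)) by rewrite /v -/zeta6 Im_dilog.
have v0 : 0 < v by rewrite vE mulr_gt0// mulr_gt0// lob_pi3_gt0.
rewrite -/(fun t : R => v^-1 * shape t).
have [mg gE] := g_law.
(* The law concerns the coset of [g w], so the length is factored through the coset by means of the
   section. *)
have XE : (fun w => shortest_length (lattice_of (g w))) = (fun w => ell (lift (coset_of (g w)))).
  by apply/funext => w; apply: ell_coset; rewrite liftK.
have mf : measurable_fun setT (fun t : R => v^-1 * shape t).
  by apply: measurable_funM => //; exact: measurable_shape.
rewrite XE; split => //.
- exact: (measurableT_comp measurable_ell_lift mg).
- by move=> t; rewrite mulr_ge0 ?shape_ge0// invr_ge0 ltW.
- move=> A mA.
  transitivity (ell_law mu A); first exact: (gE _ (measurable_ell_set mA)).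
  rewrite (ell_law_density mu_inv mA); apply: ge0_ae_eq_integral => //.
  + by apply: measurable_funTS; apply/measurable_EFinP; apply: measurable_funM => //; exact: measurable_mdens.
  + by apply: measurable_funTS; exact/measurable_EFinP.
  + move=> t _; rewrite lee_fin mulr_ge0 ?mdens_ge0// invr_ge0 mulr_ge0 ?ltW ?cball_gt0 ?lob_pi3_gt0//.
  + by move=> t _; rewrite lee_fin mulr_ge0 ?shape_ge0// invr_ge0 ltW.
  (* The breakpoints of the density form a null set, outside of which the two integrands agree. *)
  pose N : set R := [set 1] `|` ([set (4 / 3) `^ (1 / 4)] `|` [set (3 / 2) `^ (1 / 4)]).
  have cN : countable N.
    by apply: finite_set_countable; rewrite !finite_setU; do !split; exact: finite_set1.
  exists N; split; first exact: countable_measurable.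
    exact: countable_lebesgue_measure0.
  move=> t /=; apply: contra_notP => tN _; congr EFin; rewrite vE; apply/esym/shape_mdens;
    apply/eqP => tE; apply: tN; rewrite /N tE; by [left|right; left|right; right].
Qed.
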